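(* Let $G=(V,E)$ be an input graph with arboricity $a$ in the Node-Capacitated Clique model. There is an algorithm that computes a maximal matching of $G$ in $O((a+\log n)\log n)$ rounds, w.h.p.
   Context: Node-Capacitated Clique model: a set $V$ of $n$ nodes with unique identifiers from $\{0,\dots,n-1\}$, all known to every node; synchronous rounds; per round each node may perform arbitrary local computation and send distinct messages of $O(\log n)$ bits to up to $O(\log n)$ other nodes, and receives at most $O(\log n)$ messages (excess dropped arbitrarily). Initially each node knows only the identifiers of its neighbors in $G$. Shared (pseudo-)random hash functions behave as perfectly random functions. Arboricity: minimum number of forests partitioning the edge set. A maximal matching is a set $M\subseteq E$ of pairwise node-disjoint edges not contained in any larger such set; each node learns which of its incident edges (if any) is in $M$. ''W.h.p.'' means with probability at least $1-1/n^c$ for any fixed constant $c>0$. *)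

(* Defs.v *)
From mathcomp Require Import all_boot.

Set Implicit Arguments.
Unset Strict Implicit.
Unset Printing Implicit Defensive.

Definition lg (n : nat) : nat := up_log 2 n.

(* Model capacity: with model constant kappa, each node sends/receives at most
   kappa * lg n messages per round, each of at most kappa * lg n bits. *)
Definition cap (kappa n : nat) : nat := kappa * lg n.

(* A "mailbox" for n nodes: entry u is the (optional) message to/from node u.
   At most one message per (sender, receiver) pair ("distinct messages to up to
   O(log n) other nodes"). Messages are natural numbers (bit strings). *)
Definition mailbox (n : nat) := {ffun 'I_n -> option nat}.

Definition nmsgs n (m : mailbox n) : nat := #|[pred u | m u != None]|.

Definition send_ok (kappa n : nat) (m : mailbox n) : bool :=
  (nmsgs m <= cap kappa n) &&
  [forall u, if m u is Some x then x < 2 ^ cap kappa n else true].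

(* A randomized NCC algorithm (uniform in n).  Randomness: a shared, uniformly
   random bit string of length rbits n (models the shared perfectly random hash
   functions; private randomness is a special case).  Node states are of an
   arbitrary type (arbitrary local computation). *)
Record NCCAlg (kappa : nat) := {
  rbits : nat -> nat;
  St : nat -> Type;
  (* initial knowledge: n, the random string, own id, ids of neighbors *)
  init : forall n, {ffun 'I_(rbits n) -> bool} -> 'I_n -> {set 'I_n} -> St n;
  (* messages sent in a round (indexed by destination) *)
  send : forall n, St n -> mailbox n;
  (* state update from the messages received (indexed by sender) *)
  recv : forall n, St n -> mailbox n -> St n;
  halted : forall n, St n -> bool;
  (* the node's output: its partner in the matching, if any *)
  output : forall n, St n -> option 'I_n;
  send_valid : forall n (s : St n), send_ok kappa (send s)
}.

Definition Seed kappa (A : NCCAlg kappa) (n : nat) :=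
  {ffun 'I_(rbits A n) -> bool}.

Definition delivery_ok (kappa n : nat) (inc del : mailbox n) : Prop :=
  (forall u, del u = inc u \/ del u = None) /\
  nmsgs del <= cap kappa n /\
  (nmsgs inc <= cap kappa n -> del = inc).

(* The (omniscient) adversary choosing which messages are dropped:
   round, random string, receiver, incoming messages |-> delivered messages. *)
Definition Adversary kappa (A : NCCAlg kappa) (n : nat) :=
  nat -> Seed A n -> 'I_n -> mailbox n -> mailbox n.

Definition adversary_ok kappa (A : NCCAlg kappa) n (adv : Adversary A n) : Prop :=
  forall (t : nat) (om : Seed A n) (w : 'I_n) (inc : mailbox n),
    delivery_ok kappa inc (adv t om w inc).

Section Exec.
Variables (kappa : nat) (A : NCCAlg kappa) (n : nat) (e : rel 'I_n)
          (adv : Adversary A n) (om : Seed A n).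

Definition config := 'I_n -> St A n.

Definition incoming (cfg : config) (w : 'I_n) : mailbox n :=
  [ffun u => if halted (cfg u) then None else send (cfg u) w].

Definition round (t : nat) (cfg : config) : config :=
  fun w => if halted (cfg w) then cfg w
           else recv (cfg w) (adv t om w (incoming cfg w)).

Fixpoint exec (t : nat) : config :=
  match t with
  | 0 => fun v => init om v [set u | e v u]
  | t'.+1 => round t' (exec t')
  end.
End Exec.

(* p v = Some u means "edge {v,u} is in M" as learned by v. p encodes a
   maximal matching M of the graph e. *)
Definition is_maximal_matching n (e : rel 'I_n) (p : 'I_n -> option 'I_n) : bool :=
  [forall v, forall u, (p v == Some u) ==> e v u && (p u == Some v)] &&
  [forall u, forall v, e u v ==> (p u != None) || (p v != None)].

Definition success kappa (A : NCCAlg kappa) n (e : rel 'I_n)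
    (adv : Adversary A n) (T : nat) (om : Seed A n) : bool :=
  let cfg := exec e adv om T in
  [forall v, halted (cfg v)] && is_maximal_matching e (fun v => output (cfg v)).

Definition is_forest n (F : rel 'I_n) : Prop :=
  ~ exists s : seq 'I_n, [/\ 2 < size s, uniq s & cycle F s].

Definition forest_decomposable n (e : rel 'I_n) (k : nat) : Prop :=
  exists col : 'I_n -> 'I_n -> 'I_k,
    (forall u v, col u v = col v u) /\
    (forall i : 'I_k, is_forest [rel u v | e u v && (col u v == i)]).

Definition arboricity n (e : rel 'I_n) (a : nat) : Prop :=
  forest_decomposable e a /\ (forall k, forest_decomposable e k -> a <= k).

(* Main.v *)
Require Import Defs.
From mathcomp Require Import all_boot zify.
Set Implicit Arguments.
Unset Strict Implicit.
Unset Printing Implicit Defensive.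

(** Let [L = lg n].  The basic tool is aggregation: every node contributes O(L)
    tokens, each addressed to a pair (node, bucket), and every addressee learns the
    number, the sum and the maximum of the identifiers that reach each of its
    buckets.  The tokens of one pair climb a binary tree on the bits of the
    contributors' identifiers, whose inner vertices are hosted by shared random
    nodes; a union bound over small sets of tree vertices shows that no node is ever
    overloaded, so that one aggregation costs O(L) rounds.

    The arboricity being unknown, stage j works with the guess D = 2^j L, and a
    global disjunction at its end decides whether to go on with a doubled guess.  A
    stage first orients the edges with outdegree O(D).  Nodes are heads or tails at
    random, and pairs are sampled into L buckets at rate 2^-j / 16.  A head that owns
    an oriented edge to the tail v reports itself to the bucket of that edge; v then
    subtracts what it is told from what it knows about all of its neighbours, and
    when a single candidate is left in a bucket, v recovers it from the sum of the
    identifiers and orients that edge outwards.  Only nodes with at most 8D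
    neighbours that are not in-neighbours do so, which bounds the outdegree
    and hence the number of tokens.  When the arboricity is at most D, most remaining
    edges have such an endpoint, so the expected number of unoriented edges decreases
    by a factor 1 - 2^-(j+9) per step, and O(D) steps suffice.

    Given the orientation, an unmatched tail proposes in each step to one of its
    out-neighbours among the heads, and an unmatched head accepts one of the
    proposals it receives.  Afterwards one endpoint of the proposed edge is matched,
    hence the edge is done with; the sum over u of 2^(edges left at u) shrinks by 7/8
    in expectation, and again O(D) steps suffice.  Both potentials are turned into
    probabilities by Markov's inequality. *)

(** * Counting *)

(** The values of a uniformly random function at distinct points are independent, so constraints of
    probability [1 / q] at the points of [D] hold together with probability [q ^ -|D|]. Here and
    below probabilities are kept division-free: an event of size [s] with [s * d <= #|T|] has
    probability at most [1 / d]. *)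
Lemma card_ffun_constrained (X Z : finType) (D : {set X}) (A : X -> {set Z}) (q : nat) :
  (forall d, d \in D -> #|A d| * q = #|Z|) ->
  #|[set h : {ffun X -> Z} | [forall d in D, h d \in A d]]| * q ^ #|D|
    = #|{ffun X -> Z}|.
Proof.
move=> hA.
pose F x : pred Z := [pred z | (x \in D) ==> (z \in A x)].
have -> : #|[set h : {ffun X -> Z} | [forall d in D, h d \in A d]]| = #|family F|.
  rewrite cardsE; apply: eq_card => h; rewrite !inE.
  by apply/forallP/familyP => hh x; have := hh x; rewrite inE.
have -> : q ^ #|D| = \prod_x (if x \in D then q else 1).
  by rewrite -big_mkcond prod_nat_const.
rewrite card_family foldrE big_map big_enum /= card_ffun -[RHS]prod_nat_const -big_split /=.
apply: eq_bigr => x _; case: ifP => xD.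
  by rewrite -(hA x xD); congr muln; apply: eq_card => z; rewrite !inE xD.
by rewrite muln1; apply: eq_card => z; rewrite !inE xD.
Qed.

Lemma card_bigcup_leq (I T : finType) (P : pred I) (F : I -> {set T}) :
  #|\bigcup_(i | P i) F i| <= \sum_(i | P i) #|F i|.
Proof.
elim/big_rec2: _ => [|i k A _ leAk]; first by rewrite cards0.
by rewrite (leq_trans (leq_card_setU _ _)) // leq_add2l.
Qed.

(** Union bound. *)
Lemma card_exists_mul_leq (I T : finType) (P : pred I) (E : I -> pred T) (d k : nat) :
  (forall i, P i -> #|[set t | E i t]| * d <= k) ->
  #|[set t | [exists (i | P i), E i t]]| * d <= #|P| * k.
Proof.
move=> hE; apply: leq_trans (_ : (\sum_(i | P i) #|[set t | E i t]|) * d <= _).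
  rewrite leq_mul2r; apply/orP; right.
  apply: leq_trans (card_bigcup_leq P (fun i => [set t | E i t])).
  apply: subset_leq_card; apply/subsetP => t; rewrite inE => /existsP[i /andP[Pi Et]].
  by apply/bigcupP; exists i => //; rewrite inE.
by rewrite big_distrl /= -sum_nat_const; apply: leq_sum.
Qed.

(** If at least [k] events occur, then some [k]-subset of them occurs entirely; union bound over
    these subsets. *)
Lemma card_many_events (C T : finType) (I : {set C}) (E : C -> pred T) (k d : nat) :
  (forall J : {set C}, J \subset I -> #|J| = k ->
     #|[set t | [forall c in J, E c t]]| * d <= #|T|) ->
  #|[set t | k <= #|[set c in I | E c t]|]| * d <= 'C(#|I|, k) * #|T|.
Proof.
move=> hE; rewrite -(cards_draws I k).
set P := [set A : {set C} | _ & _].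
apply: leq_trans (_ : #|[set t | [exists J in P, [forall c in J, E c t]]]| * d <= _).
  rewrite leq_mul2r; apply/orP; right; apply: subset_leq_card.
  apply/subsetP => t; rewrite !inE => hk.
  have [J hJ sJ] : exists2 J : {set C}, #|J| = k & J \subset [set c in I | E c t].
    have : 0 < #|[set J : {set C} | J \subset [set c in I | E c t] & #|J| == k]|.
      by rewrite cards_draws bin_gt0.
    by case/card_gt0P => J; rewrite inE => /andP[sJ /eqP]; exists J.
  apply/existsP; exists J; rewrite !inE hJ eqxx andbT; apply/andP; split.
    by apply/subsetP => c /(subsetP sJ); rewrite inE => /andP[].
  by apply/forall_inP => c /(subsetP sJ); rewrite inE => /andP[].
apply: card_exists_mul_leq => J; rewrite inE => /andP[sJ /eqP cJ]; exact: hE.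
Qed.

Lemma ffact_leq_exp b i : b ^_ i <= b ^ i.
Proof.
elim: i b => [|i IH] b; first by rewrite ffactn0.
rewrite ffactnS expnS; apply: leq_mul => //.
by apply: leq_trans (IH _) _; case: (i) => [|i']; rewrite ?expn0 ?leq_exp2r ?leq_pred.
Qed.

Lemma bin_leq_exp a k : 'C(a, k) <= a ^ k.
Proof.
by apply: leq_trans (ffact_leq_exp a k); rewrite -bin_ffact leq_pmulr ?fact_gt0.
Qed.

(** The usual estimate of a binomial by a power of [e * a / k], with 4 in place of [e]: [k ^ k] is
    at most [(2k)! / k!], which is the central binomial times [k!], hence at most [4 ^ k * k!]. *)
Lemma bin_exp_leq (a k : nat) : 'C(a, k) * k ^ k <= (4 * a) ^ k.
Proof.
have le_ffact b i : b ^ i <= (b + i) ^_ i.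
  elim: i => [|i IH]; first by rewrite ffactn0.
  rewrite addnS ffactnS expnS; apply: leq_mul => //; lia.
have h1 : k ^ k <= 'C(k + k, k) * k`!.
  by rewrite bin_ffact; exact: le_ffact.
have h2 : 'C(k + k, k) <= 4 ^ k.
  have -> : 4 ^ k = (1 + 1) ^ (k + k) by rewrite -[1 + 1]/2 -[4]/(2 ^ 2) -expnM mul2n addnn.
  rewrite expnDn (bigD1 (inord k)) //= !exp1n !muln1 inordK; last by lia.
  exact: leq_addr.
rewrite expnMn; apply: leq_trans (_ : 'C(a, k) * ('C(k + k, k) * k`!) <= _).
  by rewrite leq_mul2l h1 orbT.
by rewrite mulnCA bin_ffact leq_mul ?ffact_leq_exp.
Qed.

(** Bernoulli's inequality for [(1 + 1 / q) ^ q]. It converts a decay by [1 - 1 / (q + 1)] per step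
    into a halving every [q + 1] steps. *)
Lemma halving_exp (q : nat) : 2 * q ^ q.+1 <= q.+1 ^ q.+1.
Proof.
have bern k x : x ^ k * x + k * x ^ k <= x.+1 ^ k * x.
  elim: k => [|k IH]; first by rewrite !expn0; lia.
  rewrite !expnS; nia.
have := bern q q; rewrite [q.+1 ^ q.+1]expnSr [q ^ q.+1]expnSr.
move=> h; nia.
Qed.

Lemma card_preim_bij (A B : finType) (f : A -> B) (P : pred B) :
  bijective f -> #|[set a | P (f a)]| = #|[set b | P b]|.
Proof.
move=> bf; rewrite -(@on_card_preimset _ _ f); last exact: onW_bij.
by apply: eq_card => a; rewrite !inE.
Qed.

(** * Iterating a random step *)

Section Chain.
Variables (Y : finType) (X : Type) (f : X -> Y -> X) (inv : X -> Prop).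
Hypothesis inv_step : forall x y, inv x -> inv (f x y).

Lemma sum_tuple_cons T (F : T.+1.-tuple Y -> nat) :
  \sum_w F w = \sum_y \sum_(w : T.-tuple Y) F (cons_tuple y w).
Proof.
rewrite pair_big /= (reindex (fun p : Y * T.-tuple Y => cons_tuple p.1 p.2)) //=.
exists (fun w => (thead w, behead_tuple w)) => [[y w] _|w _] /=.
  by rewrite theadE; congr pair; apply: val_inj.
by rewrite [RHS]tuple_eta; apply: val_inj.
Qed.

(** The expectation of [phi] shrinks by [a / b] at every step, by averaging over the first coin and
    induction. The tape has a fixed length [T] of which only a prefix is consumed, as all stages
    share one tape. *)
Lemma chain_decay (phi : X -> nat) (a b : nat) :
  (forall x, inv x -> b * \sum_y phi (f x y) <= a * #|Y| * phi x) ->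
  forall T t x, t <= T -> inv x ->
  b ^ t * \sum_(w : T.-tuple Y) phi (foldl f x (take t w)) <= a ^ t * #|Y| ^ T * phi x.
Proof.
move=> hphi; elim=> [|T IH] [|t] x // lt ix.
- rewrite (eq_bigr (fun=> phi x)) => [|w _]; last by rewrite take0.
  by rewrite sum_nat_const card_tuple !expn0 !mul1n.
- rewrite (eq_bigr (fun=> phi x)) => [|w _]; last by rewrite take0.
  by rewrite sum_nat_const card_tuple !expn0 !mul1n.
rewrite sum_tuple_cons /= expnS -mulnA big_distrr /=.
apply: leq_trans (_ : b * \sum_y a ^ t * #|Y| ^ T * phi (f x y) <= _).
  rewrite leq_mul2l; apply/orP; right; apply: leq_sum => y _.
  by apply: IH => //; exact: inv_step.
rewrite -big_distrr /= mulnCA.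
apply: leq_trans (_ : a ^ t * #|Y| ^ T * (a * #|Y| * phi x) <= _).
  by rewrite leq_mul2l hphi ?orbT.
by rewrite !expnS (mulnACA a) mulnA [X in X * phi x <= _]mulnC.
Qed.

Variable bad : X -> Y -> bool.

Fixpoint has_bad (x : X) (l : seq Y) : bool :=
  if l is y :: l' then bad x y || has_bad (f x y) l' else false.

Lemma has_badPn y0 x l s :
  ~~ has_bad x l -> s < size l -> ~~ bad (foldl f x (take s l)) (nth y0 l s).
Proof.
elim: l x s => [|y l IH] x [|s] //=; first by rewrite negb_or => /andP[].
by rewrite negb_or => /andP[_ h]; exact: IH.
Qed.

(** Union bound over the steps: whether a coin is bad depends on the state reached so far, but for
    each such state it is bad with probability at most [1 / d]. *)
Lemma chain_union (d : nat) :
  (forall x, inv x -> #|[set y | bad x y]| * d <= #|Y|) ->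
  forall T t x, t <= T -> inv x ->
  #|[set w : T.-tuple Y | has_bad x (take t w)]| * d <= t * #|Y| ^ T.
Proof.
move=> hbad.
have cardE T (P : pred (T.-tuple Y)) : #|[set w | P w]| = \sum_w P w.
  by rewrite -sum1_card big_mkcond /=; apply: eq_bigr => w _; rewrite inE; case: (P w).
elim=> [|T IH] [|t] x // lt ix.
- by rewrite cardE big1 // => w _; rewrite take0.
- by rewrite cardE big1 // => w _; rewrite take0.
rewrite cardE sum_tuple_cons /=.
apply: leq_trans
  (_ : (\sum_y (bad x y * #|Y| ^ T + #|[set w : T.-tuple Y | has_bad (f x y) (take t w)]|)) * d <= _).
  rewrite leq_mul2r; apply/orP; right; apply: leq_sum => y _.
  rewrite cardE; case: (bad x y) => //=.
  by rewrite sum_nat_const card_tuple muln1 mul1n leq_addr.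
rewrite big_split /= mulnDl mulSn leq_add //.
  rewrite -big_distrl /= mulnAC expnS leq_mul2r; apply/orP; right.
  apply: leq_trans (hbad x ix); rewrite leq_mul2r; apply/orP; right.
  rewrite -sum1_card [X in _ <= X]big_mkcond /=; apply: leq_sum => y _.
  by rewrite inE; case: (bad x y).
rewrite big_distrl /= expnS mulnCA -sum_nat_const; apply: leq_sum => y _.
by apply: IH => //; exact: inv_step.
Qed.
End Chain.

(** * Arboricity and edge density *)

Section Density.
Variables (n : nat).
Implicit Types (F e : rel 'I_n) (W : {set 'I_n}).

Definition pairs_in F W : {set 'I_n * 'I_n} :=
  [set p | [&& p.1 \in W, p.2 \in W & F p.1 p.2]].

(* Otherwise a simple path inside [W] could be prolonged forever. *)
Lemma forest_leaf F W : symmetric F -> irreflexive F -> is_forest F ->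
  W != set0 -> exists2 w, w \in W & #|[set u in W | F w u]| <= 1.
Proof.
move=> symF irrF forestF /set0Pn[w0 w0W].
case: (boolP [exists w in W, #|[set u in W | F w u]| <= 1]) => [/exists_inP[w]|].
  by exists w.
rewrite negb_exists => /forallP hdeg; exfalso.
have deg2 w : w \in W -> 1 < #|[set u in W | F w u]|.
  by move=> wW; have := hdeg w; rewrite wW ltnNge.
have long k : exists x p, [/\ size p = k, uniq (x :: p), path F x p & {subset x :: p <= W}].
  elim: k => [|k [x [p [sp up pp sW]]]].
    by exists w0, [::]; split=> // y; rewrite inE => /eqP->.
  have xW : x \in W by apply: sW; rewrite mem_head.
  (* A neighbour of the end [x] other than its successor on the path: either it prolongs the path,
     or it lies on the path and closes a cycle. *)
  have [y yW nyp] : exists2 y, y \in [set u in W | F x u] & y != head x p.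
    have /card_gt0P[y] : 0 < #|[set u in W | F x u] :\ head x p|.
      have := deg2 x xW; rewrite (cardsD1 (head x p)) => h.
      by rewrite -(ltn_add2l 1); apply: leq_trans h _; rewrite leq_add2r leq_b1.
    by rewrite !inE => /andP[ny yW]; exists y => //; rewrite inE.
  move: yW; rewrite inE => /andP[yW Fxy].
  case: (boolP (y \in x :: p)) => [yp|nyp']; last first.
    exists y, (x :: p); split=> //=; first by rewrite sp.
    - by rewrite nyp'.
    - by rewrite symF Fxy.
    by move=> z; rewrite inE => /orP[/eqP->//|]; exact: sW.
  have nyx : y != x by apply/eqP => yx; rewrite yx irrF in Fxy.
  move: yp; rewrite inE (negbTE nyx) /= => yp; exfalso.
  case/splitPr: yp sp up pp sW nyp => p1 p2 _ up pp _ nyp.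
  apply: forestF; exists (x :: rcons p1 y); split.
  - by case: p1 {up pp} nyp => //=; rewrite ?eqxx // => z p1; rewrite size_rcons.
  - by move: up; rewrite -cat_rcons -cat_cons cat_uniq => /andP[].
  rewrite /= rcons_path last_rcons symF Fxy andbT.
  by move: pp; rewrite -cat_rcons cat_path => /andP[].
have [x [p [sp up _ _]]] := long n.
by have := uniq_leq_size up (fun y _ => mem_enum 'I_n y); rewrite -cardE card_ord /= sp ltnn.
Qed.

(** Removing a leaf destroys at most two pairs, since [pairs_in] counts every edge in both
    directions. *)
Lemma forest_sparse F W : symmetric F -> irreflexive F -> is_forest F ->
  #|pairs_in F W| <= 2 * #|W|.
Proof.
have p0 : pairs_in F set0 = set0 by apply/setP => p; rewrite !inE.
move=> symF irrF forestF; elim: {W}#|W| {-2}W (leqnn #|W|) => [|k IH] W.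
  by rewrite leqn0 cards_eq0 => /eqP->; rewrite p0 cards0.
case: (eqVneq W set0) => [-> _|nW lW]; first by rewrite p0 cards0.
have [w wW dw] := forest_leaf symF irrF forestF nW.
have cW := cardsD1 w W; rewrite wW /= in cW.
have lW' : #|W :\ w| <= k by move: lW; rewrite cW.
rewrite cW mulnDr muln1 addnC.
have sub : pairs_in F W \subset pairs_in F (W :\ w) :|:
   ([set (w, u) | u in [set u in W | F w u]] :|: [set (u, w) | u in [set u in W | F w u]]).
  apply/subsetP => -[a b]; rewrite !inE /= => /and3P[aW bW Fab].
  case: (eqVneq a w) => [aw|na].
    by apply/orP; right; apply/orP; left; rewrite aw; apply: imset_f; rewrite inE bW -aw.
  case: (eqVneq b w) => [bw|nb]; last by rewrite aW bW Fab.
  by apply/orP; right; apply/orP; right; rewrite bw; apply: imset_f; rewrite inE aW -bw symF.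
apply: leq_trans (subset_leq_card sub) _; apply: leq_trans (leq_card_setU _ _) _.
apply: leq_add; first exact: IH.
apply: leq_trans (leq_card_setU _ _) _.
by rewrite -[2]/(1 + 1); apply: leq_add; apply: leq_trans (leq_imset_card _ _) dw.
Qed.

Lemma arboricity_sparse e a W : symmetric e -> irreflexive e ->
  forest_decomposable e a -> #|pairs_in e W| <= 2 * a * #|W|.
Proof.
move=> syme irre [col [symc forests]].
pose F i := [rel u v | e u v && (col u v == i)].
apply: leq_trans (_ : \sum_(i < a) #|pairs_in (F i) W| <= _).
  rewrite -sum1_card; under [X in _ <= X]eq_bigr => i _ do rewrite -sum1_card.
  rewrite (partition_big (fun p => col p.1 p.2) xpredT) //=.
  apply: leq_sum => i _; apply: eq_leq; apply: eq_bigl => p.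
  by rewrite !inE /= -!andbA.
rewrite mulnAC -[a in X in _ <= X]card_ord mulnC -sum_nat_const; apply: leq_sum => i _.
apply: forest_sparse => //.
- by move=> u v; rewrite /= syme symc.
- by move=> u; rewrite /= irre.
exact: forests.
Qed.
End Density.

(** * Packet algorithms *)

Lemma eq_maximal_matching n (e : rel 'I_n) (p p' : 'I_n -> option 'I_n) :
  p =1 p' -> is_maximal_matching e p -> is_maximal_matching e p'.
Proof.
move=> pp /andP[/forallP m1 /forallP m2]; apply/andP; split; apply/forallP => v; apply/forallP => u.
  by rewrite -!pp; exact: (forallP (m1 v) u).
by rewrite -!pp; exact: (forallP (m2 v) u).
Qed.

(* In one super-round of a packet algorithm every node emits, for each
   sub-round in [Sub] and each destination, at most one packet; a packet is
   shipped as [W] words of [lg n] bits.  A super-round thus costs [#|Sub| * W]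
   rounds.  Sizes below 2 are treated apart, nodes being indexed by ['I_m.+2]. *)
Section Compile.
Variables (kappa : nat) (rb : nat -> nat) (Sub : finType) (sub0 : Sub) (W : nat).
Variables (St2 : nat -> Type) (Pk : nat -> finType) (word : forall m, nat -> Pk m -> nat).
Variables (init2 : forall m, {ffun 'I_(rb m.+2) -> bool} -> 'I_m.+2 -> {set 'I_m.+2} -> St2 m)
  (emit : forall m, St2 m -> Sub -> 'I_m.+2 -> option (Pk m))
  (absorb : forall m, St2 m -> {ffun Sub * 'I_m.+2 -> option (Pk m)} -> St2 m)
  (halt : forall m, St2 m -> bool) (out : forall m, St2 m -> option 'I_m.+2).
Hypothesis kappa_gt0 : 0 < kappa.
Hypothesis W_gt0 : 0 < W.
Hypothesis word_lt : forall m k (p : Pk m), word k p < 2 ^ lg m.+2.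
Hypothesis word_inj : forall m (p p' : Pk m),
  (forall k, k < W -> word k p = word k p') -> p = p'.

Definition no_mail n : mailbox n := [ffun=> None].

Definition superlen := #|Sub| * W.

Definition raw_mail m (s : St2 m) (r : nat) : mailbox m.+2 :=
  [ffun w => omap (word (r %% W)) (emit s (nth sub0 (enum Sub) (r %/ W)) w)].

(** Decoding is a search for a packet all of whose words have arrived; [word_inj] makes it
    unique. *)
Definition decode m (bs : seq (mailbox m.+2)) : {ffun Sub * 'I_m.+2 -> option (Pk m)} :=
  [ffun z => [pick p | [forall k : 'I_W,
     nth (no_mail _) bs (index z.1 (enum Sub) * W + k) z.2 == Some (word k p)]]].

(** The list buffers the mailboxes of the current super-round, and its length is the round
    counter. *)
Definition cSt n : Type := if n is m.+2 then (St2 m * seq (mailbox m.+2))%type else unit.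

Definition c_init n : {ffun 'I_(rb n) -> bool} -> 'I_n -> {set 'I_n} -> cSt n :=
  match n return {ffun 'I_(rb n) -> bool} -> 'I_n -> {set 'I_n} -> cSt n with
  | m.+2 => fun om v nb => (init2 om v nb, [::])
  | _ => fun _ _ _ => tt
  end.

(** [send_valid] speaks of all states, reachable or not, so an oversized mailbox is replaced by an
    empty one. By [raw_mail_ok] this never happens under [traffic_ok]. *)
Definition guard n (x : mailbox n) := if send_ok kappa x then x else no_mail n.

Definition c_send n : cSt n -> mailbox n :=
  match n return cSt n -> mailbox n with
  | m.+2 => fun s => guard (raw_mail s.1 (size s.2))
  | _ => fun _ => no_mail _
  end.

Definition c_recv n : cSt n -> mailbox n -> cSt n :=
  match n return cSt n -> mailbox n -> cSt n with
  | m.+2 => fun s x => let bs := rcons s.2 x in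
      if size bs == superlen then (absorb s.1 (decode bs), [::]) else (s.1, bs)
  | _ => fun s _ => s
  end.

Definition c_halted n : cSt n -> bool :=
  match n return cSt n -> bool with m.+2 => fun s => halt s.1 | _ => fun _ => true end.

Definition c_output n : cSt n -> option 'I_n :=
  match n return cSt n -> option 'I_n with m.+2 => fun s => out s.1 | _ => fun _ => None end.

Lemma no_mail_ok n : send_ok kappa (no_mail n).
Proof.
rewrite /send_ok /nmsgs (eq_card0 (A := [pred u | no_mail n u != None])) //=.
  by apply/forallP => u; rewrite ffunE.
by move=> u; rewrite !inE ffunE.
Qed.

Lemma c_send_valid n (s : cSt n) : send_ok kappa (c_send s).
Proof.
case: n s => [|[|m]] s /=; rewrite ?no_mail_ok // /guard.
by case: ifP => // _; exact: no_mail_ok.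
Qed.

Definition compiled : NCCAlg kappa :=
  {| rbits := rb; St := cSt; init := c_init; send := c_send; recv := c_recv;
     halted := c_halted; output := c_output; send_valid := c_send_valid |}.

Definition ideal_round m (cfg : 'I_m.+2 -> St2 m) : 'I_m.+2 -> St2 m :=
  fun v => absorb (cfg v) [ffun z => emit (cfg z.2) z.1 v].

Definition ideal m (e : rel 'I_m.+2) om (t : nat) : 'I_m.+2 -> St2 m :=
  iter t (@ideal_round m) (fun v => init2 om v [set u | e v u]).

(** * Faithful simulation of the packet algorithm under bounded traffic *)

Section Simulation.
Variables (m : nat) (e : rel 'I_m.+2) (adv : Adversary compiled m.+2).
Hypothesis adv_ok : adversary_ok adv.
Variable om : Seed compiled m.+2.
Local Notation ex := (exec e adv om).
Local Notation id2 := (ideal e om).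

(** Halting is excluded because [incoming] suppresses the messages of halted nodes. *)
Definition traffic_ok t := forall v x,
  [/\ ~~ halt (id2 t v),
      #|[pred w | emit (id2 t v) x w != None]| <= lg m.+2
    & #|[pred u | emit (id2 t u) x v != None]| <= lg m.+2].

Lemma lg_cap : lg m.+2 <= cap kappa m.+2.
Proof. by rewrite /cap leq_pmull. Qed.

Lemma raw_mail_ok t v r : traffic_ok t -> send_ok kappa (raw_mail (id2 t v) r).
Proof.
move=> ok; have [_ s_ok _] := ok v (nth sub0 (enum Sub) (r %/ W)).
apply/andP; split.
  apply: leq_trans lg_cap; apply: leq_trans s_ok; apply: subset_leq_card.
  by apply/subsetP => w; rewrite !inE ffunE; case: emit.
apply/forallP => w; rewrite ffunE; case: emit => //= p.
by apply: leq_trans (word_lt _ _) _; rewrite leq_exp2l // lg_cap.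
Qed.

Lemma decode_raw t v (bs : seq (mailbox m.+2)) :
  (forall r, r < superlen ->
     nth (no_mail _) bs r = [ffun u => raw_mail (id2 t u) r v]) ->
  decode bs = [ffun z => emit (id2 t z.2) z.1 v].
Proof.
move=> hbs; apply/ffunP => -[x u]; rewrite !ffunE /=.
have ix : index x (enum Sub) < #|Sub| by rewrite cardE index_mem mem_enum.
have val (k : 'I_W) : nth (no_mail _) bs (index x (enum Sub) * W + k) u
    = omap (word k) (emit (id2 t u) x v).
  rewrite hbs; last by rewrite /superlen; have := ltn_ord k; nia.
  by rewrite !ffunE divnMDl // divn_small // addn0 modnMDl modn_small // nth_index // mem_enum.
case: pickP => [p /forallP hp|hp].
  case E: (emit (id2 t u) x v) => [p'|]; last first.
    by have := hp (Ordinal W_gt0); rewrite val E.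
  congr Some; apply: word_inj => k lk; have := hp (Ordinal lk).
  by rewrite val E /= => /eqP[].
case E: (emit (id2 t u) x v) => [p'|] //.
have := hp p'; suff -> : [forall k : 'I_W,
  nth (no_mail _) bs (index x (enum Sub) * W + k) u == Some (word k p')] by [].
by apply/forallP => k; rewrite val E.
Qed.

Lemma superlen_gt0 : 0 < superlen.
Proof. by rewrite muln_gt0 W_gt0 andbT; apply/card_gt0P; exists sub0. Qed.

(** Traffic within capacity must be delivered completely, so the adversary has no choice left. *)
Lemma delivered t r k (cfg : config compiled m.+2) v (bs : 'I_m.+2 -> seq (mailbox m.+2)) :
  traffic_ok t -> (forall u, cfg u = (id2 t u, bs u)) -> (forall u, size (bs u) = r) ->
  adv k om v (incoming cfg v) = [ffun u => raw_mail (id2 t u) r v].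
Proof.
move=> ok cfgE sz; set inc := incoming _ v.
have incE : inc = [ffun u => raw_mail (id2 t u) r v].
  apply/ffunP => u; rewrite /inc /incoming !ffunE cfgE /=.
  have [nhu _ _] := ok u sub0; rewrite (negbTE nhu) sz.
  by rewrite /guard raw_mail_ok // ffunE.
rewrite -incE; have [_ [_ hd]] := adv_ok k om v inc; apply: hd.
have [_ _ r_ok] := ok v (nth sub0 (enum Sub) (r %/ W)).
apply: leq_trans lg_cap; apply: leq_trans r_ok; apply: subset_leq_card.
by apply/subsetP => u; rewrite !inE incE !ffunE; case: emit.
Qed.

Lemma exec_superround t r : traffic_ok t -> r < superlen ->
  (forall v, ex (t * superlen) v = (id2 t v, [::])) ->
  forall v, ex (t * superlen + r) v
    = (id2 t v, [seq [ffun u => raw_mail (id2 t u) i v] | i <- iota 0 r]).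
Proof.
move=> ok + h0; elim: r => [|r IH] lr v; first by rewrite addn0 h0.
have {}IH := IH (ltnW lr).
have sz u : size [seq [ffun w => raw_mail (id2 t w) i u] | i <- iota 0 r] = r.
  by rewrite size_map size_iota.
rewrite addnS /= /round (delivered _ _ ok IH sz) !IH /=.
have [nh _ _] := ok v sub0; rewrite (negbTE nh) size_rcons sz (ltn_eqF lr); congr pair.
by rewrite -map_rcons -cats1 -(iotaD 0 r 1) addn1.
Qed.

Lemma exec_ideal T : (forall t, t < T -> traffic_ok t) ->
  forall v, ex (T * superlen) v = (id2 T v, [::]).
Proof.
elim: T => [|T IH] ok v; first by rewrite mul0n.
have {}IH := IH (fun t lt => ok t (ltnW lt)).
have okT := ok T (ltnSn T).
have slE := prednK superlen_gt0.
have lr : superlen.-1 < superlen by rewrite slE.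
have hE := exec_superround okT lr IH.
have sz u : size [seq [ffun w => raw_mail (id2 T w) i u] | i <- iota 0 superlen.-1] = superlen.-1.
  by rewrite size_map size_iota.
rewrite mulSnr -{2}slE addnS /= /round (delivered _ _ okT hE sz) !hE /=.
have [nh _ _] := okT v sub0; rewrite (negbTE nh).
rewrite size_rcons sz slE eqxx; congr pair.
rewrite /ideal_round; congr absorb; apply: decode_raw => r lr'.
rewrite -map_rcons -cats1 -(iotaD 0 _ 1) addn1 slE.
by rewrite (nth_map 0) ?size_iota // nth_iota.
Qed.

Lemma exec_halted T T' : (forall t, t < T -> traffic_ok t) ->
  (forall v, halt (id2 T v)) -> T * superlen <= T' ->
  forall v, ex T' v = (id2 T v, [::]).
Proof.
move=> ok hT /subnKC <-; elim: (T' - _) => [|d IH] v.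
  by rewrite addn0; exact: exec_ideal.
by rewrite addnS /= /round !IH /= hT.
Qed.

Lemma compiled_success T T' : (forall t, t < T -> traffic_ok t) ->
  (forall v, halt (id2 T v)) -> T * superlen <= T' ->
  is_maximal_matching e (fun v => out (id2 T v)) ->
  success e adv T' om.
Proof.
move=> ok hT le mm; have hE := exec_halted ok hT le.
apply/andP; split; first by apply/forallP => v; rewrite hE /= hT.
by apply: eq_maximal_matching mm => v; rewrite hE.
Qed.
End Simulation.
End Compile.

(** * Aggregation along binary trees *)

Lemma pow2_gt0 d : 0 < 2 ^ d.
Proof. by rewrite expn_gt0. Qed.

Definition modI d (x : nat) : 'I_(2 ^ d) := Ordinal (ltn_pmod x (pow2_gt0 d)).

Section Aggregation.
Variables (n L B1 rho Q : nat).

Definition key := ('I_n * 'I_B1)%type.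
(* The item [(k, p)] of level [lev] stands for the contributors to [k] whose
   leading [lev] bits (out of [L]) are [p]. *)
Definition item := (key * 'I_(2 ^ L))%type.
Definition value := ('I_(2 ^ L) * 'I_(2 ^ L) * 'I_(2 ^ L))%type.
Definition packet := (item * value)%type.
(** A host spreads its items over [2 ^ rho] slots. A sub-round serves one source slot and one target
    slot, so it suffices that every slot holds at most [L] items, even if the whole node holds
    more. *)
Definition cell := ('I_n * 'I_(2 ^ rho))%type.
(* Side of the child, slot of the source, slot of the target, rank. *)
Definition subround := (bool * 'I_(2 ^ rho) * 'I_(2 ^ rho) * 'I_Q.+1)%type.
Definition holdings := {ffun item -> option ('I_(2 ^ rho) * value)}.

Implicit Types (C : key -> {set 'I_n}) (loc : item -> cell) (c : item) (lev : nat).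

(** Reduction modulo [2 ^ L] makes every field fit into one word. The sum is needed only modulo
    [2 ^ L], since it serves to recover one identifier below [2 ^ L]. *)
Definition enc (A : {set 'I_n}) : option value :=
  if A == set0 then None
  else Some (modI L #|A|, modI L (\sum_(u in A) u), modI L (\max_(u in A) u)).

Definition ocomb (x y : option value) : option value :=
  match x, y with
  | Some (a, b, c), Some (a', b', c') =>
      Some (modI L (a + a'), modI L (b + b'), modI L (maxn c c'))
  | None, _ => y
  | _, None => x
  end.

Definition parent (c : item) : item := (c.1, modI L (c.2 %/ 2)).

Definition group (h : holdings) (loc : item -> cell) (b : bool) s1 (y : cell) : seq item :=
  [seq c <- enum {: item} | [&& omap fst (h c) == Some s1, odd c.2 == b & loc (parent c) == y]].

(** Several items of one slot may have their parents in the same cell; the rank [q] sends them one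
    per sub-round, so that each destination gets at most one packet. *)
Definition send_up (h : holdings) loc (x : subround) (w : 'I_n) : option packet :=
  let: (b, s1, s2, q) := x in
  obind (fun c => omap (fun hv => (parent c, hv.2)) (h c))
        (ohead (drop q (group h loc b s1 (w, s2)))).

Definition received (rcv : {ffun subround * 'I_n -> option packet}) (b : bool) (c : item) :
    option value :=
  [pick x | [exists z, (z.1.1.1.1 == b) && (rcv z == Some (c, x))]].

Definition merge_up (loc : item -> cell) rcv : holdings :=
  [ffun c => omap (pair (loc c).2) (ocomb (received rcv false c) (received rcv true c))].

Definition below (C : key -> {set 'I_n}) (lev : nat) (c : item) : {set 'I_n} :=
  [set u in C c.1 | u %/ 2 ^ (L - lev) == c.2].

Definition held (C : key -> {set 'I_n}) lev (loc : item -> cell) (v : 'I_n) : holdings :=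
  [ffun c => if (loc c).1 == v then omap (pair (loc c).2) (enc (below C lev c)) else None].

Definition load C lev (loc : item -> cell) (x : cell) : {set item} :=
  [set c | (below C lev c != set0) && (loc c == x)].

Definition traffic C lev (loc' loc : item -> cell) b x y : {set item} :=
  [set c | [&& c \in load C lev.+1 loc' x, odd c.2 == b & loc (parent c) == y]].

Lemma in_load C lev loc x c :
  (c \in load C lev loc x) = (below C lev c != set0) && (loc c == x).
Proof. by rewrite in_set. Qed.

Lemma in_traffic C lev loc' loc b x y c : (c \in traffic C lev loc' loc b x y)
  = [&& below C lev.+1 c != set0, loc' c == x, odd c.2 == b & loc (parent c) == y].
Proof. by rewrite in_set in_load -!andbA. Qed.

Lemma parent_eq (c' c : item) b : parent c' = c -> odd c'.2 = b ->
  c'.1 = c.1 /\ c'.2 = c.2 * 2 + b :> nat.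
Proof.
move=> <- <- /=; split=> //; rewrite modn_small; last by have := ltn_ord c'.2; lia.
by rewrite -modn2 -divn_eq.
Qed.

Lemma parent_inj c c' : odd c.2 = odd c'.2 -> parent c = parent c' -> c = c'.
Proof.
move=> oc pc; have [e1 h1] := parent_eq pc oc.
have [e2 h2] := parent_eq (erefl (parent c')) (erefl _).
rewrite [c]surjective_pairing [c']surjective_pairing; congr pair; first by rewrite e1.
exact: val_inj (etrans h1 (esym h2)).
Qed.

Hypothesis leq_n : n <= 2 ^ L.

Lemma id_lt (u : 'I_n) : u < 2 ^ L.
Proof. exact: leq_trans (ltn_ord u) leq_n. Qed.

Lemma enc_eq_None A : (enc A == None) = (A == set0).
Proof. by rewrite /enc; case: ifP. Qed.

Lemma encU (A B : {set 'I_n}) : [disjoint A & B] ->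
  enc (A :|: B) = ocomb (enc A) (enc B).
Proof.
move=> dAB; rewrite /enc setU_eq0.
case: (eqVneq A set0) => [->|nA] /=; first by rewrite set0U; case: eqVneq.
case: (eqVneq B set0) => [->|nB] /=; first by rewrite setU0.
have maxlt (D : {set 'I_n}) : D != set0 -> \max_(u in D) u < 2 ^ L.
  move=> nD; apply: leq_ltn_trans (_ : (2 ^ L).-1 < _); last by rewrite prednK ?pow2_gt0.
  by apply/bigmax_leqP => u _; have := id_lt u; lia.
have le_max (D : {set 'I_n}) (u : 'I_n) : u \in D -> u <= \max_(u in D) u.
  by move=> uD; exact: (@leq_bigmax_cond _ (mem D) (fun u : 'I_n => u : nat) u uD).
congr Some; congr (_, _, _); apply: val_inj => /=.
- by rewrite modnDm cardsU disjoint_setI0 // cards0 subn0.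
- by rewrite modnDm -bigU //=; congr (_ %% _); apply: eq_bigl => u; rewrite !inE.
rewrite (modn_small (maxlt A nA)) (modn_small (maxlt B nB)).
congr (_ %% _); apply/eqP; rewrite eqn_leq geq_max; apply/andP; split.
  apply/bigmax_leqP => u; rewrite inE leq_max => /orP[/le_max->//|/le_max->].
  by rewrite orbT.
by apply/andP; split; apply/bigmax_leqP => u uA; apply: le_max; rewrite inE uA ?orbT.
Qed.

(** The child is given by the number [c.2 * 2 + b], which need not fit into ['I_(2 ^ L)]; it does
    whenever the set is nonempty. *)
Definition child_set C lev (c : item) (b : bool) : {set 'I_n} :=
  [set u in C c.1 | u %/ 2 ^ (L - lev.+1) == c.2 * 2 + b].

Lemma below_split C lev c : lev < L ->
  enc (below C lev c) = ocomb (enc (child_set C lev c false)) (enc (child_set C lev c true)).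
Proof.
move=> lL; rewrite -encU; last first.
  rewrite -setI_eq0; apply/eqP/setP => u; rewrite !inE.
  by apply/negP => /andP[/andP[_ /eqP h1] /andP[_ /eqP h2]]; move: h1 h2; lia.
congr enc; apply/setP => u; rewrite !inE -andb_orr; congr andb.
have -> : L - lev = (L - lev.+1).+1 by lia.
rewrite expnSr divnMA; set k := u %/ _.
apply/eqP/orP => [h|[/eqP|/eqP]]; lia.
Qed.

Lemma below_parent C lev (c' : item) : lev < L ->
  below C lev.+1 c' != set0 -> below C lev (parent c') != set0.
Proof.
move=> lL /set0Pn[u]; rewrite inE => /andP[uC /eqP hu]; apply/set0Pn; exists u.
rewrite inE uC /= -hu (_ : L - lev = (L - lev.+1).+1); last by lia.
rewrite expnSr divnMA modn_small //.
by apply: leq_ltn_trans (leq_div _ _) _; apply: leq_ltn_trans (leq_div _ _) (id_lt u).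
Qed.

Lemma mem_group C lev loc' loc b s1 u y c :
  (c \in group (held C lev.+1 loc' u) loc b s1 y) = (c \in traffic C lev loc' loc b (u, s1) y).
Proof.
rewrite mem_filter mem_enum andbT in_traffic ffunE.
have -> : (loc' c == (u, s1)) = ((loc' c).1 == u) && ((loc' c).2 == s1)
  by rewrite -xpair_eqE -surjective_pairing.
case E: ((loc' c).1 == u) => /=; last by rewrite !andbF.
by rewrite -enc_eq_None; case: (enc _).
Qed.

Lemma size_group C lev loc' loc b s1 u y :
  size (group (held C lev.+1 loc' u) loc b s1 y) = #|traffic C lev loc' loc b (u, s1) y|.
Proof.
rewrite cardE; apply/perm_size/uniq_perm; rewrite ?enum_uniq //.
  by apply: filter_uniq; exact: enum_uniq.
by move=> c; rewrite mem_group mem_enum.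
Qed.

Lemma send_upP C lev loc' loc u b s1 s2 q w p :
  send_up (held C lev.+1 loc' u) loc (b, s1, s2, q) w = Some p ->
  exists c, [/\ c \in traffic C lev loc' loc b (u, s1) (w, s2), parent c = p.1 &
    enc (below C lev.+1 c) = Some p.2].
Proof.
rewrite /send_up; case E: (drop q _) => [|c l] //=.
have cg : c \in group (held C lev.+1 loc' u) loc b s1 (w, s2).
  by apply: (mem_drop (n0 := q)); rewrite E mem_head.
have hc := cg; rewrite mem_group in hc.
rewrite ffunE; case: eqP => [lc|] //; case Ee: (enc _) => [x|] //= [<-].
by exists c.
Qed.

Lemma send_up_traffic C lev loc' loc b c (u w : 'I_n) s1 s2 :
  (forall x y, #|traffic C lev loc' loc b x y| <= Q.+1) ->
  c \in traffic C lev loc' loc b (u, s1) (w, s2) ->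
  exists q, forall x, enc (below C lev.+1 c) = Some x ->
    send_up (held C lev.+1 loc' u) loc (b, s1, s2, q) w = Some (parent c, x).
Proof.
move=> hQ hc; have hg := hc; rewrite -mem_group in hg.
set g := group _ _ _ _ _ in hg.
have lq : index c g < Q.+1.
  by apply: leq_trans (hQ (u, s1) (w, s2)); rewrite -size_group -/g index_mem.
exists (Ordinal lq) => x hx; rewrite /send_up -/g.
rewrite (drop_nth c) ?index_mem //= nth_index // ffunE hx.
by move: hc; rewrite in_traffic => /and4P[_ /eqP-> _ _] /=; rewrite eqxx.
Qed.

(** A vertex has only one child on side [b], so every packet addressed to [c] from that side carries
    the value of this child. Conversely the traffic bound provides the child with a rank, hence its
    packet is really sent. *)
Lemma receivedE C lev loc' loc v b c : lev < L ->
  (forall x y, #|traffic C lev loc' loc b x y| <= Q.+1) ->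
  received [ffun z => send_up (held C lev.+1 loc' z.2) loc z.1 v] b c
  = if (loc c).1 == v then enc (child_set C lev c b) else None.
Proof.
move=> lL hQ.
have childE c' : parent c' = c -> odd c'.2 = b -> below C lev.+1 c' = child_set C lev c b.
  by move=> h1 h2; have [e1 e2] := parent_eq h1 h2; apply/setP => u; rewrite !inE e1 e2.
rewrite /received; case: pickP => [x /existsP[[[[[b' s1] s2] q] u]]|nox].
  rewrite ffunE /= => /andP[/eqP-> /eqP/send_upP[c' [+ /= pc <-]]].
  rewrite in_traffic => /and4P[_ _ /eqP ob /eqP]; rewrite pc => ->.
  by rewrite eqxx (childE c').
case: eqP => // lv; case E: (enc (child_set C lev c b)) => [x|] //.
have : child_set C lev c b != set0 by rewrite -enc_eq_None E.
case/set0Pn => u; rewrite inE => /andP[uC /eqP hu].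
have lt2 : c.2 * 2 + b < 2 ^ L.
  by rewrite -hu; apply: leq_ltn_trans (leq_div _ _) (id_lt u).
pose c' : item := (c.1, modI L (c.2 * 2 + b)).
have c'2 : c'.2 = c.2 * 2 + b :> nat by rewrite /= modn_small.
have pc' : parent c' = c.
  rewrite [c in RHS]surjective_pairing /parent c'2; congr pair; apply: val_inj => /=.
  have -> : (c.2 * 2 + b) %/ 2 = c.2 by case: (b); lia.
  by rewrite modn_small.
have oc' : odd c'.2 = b by rewrite c'2 oddD oddM andbF /=; case: (b).
have tr : c' \in traffic C lev loc' loc b (loc' c') (v, (loc c).2).
  rewrite in_traffic eqxx oc' eqxx pc' -lv -surjective_pairing eqxx !andbT.
  by rewrite (childE c') // -enc_eq_None E.
have [q hq] : exists q, forall x, enc (below C lev.+1 c') = Some x ->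
    send_up (held C lev.+1 loc' (loc' c').1) loc (b, (loc' c').2, (loc c).2, q) v = Some (c, x).
  by rewrite -pc'; apply: send_up_traffic => //; rewrite pc' -surjective_pairing.
have := nox x; apply: contraFeq => _; apply/existsP.
exists ((b, (loc' c').2, (loc c).2, q), (loc' c').1).
by rewrite ffunE; apply/andP; split=> //; apply/eqP; apply: hq; rewrite childE.
Qed.

Lemma merge_upE C lev loc' loc v : lev < L ->
  (forall b x y, #|traffic C lev loc' loc b x y| <= Q.+1) ->
  merge_up loc [ffun z => send_up (held C lev.+1 loc' z.2) loc z.1 v] = held C lev loc v.
Proof.
move=> lL hQ; apply/ffunP => c; rewrite !ffunE !receivedE //.
by case: eqP => // _; rewrite below_split.
Qed.

Lemma send_up_out C lev loc' loc u x k :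
  (forall y, #|load C lev.+1 loc' y| <= k) ->
  #|[pred w | send_up (held C lev.+1 loc' u) loc x w != None]| <= k.
Proof.
case: x => [[[b s1] s2] q] hk; apply: leq_trans (hk (u, s1)).
apply: leq_trans (leq_imset_card (fun c => (loc (parent c)).1) _).
apply: subset_leq_card; apply/subsetP => w; rewrite !inE.
case E: send_up => [p|] // _; have [c [+ _ _]] := send_upP E.
rewrite in_traffic => /and4P[nb lc _ /eqP pc]; apply/imsetP; exists c; first by rewrite in_load nb.
by rewrite pc.
Qed.

(** The side being fixed, distinct items have distinct parents, and these parents all lie in the
    target cell. So the load of that cell bounds the number of senders. *)
Lemma send_up_in C lev loc' loc v x k : lev < L ->
  (forall y, #|load C lev loc y| <= k) ->
  #|[pred u | send_up (held C lev.+1 loc' u) loc x v != None]| <= k.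
Proof.
case: x => [[[b s1] s2] q] lL hk; apply: leq_trans (hk (v, s2)).
pose D := [set c | (below C lev.+1 c != set0) && (odd c.2 == b) && (loc (parent c) == (v, s2))].
have injD : {in D &, injective parent}.
  move=> c1 c2; rewrite !in_set -!andbA => /and3P[_ /eqP o1 _] /and3P[_ /eqP o2 _].
  by apply: parent_inj; rewrite o1 o2.
apply: leq_trans (_ : #|D| <= _); last first.
  rewrite -(card_in_imset injD); apply: subset_leq_card; apply/subsetP => c /imsetP[c' + ->].
  by rewrite in_set in_load => /andP[/andP[nb _] ->]; rewrite andbT below_parent.
apply: leq_trans (leq_imset_card (fun c => (loc' c).1) _).
apply: subset_leq_card; apply/subsetP => u; rewrite !inE.
case E: send_up => [p|] // _; have [c [+ _ _]] := send_upP E.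
rewrite in_traffic => /and4P[nb /eqP lc ob pc]; apply/imsetP; exists c.
  by rewrite in_set nb ob pc.
by rewrite lc.
Qed.

End Aggregation.

(** * The algorithm *)

Section Algorithm.
Variables (cc rho Q m : nat).
Local Notation n := m.+2.
Local Notation L := (lg m.+2).

(* Powers of two throughout, so that the sample space is that of a bit string. *)
Definition nbuckets : nat := 2 ^ up_log 2 L.
(** Each block of [2 ^ (j + 9)] steps halves the expected number of unoriented edges; [(cc + 2) * L]
    halvings bring it from [n ^ 2] below [n ^ -cc]. The additional step announces the edges oriented
    last. *)
Definition nsteps (j : nat) : nat := 2 ^ (j + 9) * (cc + 2) * L + 1.

Definition hashval : predArgType := ('I_(2 ^ (L + 4)) * 'I_nbuckets)%type.
Definition coins : predArgType := ({ffun 'I_n * 'I_n -> hashval} * {ffun 'I_n -> bool})%type.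
Definition coins0 : coins := ([ffun=> (modI _ 0, modI _ 0)], [ffun=> false]).

Local Notation Key := (key n nbuckets.+1).
Local Notation Item := (item n L nbuckets.+1).
Local Notation Value := (value L).
Local Notation Packet := (packet n L nbuckets.+1).
Local Notation Cell := (cell n rho).
Local Notation Sub := (subround rho Q).
Local Notation Hold := (holdings n L nbuckets.+1 rho).

Definition maxsteps := nsteps L.
(** Hosts are drawn from the first [2 ^ L.-1] nodes, the largest power of two below [n],
    independently for every step, level and item. *)
Definition placement : predArgType :=
  {ffun 'I_(2 * maxsteps).+1 * 'I_L.+1 * Item -> 'I_(2 ^ L.-1) * 'I_(2 ^ rho)}.
(** One tape of coins for the orientation and one for the matching. All stages reuse them, as
    failures are only combined by union bounds. *)
Definition Omega : predArgType := (maxsteps.-tuple coins * maxsteps.-tuple coins * placement)%type.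

(* In stage [j] a pair is sampled with probability [2 ^- (j + 4)]. *)
Definition bucket (j : nat) (z : hashval) : option nat :=
  if z.1 < 2 ^ (L - j) then Some (val z.2) else None.

Implicit Types (y : coins) (u v w : 'I_n) (nb : {set 'I_n}).

Record data := Data {
  d_out : {set 'I_n};            (* neighbours along outgoing edges *)
  d_old : {set 'I_n};            (* [d_out] one step earlier *)
  d_todo : {set 'I_n};           (* outgoing edges not yet tried *)
  d_in : nat;                    (* number of announced incoming edges *)
  d_mate : option 'I_n;
  d_win : option 'I_n }.         (* proposal accepted in the current step *)

Implicit Type d : data.

Definition data0 := Data set0 set0 set0 0 None None.

Definition propose (y : coins) (u : 'I_n) (d : data) : option 'I_n :=
  if (d_mate d == None) && ~~ y.2 u then [pick v in d_todo d | y.2 v] else None.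

(** The buckets below [nbuckets] carry the sampled reports of heads to tails. The bucket [nbuckets]
    is reserved for announcing to [k.1] the edges that were oriented towards it in the preceding
    step. *)
Definition contrib_orient j (y : coins) (u : 'I_n) (d : data) : {set Key} :=
  [set k : Key | [&& k.1 \in d_out d, ~~ y.2 k.1, y.2 u & bucket j (y.1 (k.1, u)) == Some (val k.2)]
        || (k.2 == nbuckets :> nat) && (k.1 \in d_out d :\: d_old d)].

Definition contrib_match (y : coins) (u : 'I_n) (d : data) : {set Key} :=
  [set k : Key | (propose y u d == Some k.1) && (k.2 == 0 :> nat)].

Definition contrib (orient : bool) j y u d :=
  if orient then contrib_orient j y u d else contrib_match y u d.

Definition val_count (o : option Value) : nat := if o is Some x then x.1.1 else 0.
Definition val_sum (o : option Value) : nat := if o is Some x then x.1.2 else 0.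

Definition candidates j (y : coins) (v : 'I_n) (nb : {set 'I_n}) (d : data) (b : nat) :
    {set 'I_n} :=
  [set w in nb :\: d_out d | y.2 w & bucket j (y.1 (v, w)) == Some b].

Definition identified j y v nb d (b : nat) (o : option Value) : {set 'I_n} :=
  let F := candidates j y v nb d b in
  [set w in F | (#|F| == val_count o + 1) &&
                (modI L (\sum_(x in F) x) == modI L (val_sum o + w))].

Definition cap_deg j := 8 * (2 ^ j * nbuckets).

Definition fresh j (y : coins) v nb d (res : {ffun 'I_nbuckets.+1 -> option Value}) : {set 'I_n} :=
  if ~~ y.2 v && (#|nb| - (d_in d + val_count (res ord_max)) <= cap_deg j)
  then [set w | [exists b : 'I_nbuckets.+1,
          (b < nbuckets) && (w \in identified j y v nb d b (res b))]]
  else set0.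

Definition upd_orient j y v nb d res : data :=
  let out := d_out d :|: fresh j y v nb d res in
  Data out (d_out d) out (d_in d + val_count (res ord_max)) (d_mate d) None.

(** The maximum field of the aggregate names one of the proposers. *)
Definition accept (y : coins) v d (res : {ffun 'I_nbuckets.+1 -> option Value}) : option 'I_n :=
  if (d_mate d == None) && y.2 v then omap (fun x : Value => inord x.2) (res ord0) else None.

(** A proposal is struck off [d_todo] whether accepted or not: its addressee is matched after the
    step in either case. *)
Definition upd_match (y : coins) v d res : data :=
  let win := accept y v d res in
  Data (d_out d) (d_old d) (if propose y v d is Some w then d_todo d :\ w else d_todo d)
    (d_in d) (if win is Some w then Some w else d_mate d) win.

Definition upd (orient : bool) j y v nb d res :=
  if orient then upd_orient j y v nb d res else upd_match y v d res.

Definition set_mate (d : data) (o : option 'I_n) : data :=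
  if o is Some u then Data (d_out d) (d_old d) (d_todo d) (d_in d) (Some u) (d_win d) else d.

Definition pending (nb : {set 'I_n}) (d : data) : bool :=
  (#|nb| - #|d_out d| - d_in d != 0) || (d_mate d == None) && (d_todo d != set0).

Definition coins_at (om : Omega) j s : coins :=
  if s < nsteps j then nth coins0 om.1.1 s else nth coins0 om.1.2 (s - nsteps j).

(** The root of the tree of [(v, b)] is hosted by [v] itself, which thus ends up holding its own
    result; the slot depends on the bucket so that each slot gets at most [L] roots. *)
Definition place (om : Omega) s lev (c : Item) : Cell :=
  if lev == 0 then (c.1.1, modI rho (c.1.2 %/ L))
  else let h := om.2 (inord s, inord lev, c) in (inord h.1, h.2).

Definition leaf_slot (K : {set Key}) (k : Key) : 'I_(2 ^ rho) :=
  modI rho (index k (enum K) %/ L).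

Definition leaf_hold (K : {set Key}) (u : 'I_n) : Hold :=
  [ffun c : Item => if (c.2 == u :> nat) && (c.1 \in K)
             then omap (pair (leaf_slot K c.1)) (enc L [set u]) else None].

Definition no_hold : Hold := [ffun=> None].

Record node := Node {
  n_om : Omega; n_me : 'I_n; n_nb : {set 'I_n};
  n_stage : nat; n_time : nat;
  n_data : data; n_hold : Hold; n_flag : bool; n_halt : bool }.

(* A stage consists of [2 * nsteps j] steps of [L.+1] super-rounds (climbing
   the trees, then answering the winners) and of [L] super-rounds that compute the
   disjunction of all [pending] flags. *)
Definition check_start j := 2 * nsteps j * L.+1.
Definition stage_len j := check_start j + L.

Definition start (om : Omega) (v : 'I_n) (nb : {set 'I_n}) j : node :=
  Node om v nb j 0 data0 no_hold false false.

Definition n_step x := n_time x %/ L.+1.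
Definition n_phase x := n_time x %% L.+1.
Definition n_orient x := n_step x < nsteps (n_stage x).
Definition n_coins x := coins_at (n_om x) (n_stage x) (n_step x).

Definition cur_hold x : Hold :=
  if n_phase x == 0
  then leaf_hold (contrib (n_orient x) (n_stage x) (n_coins x) (n_me x) (n_data x)) (n_me x)
  else n_hold x.

Definition cur_place x := place (n_om x) (n_step x) (L - (n_phase x).+1).

Definition mid_data x : data :=
  upd (n_orient x) (n_stage x) (n_coins x) (n_me x) (n_nb x) (n_data x)
    [ffun b => omap snd (n_hold x ((n_me x, b), modI L 0))].

Definition cur_flag x : bool :=
  if n_time x == check_start (n_stage x) then pending (n_nb x) (n_data x) else n_flag x.

(** Identifiers form a cycle. In the [i]-th super-round of the check flags jump forward by [2 ^ i],
    so they spread over the whole cycle in [L] super-rounds. *)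
Definition shift (u : 'I_n) (k : nat) : 'I_n :=
  inord (if u + k < n then u + k else u + k - n).

Definition sub_first : Sub := (false, modI rho 0, modI rho 0, ord0).
(** For answers and flags the mere arrival of a packet is the message. *)
Definition dummy : Packet := (((ord0, ord0), modI L 0), (modI L 0, modI L 0, modI L 0)).

Definition emit (x : node) (z : Sub) (w : 'I_n) : option Packet :=
  if n_time x < check_start (n_stage x) then
    if n_phase x < L then send_up (cur_hold x) (cur_place x) z w
    else if (z == sub_first) && (d_win (mid_data x) == Some w) then Some dummy else None
  else if [&& z == sub_first, cur_flag x
            & w == shift (n_me x) (2 ^ (n_time x - check_start (n_stage x)))]
       then Some dummy else None.

Definition absorb (x : node) (rcv : {ffun Sub * 'I_n -> option Packet}) : node :=
  let: Node om v nb j t d h f hl := x in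
  if t < check_start j then
    if n_phase x < L
    then Node om v nb j t.+1 d (merge_up (cur_place x) rcv) false false
    else Node om v nb j t.+1 (set_mate (mid_data x) [pick u | rcv (sub_first, u) != None])
           no_hold false false
  else
    let f' := cur_flag x || [exists u, rcv (sub_first, u) != None] in
    if t.+1 < stage_len j then Node om v nb j t.+1 d no_hold f' false
    else if f' then start om v nb j.+1
    else Node om v nb j t.+1 d no_hold f' true.

(** * Intended behaviour *)

Variable e : rel 'I_n.
Definition nbrs v := [set u | e v u].
Definition global := 'I_n -> data.
Definition global0 : global := fun=> data0.

Definition contributors orient j y (X : global) (k : Key) : {set 'I_n} :=
  [set u | k \in contrib orient j y u (X u)].

Definition mid_step orient j y (X : global) : global :=
  fun v => upd orient j y v (nbrs v) (X v)
             [ffun b => enc L (contributors orient j y X (v, b))].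

Definition step orient j (X : global) y : global :=
  let X1 := mid_step orient j y X in
  fun v => set_mate (X1 v) [pick u | d_win (X1 u) == Some v].

Fixpoint state (om : Omega) j s : global :=
  if s is s'.+1 then step (s' < nsteps j) j (state om j s') (coins_at om j s')
  else global0.

Definition contributors_at om j s :=
  contributors (s < nsteps j) j (coins_at om j s) (state om j s).

Definition contrib_at om j s u :=
  contrib (s < nsteps j) j (coins_at om j s) u (state om j s u).

Definition leaf_place (K : 'I_n -> {set Key}) (c : Item) : Cell :=
  (inord c.2, leaf_slot (K (inord c.2)) c.1).

Definition place_at om j s lev :=
  if lev == L then leaf_place (contrib_at om j s) else place om s lev.

Definition loads_ok om j s : Prop :=
  (forall lev x, lev <= L -> #|load (contributors_at om j s) lev (place_at om j s lev) x| <= L) /\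
  (forall lev b (x x' : Cell), lev < L ->
     #|traffic (contributors_at om j s) lev (place_at om j s lev.+1) (place_at om j s lev) b x x'|
       <= Q.+1).

Definition dist (u v : 'I_n) : nat := if u <= v then v - u else v + n - u.

Definition final_pending om j (u : 'I_n) : bool :=
  pending (nbrs u) (state om j (2 * nsteps j) u).

(** Reference state at time [t] of a stage: after [l] phases of a step the aggregates sit at level
    [L - l] of the trees, and after [i > 0] super-rounds of the check a node knows the flags at
    cyclic distance below [2 ^ i] behind it. *)
Definition expected om j t (v : 'I_n) : node :=
  let s := t %/ L.+1 in let l := t %% L.+1 in
  if t < check_start j then
    Node om v (nbrs v) j t (state om j s v)
      (if l == 0 then no_hold
       else held (contributors_at om j s) (L - l) (place om s (L - l)) v) false false
  else
    Node om v (nbrs v) j t (state om j (2 * nsteps j) v) no_hold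
      (if t == check_start j then false
       else [exists u, final_pending om j u && (dist u v < 2 ^ (t - check_start j))]) false.

Definition ended om j (v : 'I_n) : node :=
  if [exists u, final_pending om j u] then start om v (nbrs v) j.+1
  else Node om v (nbrs v) j (stage_len j) (state om j (2 * nsteps j) v) no_hold false true.

Lemma lg_gt0 : 0 < L.
Proof. by rewrite /lg up_log_gt0. Qed.

Lemma leq_pow_lg : n <= 2 ^ L.
Proof. exact: up_logP. Qed.

Lemma ltn_pow_lg_pred : 2 ^ L.-1 < n.
Proof. exact: up_log_gtn. Qed.

Lemma leaf_holdE om j s v :
  leaf_hold (contrib_at om j s v) v
  = held (contributors_at om j s) L (place_at om j s L) v.
Proof.
apply/ffunP => c; rewrite !ffunE /place_at eqxx /leaf_place /=.
have belowE (u : 'I_n) : c.2 = u :> nat -> below (contributors_at om j s) L c =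
    if c.1 \in contrib_at om j s u then [set u] else set0.
  move=> cu; apply/setP => u'; rewrite !inE subnn divn1 cu.
  case: (eqVneq u' u) => [->|nu].
    by rewrite eqxx andbT; case: ifP => h; rewrite ?inE ?eqxx.
  have -> : (u' == u :> nat) = false by apply/negbTE.
  by rewrite andbF; case: ifP => _; rewrite ?inE ?(negbTE nu).
case: (eqVneq (c.2 : nat) v) => [cv|ncv] /=.
  rewrite cv inord_val eqxx (belowE v cv); case: ifP => // _.
  by rewrite /enc eqxx.
case: ifP => // /eqP hv; case: (ltnP c.2 n) => lc.
  by move: ncv; rewrite -hv inordK // eqxx.
rewrite /enc (_ : below _ _ _ == set0) //; apply/eqP/setP => u; rewrite !inE subnn divn1.
by have := ltn_ord u; case: eqP => [->|]; rewrite ?andbF // ltnNge lc.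
Qed.

(** * The distributed run of a stage agrees with its intended behaviour *)

Section Rounds.
Variables (om : Omega) (j : nat).
Local Notation next cfg := (fun v : 'I_n => absorb (cfg v) [ffun z => emit (cfg z.2) z.1 v]).

Lemma cur_hold_expected t v : t < check_start j -> t %% L.+1 < L ->
  cur_hold (expected om j t v) = held (contributors_at om j (t %/ L.+1))
    (L - (t %% L.+1).+1).+1 (place_at om j (t %/ L.+1) (L - (t %% L.+1).+1).+1) v.
Proof.
move=> lt lL; rewrite /expected lt /cur_hold /n_phase /=.
have -> : (L - (t %% L.+1).+1).+1 = L - t %% L.+1 by lia.
case: eqP => [->|nt]; first by rewrite subn0 -leaf_holdE.
by rewrite /place_at; case: eqP => // h; lia.
Qed.

Lemma cur_place_expected t v : t < check_start j -> t %% L.+1 < L ->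
  cur_place (expected om j t v) = place_at om j (t %/ L.+1) (L - (t %% L.+1).+1).
Proof.
move=> lt lL; rewrite /expected lt /cur_place /n_phase /n_step /= /place_at.
by case: eqP => // h; have := lg_gt0; lia.
Qed.

Lemma divmod_next t : t %% L.+1 < L ->
  (t.+1 %/ L.+1 = t %/ L.+1) /\ (t.+1 %% L.+1 = (t %% L.+1).+1).
Proof.
have := divn_eq t L.+1; move: (t %/ L.+1) (t %% L.+1) => q r -> lt.
by rewrite -addnS divnMDl // modnMDl divn_small ?addn0 ?modn_small.
Qed.

Lemma divmod_last t : t %% L.+1 = L ->
  (t.+1 %/ L.+1 = (t %/ L.+1).+1) /\ (t.+1 %% L.+1 = 0).
Proof.
have := divn_eq t L.+1; move: (t %/ L.+1) (t %% L.+1) => q r -> ->.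
by rewrite -addnS divnMDl // modnMDl divnn modnn addn1.
Qed.

Lemma emit_up t v z w : t < check_start j -> t %% L.+1 < L ->
  emit (expected om j t v) z w =
  send_up (held (contributors_at om j (t %/ L.+1))
    (L - (t %% L.+1).+1).+1 (place_at om j (t %/ L.+1) (L - (t %% L.+1).+1).+1) v)
    (place_at om j (t %/ L.+1) (L - (t %% L.+1).+1)) z w.
Proof.
move=> lt lL; rewrite /emit cur_hold_expected // cur_place_expected //.
by rewrite /expected lt /n_phase /= lt lL.
Qed.

Lemma absorb_up t v rcv : t < check_start j -> t %% L.+1 < L ->
  absorb (expected om j t v) rcv = Node om v (nbrs v) j t.+1 (state om j (t %/ L.+1) v)
    (merge_up (cur_place (expected om j t v)) rcv) false false.
Proof. by move=> lt lL; rewrite /absorb /expected lt /n_phase /= lt lL. Qed.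

Lemma round_up t (cfg : 'I_n -> node) : t < check_start j -> t %% L.+1 < L ->
  loads_ok om j (t %/ L.+1) -> (forall v, cfg v = expected om j t v) ->
  forall v, next cfg v = expected om j t.+1 v.
Proof.
move=> lt lL [_ okT] hc v; rewrite hc absorb_up // cur_place_expected //.
have -> : [ffun z : Sub * 'I_n => emit (cfg z.2) z.1 v] = [ffun z =>
  send_up (held (contributors_at om j (t %/ L.+1))
    (L - (t %% L.+1).+1).+1 (place_at om j (t %/ L.+1) (L - (t %% L.+1).+1).+1) z.2)
    (place_at om j (t %/ L.+1) (L - (t %% L.+1).+1)) z.1 v].
  by apply/ffunP => z; rewrite !ffunE hc emit_up.
have lev_lt : L - (t %% L.+1).+1 < L by have := lg_gt0; lia.
rewrite merge_upE //; last by move=> b x x'; exact: okT.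
  have [e1 e2] := divmod_next lL.
  have lt' : t.+1 < check_start j.
    rewrite ltn_neqAle lt andbT; apply/eqP => h.
    by move: e2; rewrite h /check_start modnMl.
  by rewrite /expected lt' e1 e2 /place_at; case: eqP => // h; lia.
exact: leq_pow_lg.
Qed.

Lemma mid_data_expected t v : t < check_start j -> t %% L.+1 = L ->
  mid_data (expected om j t v) = mid_step (t %/ L.+1 < nsteps j) j
    (coins_at om j (t %/ L.+1)) (state om j (t %/ L.+1)) v.
Proof.
move=> lt lL; rewrite /expected lt lL /mid_data /n_orient /n_coins /n_step /=.
have /negbTE-> : L != 0 by rewrite -lt0n lg_gt0.
rewrite /mid_step; congr upd; apply/ffunP => b; rewrite !ffunE subnn /place /= eqxx.
rewrite (_ : below _ _ _ = contributors (t %/ L.+1 < nsteps j) j (coins_at om j (t %/ L.+1))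
   (state om j (t %/ L.+1)) (v, b)); first by case: (enc _ _).
apply/setP => u; rewrite !inE subn0 /= mod0n (@divn_small u) ?eqxx ?andbT //.
exact: leq_trans (ltn_ord u) leq_pow_lg.
Qed.

Lemma emit_answer t v z w : t < check_start j -> t %% L.+1 = L ->
  emit (expected om j t v) z w =
  if (z == sub_first) && (d_win (mid_step (t %/ L.+1 < nsteps j) j
    (coins_at om j (t %/ L.+1)) (state om j (t %/ L.+1)) v) == Some w)
  then Some dummy else None.
Proof.
move=> lt lL; rewrite /emit mid_data_expected //.
by rewrite /expected lt /n_phase /= lt lL ltnn.
Qed.

Lemma absorb_answer t v rcv : t < check_start j -> t %% L.+1 = L ->
  absorb (expected om j t v) rcv = Node om v (nbrs v) j t.+1
    (set_mate (mid_data (expected om j t v)) [pick u | rcv (sub_first, u) != None])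
    no_hold false false.
Proof. by move=> lt lL; rewrite /absorb /expected lt /n_phase /= lt lL ltnn. Qed.

Lemma round_answer t (cfg : 'I_n -> node) : t < check_start j -> t %% L.+1 = L ->
  (forall v, cfg v = expected om j t v) ->
  forall v, next cfg v = expected om j t.+1 v.
Proof.
move=> lt lL hc v /=; rewrite hc absorb_answer // mid_data_expected //.
have [e1 e2] := divmod_last lL.
set X1 := mid_step _ _ _ _.
have -> : [pick u | [ffun z : Sub * 'I_n => emit (cfg z.2) z.1 v] (sub_first, u) != None]
        = [pick u | d_win (X1 u) == Some v].
  by apply: eq_pick => u; rewrite /= ffunE hc emit_answer // eqxx /= -/X1; case: (d_win (X1 u) == Some v).
have sE : set_mate (X1 v) [pick u | d_win (X1 u) == Some v] = state om j (t %/ L.+1).+1 v by [].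
rewrite sE /expected e2 eqxx.
move: lt; rewrite leq_eqVlt => /orP[/eqP h|->]; last by rewrite e1.
by rewrite h ltnn eqxx -e1 h /check_start mulnK.
Qed.

Lemma cur_flag_expected l v : l < L ->
  cur_flag (expected om j (check_start j + l) v)
  = [exists u, final_pending om j u && (dist u v < 2 ^ l)].
Proof.
move=> lL; rewrite /expected ltnNge leq_addr /= /cur_flag /=.
case: (posnP l) => [->|l0].
  rewrite addn0 eqxx -/(final_pending om j v); apply/idP/existsP => [h|[u /andP[h d]]].
    by exists v; rewrite h /dist leqnn subnn.
  suff <- : u = v by [].
  by apply: val_inj; have := ltn_ord u; move: d; rewrite /dist /= expn0; case: ifP => ?; lia.
have -> : (check_start j + l == check_start j) = false by lia.
by rewrite addKn.
Qed.

Lemma shiftE (u : 'I_n) k : k < n ->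
  shift u k = (if u + k < n then u + k else u + k - n) :> nat.
Proof. by move=> lk; rewrite /shift inordK //; have := ltn_ord u; case: ifP => ?; lia. Qed.

Lemma pow_lt_n l : l < L -> 2 ^ l < n.
Proof.
move=> lL; apply: leq_ltn_trans ltn_pow_lg_pred; rewrite leq_exp2l //; lia.
Qed.

Lemma emit_check l v z w : l < L ->
  emit (expected om j (check_start j + l) v) z w =
  if [&& z == sub_first, [exists u, final_pending om j u && (dist u v < 2 ^ l)]
       & w == shift v (2 ^ l)] then Some dummy else None.
Proof.
move=> lL; rewrite /emit cur_flag_expected //.
have ge : (check_start j + l < check_start j) = false by lia.
by rewrite /expected ge /= ge addKn.
Qed.

Lemma round_check l (cfg : 'I_n -> node) : l < L ->
  (forall v, cfg v = expected om j (check_start j + l) v) ->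
  forall v, next cfg v = if l.+1 < L then expected om j (check_start j + l).+1 v
                         else ended om j v.
Proof.
move=> lL hc v.
have fE : cur_flag (expected om j (check_start j + l) v) ||
    [exists u, [ffun z : Sub * 'I_n => emit (cfg z.2) z.1 v] (sub_first, u) != None]
    = [exists u, final_pending om j u && (dist u v < 2 ^ l.+1)].
  rewrite cur_flag_expected //.
  have pl := pow_lt_n lL; have p0 := pow2_gt0 l.
  apply/orP/existsP => [[/existsP[u /andP[hu du]]|/existsP[u]]|[u /andP[hu du]]].
  - by exists u; rewrite hu (leq_trans du) // leq_exp2l.
  - rewrite ffunE hc emit_check // eqxx /=; case: ifP => // /andP[/existsP[w /andP[hw dw]] /eqP vE] _.
    exists w; rewrite hw /= expnS.
    have := shiftE u pl; rewrite -vE => vN; move: dw vN; rewrite /dist.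
    by have := ltn_ord u; have := ltn_ord w; repeat (case: ifP => ?); lia.
  case: (ltnP (dist u v) (2 ^ l)) => dl; [left|right].
    by apply/existsP; exists u; rewrite hu dl.
  (* The node [2 ^ l] places before [v]: a flag at distance between [2 ^ l] and [2 ^ l.+1] is
     already known there and is forwarded to [v] in this super-round. *)
  pose u' : 'I_n := inord (if 2 ^ l <= v then v - 2 ^ l else v + n - 2 ^ l).
  have u'E : u' = (if 2 ^ l <= v then v - 2 ^ l else v + n - 2 ^ l) :> nat.
    by rewrite inordK //; have := ltn_ord v; case: ifP => ?; lia.
  apply/existsP; exists u'; rewrite ffunE hc emit_check // eqxx /=.
  have -> : v == shift u' (2 ^ l).
    apply/eqP/val_inj => /=; have := shiftE u' pl; move: u'E; have := ltn_ord v.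
    by repeat (case: ifP => ?); lia.
  suff -> : [exists w, final_pending om j w && (dist w u' < 2 ^ l)] by [].
  apply/existsP; exists u; rewrite hu /=; move: dl du u'E; rewrite /dist expnS.
  by have := ltn_ord v; have := ltn_ord u; repeat (case: ifP => ?); lia.
have absE rcv : absorb (expected om j (check_start j + l) v) rcv =
  let f' := cur_flag (expected om j (check_start j + l) v)
            || [exists u, rcv (sub_first, u) != None] in
  if l.+1 < L then Node om v (nbrs v) j (check_start j + l).+1 (state om j (2 * nsteps j) v)
     no_hold f' false
  else if f' then start om v (nbrs v) j.+1
  else Node om v (nbrs v) j (check_start j + l).+1 (state om j (2 * nsteps j) v) no_hold f' true.
  have ge : (check_start j + l < check_start j) = false by lia.
  rewrite /absorb /expected ge /= ge /stage_len.
  by rewrite -addnS ltn_add2l.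
rewrite hc absE fE /=; case: ltnP => l1.
  have ge : (check_start j + l.+1 < check_start j) = false by lia.
  rewrite /expected -addnS ge addKn.
  by have -> : (check_start j + l.+1 == check_start j) = false by lia.
have lE : l.+1 = L by lia.
rewrite lE -addnS lE /ended.
have -> : [exists u, final_pending om j u && (dist u v < 2 ^ L)] = [exists u, final_pending om j u].
  apply: eq_existsb => u; rewrite (_ : dist u v < 2 ^ L) ?andbT //.
  apply: leq_trans leq_pow_lg; rewrite /dist; have := ltn_ord u; have := ltn_ord v.
  by case: ifP => ?; lia.
by rewrite -/(stage_len j); case E: [exists u, final_pending om j u].
Qed.

Lemma enc_max (A : {set 'I_n}) x : enc L A = Some x -> exists2 u : 'I_n, u \in A & x.2 = u :> nat.
Proof.
rewrite /enc; case: ifP => // /negbT/set0Pn[u0 u0A] [<-] /=.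
have [|u uA ->] := @eq_bigmax_cond _ (mem A) (fun u : 'I_n => u : nat); first by apply/card_gt0P; exists u0.
by exists u => //; rewrite modn_small //; apply: leq_trans (ltn_ord u) leq_pow_lg.
Qed.

Lemma win_propose orient i y (X : global) u v :
  d_win (mid_step orient i y X u) = Some v ->
  [/\ ~~ orient, propose y v (X v) = Some u, y.2 u & d_mate (X u) = None].
Proof.
case: orient => //=; rewrite /accept ffunE; case: ifP => // /andP[/eqP mu yu].
case E: (enc _ _) => [x|] //= [hv]; have [w + xw] := enc_max E.
rewrite xw inord_val in hv; rewrite hv inE /= inE /= => /andP[/eqP-> _].
by split.
Qed.

Lemma card_le1 (P : pred 'I_n) : {in P &, forall u v, u = v} -> #|P| <= L.
Proof.
move=> hP; apply: leq_trans lg_gt0; apply/card_le1_eqP => u v uP vP.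
exact: hP.
Qed.

(** While climbing, the loads bound the traffic. In the answering phase a node answers at most one
    proposal and has itself made at most one. During the check, [shift] is injective. *)
Lemma traffic_expected t v z : (forall s, s < 2 * nsteps j -> loads_ok om j s) ->
  t < stage_len j ->
  (#|[pred w | emit (expected om j t v) z w != None]| <= L) /\
  (#|[pred u | emit (expected om j t u) z v != None]| <= L).
Proof.
move=> ok lt; case: (ltnP t (check_start j)) => lc.
  have [okL okT] : loads_ok om j (t %/ L.+1) by apply: ok; rewrite ltn_divLR.
  case: (ltnP (t %% L.+1) L) => lL.
    have lev_lt : L - (t %% L.+1).+1 < L by have := lg_gt0; lia.
    have lq := leq_pow_lg.
    split.
      rewrite (eq_card (B := [pred w | send_up (held (contributors_at om j (t %/ L.+1))
        (L - (t %% L.+1).+1).+1 (place_at om j (t %/ L.+1) (L - (t %% L.+1).+1).+1) v)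
        (place_at om j (t %/ L.+1) (L - (t %% L.+1).+1)) z w != None])); last first.
        by move=> w; rewrite !inE emit_up.
      by apply: send_up_out => // y; apply: okL.
    rewrite (eq_card (B := [pred u | send_up (held (contributors_at om j (t %/ L.+1))
        (L - (t %% L.+1).+1).+1 (place_at om j (t %/ L.+1) (L - (t %% L.+1).+1).+1) u)
        (place_at om j (t %/ L.+1) (L - (t %% L.+1).+1)) z v != None])); last first.
      by move=> w; rewrite !inE emit_up.
    by apply: send_up_in => // y; apply: okL; exact: ltnW.
  have eL : t %% L.+1 = L by have := ltn_pmod t (ltn0Sn L); lia.
  split; apply: card_le1 => u w; rewrite !inE !emit_answer //.
    case: ifP => // /andP[_ /eqP h1] _; case: ifP => // /andP[_ /eqP h2] _.
    by move: h2; rewrite h1 => -[].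
  case: ifP => // /andP[_ /eqP/win_propose[_ h1 _ _]] _.
  by case: ifP => // /andP[_ /eqP/win_propose[_ h2 _ _]] _; move: h2; rewrite h1 => -[].
have ll : t - check_start j < L by move: lt; rewrite /stage_len; lia.
have lE : t = check_start j + (t - check_start j) by lia.
have pl := pow_lt_n ll.
split; apply: card_le1 => u w; rewrite !inE lE !emit_check //.
  by case: ifP => // /and3P[_ _ /eqP->] _; case: ifP => // /and3P[_ _ /eqP->].
case: ifP => // /and3P[_ _ /eqP h1] _; case: ifP => // /and3P[_ _ /eqP h2] _.
apply: val_inj => /=; have := shiftE u pl; have := shiftE w pl; rewrite -h1 -h2.
by have := ltn_ord u; have := ltn_ord w; repeat (case: ifP => ?); lia.
Qed.

Lemma expected0 v : expected om j 0 v = start om v (nbrs v) j.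
Proof.
rewrite /expected (_ : 0 < check_start j) ?mod0n ?div0n //.
by rewrite /check_start !muln_gt0 /nsteps addn1.
Qed.

Lemma expected_live t v : n_halt (expected om j t v) = false.
Proof. by rewrite /expected; case: ifP. Qed.

Lemma stage_run (cfg : 'I_n -> node) : (forall s, s < 2 * nsteps j -> loads_ok om j s) ->
  (forall v, cfg v = start om v (nbrs v) j) ->
  (forall t, t < stage_len j -> forall v, iter t (fun c => next c) cfg v = expected om j t v) /\
  (forall v, iter (stage_len j) (fun c => next c) cfg v = ended om j v).
Proof.
move=> ok h0.
have run t : t < stage_len j -> forall v, iter t (fun c => next c) cfg v = expected om j t v.
  elim: t => [|t IH] lt v; first by rewrite /= h0 expected0.
  have {}IH := IH (ltnW lt); rewrite iterS.
  case: (ltnP t (check_start j)) => lc.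
    case: (ltnP (t %% L.+1) L) => lL.
      by apply: round_up => //; apply: ok; rewrite ltn_divLR.
    by apply: round_answer => //; have := ltn_pmod t (ltn0Sn L); lia.
  have lE : t = check_start j + (t - check_start j) by lia.
  have l1 : (t - check_start j).+1 < L by move: lt; rewrite /stage_len; lia.
  rewrite (@round_check (t - check_start j)); [by rewrite l1 -lE|exact: ltnW|].
  by rewrite -lE.
split=> // v.
have L0 := lg_gt0.
have -> : stage_len j = (check_start j + L.-1).+1 by rewrite /stage_len; lia.
rewrite iterS (@round_check L.-1); first by rewrite prednK // ltnn.
  by lia.
by move=> u; apply: run; rewrite /stage_len; lia.
Qed.

End Rounds.

Definition advance (cfg : 'I_n -> node) : 'I_n -> node :=
  fun v => absorb (cfg v) [ffun z => emit (cfg z.2) z.1 v].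

Definition run om t : 'I_n -> node := iter t advance (fun v => start om v (nbrs v) 0).

Definition stage_start j := \sum_(i < j) stage_len i.

(** The run halts with the first stage that leaves nothing pending; [J] bounds this stage, and loads
    are needed only up to it. *)
Lemma run_stages om J :
  (forall j s, j <= J -> s < 2 * nsteps j -> loads_ok om j s) ->
  ~~ [exists u, final_pending om J u] ->
  exists2 j, j <= J & let T := stage_start j.+1 in
    [/\ forall t, t < T -> forall v z, [/\ ~~ n_halt (run om t v),
          #|[pred w | emit (run om t v) z w != None]| <= L
        & #|[pred u | emit (run om t u) z v != None]| <= L],
      forall v, n_halt (run om T v),
      forall v, n_data (run om T v) = state om j (2 * nsteps j) v
    & ~~ [exists u, final_pending om j u]].
Proof.
move=> ok finJ.
have ex : exists j, ~~ [exists u, final_pending om j u] by exists J.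
case: (ex_minnP ex) => j finj minj; have leJ := minj J finJ.
have pend i : i < j -> [exists u, final_pending om i u].
  by move=> li; apply: contraLR li => /minj; rewrite -leqNgt.
have start_stage i : i <= j -> forall v, run om (stage_start i) v = start om v (nbrs v) i.
  elim: i => [|i IH] li v; first by rewrite /stage_start big_ord0.
  have [_ en] := stage_run (fun s => @ok i s (leq_trans (ltnW li) leJ)) (IH (ltnW li)).
  rewrite /stage_start big_ord_recr /= addnC /run iterD.
  by rewrite [LHS]en /ended pend.
have in_stage i l : i <= j -> l < stage_len i ->
    forall v, run om (stage_start i + l) v = expected om i l v.
  move=> li ll v; have [ru _] := stage_run (fun s => @ok i s (leq_trans li leJ)) (start_stage i li).
  by rewrite addnC /run iterD; exact: ru.
exists j => //=.
have endE v : run om (stage_start j.+1) v = ended om j v.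
  have [_ en] := stage_run (fun s => @ok j s leJ) (start_stage j (leqnn j)).
  by rewrite /stage_start big_ord_recr /= addnC /run iterD; exact: en.
split=> //; last 2 first.
- by move=> v; rewrite endE /ended (negbTE finj).
- by move=> v; rewrite endE /ended (negbTE finj).
move=> t lt v z.
have [i [l [li ll ->]]] : exists i l, [/\ i <= j, l < stage_len i & t = stage_start i + l].
  have split_time k : k <= j -> t < stage_start k.+1 ->
      exists i l, [/\ i <= j, l < stage_len i & t = stage_start i + l].
    elim: k => [|k IH] lk ltk.
      by exists 0, t; split=> //; move: ltk; rewrite /stage_start ?big_ord_recr ?big_ord0.
    case: (ltnP t (stage_start k.+1)) => h; first exact: IH (ltnW lk) h.
    exists k.+1, (t - stage_start k.+1); split=> //; last by lia.
    by move: ltk; rewrite {1}/stage_start big_ord_recr /= -/(stage_start k.+1); lia.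
  exact: split_time (leqnn j) lt.
have [t1 t2] := traffic_expected v z (fun s => @ok i s (leq_trans li leJ)) ll.
split; first by rewrite in_stage // expected_live.
  by rewrite in_stage.
by rewrite (eq_card (B := [pred u | emit (expected om i l u) z v != None])) // => u; rewrite !inE in_stage.
Qed.
End Algorithm.

(** * Invariants *)

Section Invariants.
Variables (m : nat) (e : rel 'I_m.+2) (j : nat).
Local Notation n := m.+2.
Local Notation L := (lg m.+2).
Hypotheses (sym_e : symmetric e) (irr_e : irreflexive e).
Implicit Types (X : global m) (y : coins m) (u v w : 'I_n).

Definition in_nbrs X v : {set 'I_n} := [set u | v \in d_out (X u)].

(** [d_in] lags one step behind, as it counts the edges already in [d_old]. [inv_cap] is phrased
    through [d_in], which never decreases, and yields the outdegree bound [card_out]. [inv_done]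
    says that an edge leaves [d_todo] only when one of its endpoints is matched. *)
Record sound X : Prop := Sound {
  inv_out : forall v, d_out (X v) \subset nbrs e v;
  inv_old : forall v, d_old (X v) \subset d_out (X v);
  inv_asym : forall v w, w \in d_out (X v) -> v \notin d_out (X w);
  inv_in : forall v, d_in (X v) = #|[set u | v \in d_old (X u)]|;
  inv_cap : forall v, d_out (X v) = set0 \/ #|nbrs e v| - d_in (X v) <= cap_deg m j;
  inv_new : forall v, #|d_out (X v) :\: d_old (X v)| <= nbuckets m;
  inv_mate : forall v u, d_mate (X v) = Some u -> e v u /\ d_mate (X u) = Some v;
  inv_todo : forall v, d_todo (X v) \subset d_out (X v);
  inv_done : forall u w, w \in d_out (X u) -> w \notin d_todo (X u) ->
    (d_mate (X u) != None) || (d_mate (X w) != None) }.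

Lemma sound0 : sound (global0 (m := m)).
Proof.
split=> //=; rewrite /global0 /=.
- by move=> v; rewrite sub0set.
- by move=> v w; rewrite inE.
- by move=> v; apply/esym/eqP; rewrite cards_eq0; apply/eqP/setP => u; rewrite !inE.
- by left.
- by move=> v; rewrite set0D cards0.
- by move=> u w; rewrite inE.
Qed.

Lemma in_nbrs_sub X v : sound X -> in_nbrs X v \subset nbrs e v.
Proof.
move=> iX; apply/subsetP => u; rewrite !inE => vu.
by have := subsetP (inv_out iX u) _ vu; rewrite inE sym_e.
Qed.

Lemma nbrs_small v (A : {set 'I_n}) : A \subset nbrs e v -> #|A| < n.
Proof.
move=> sA; have : A \proper [set: 'I_n].
  by rewrite properE subsetT /=; apply/subsetPn; exists v => //;
     apply: contraFN (irr_e v) => /(subsetP sA); rewrite inE.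
by move/proper_card; rewrite cardsT card_ord.
Qed.

Lemma val_countE v (A : {set 'I_n}) : A \subset nbrs e v -> val_count (enc L A) = #|A|.
Proof.
move=> sA; rewrite /enc; case: eqP => [->|_] /=; first by rewrite cards0.
by rewrite modn_small //; apply: leq_trans (nbrs_small sA) (leq_pow_lg m).
Qed.

Lemma val_sumE (A : {set 'I_n}) : val_sum (enc L A) = (\sum_(x in A) x) %% 2 ^ L.
Proof. by rewrite /enc; case: eqP => [->|_] //=; rewrite big_set0 mod0n. Qed.

(** * Orientation steps preserve the invariant *)

Section OrientStep.
Variables (X : global m) (iX : sound X) (y : coins m).
Let res v : {ffun 'I_(nbuckets m).+1 -> option (value L)} :=
  [ffun b => enc L (contributors true j y X (v, b))].

Lemma bucket_lt (h : hashval m) b : bucket j h = Some b -> b < nbuckets m.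
Proof. by rewrite /bucket; case: ifP => // _ [<-]. Qed.

Lemma contributors_max v :
  contributors true j y X (v, ord_max) = [set u | v \in d_out (X u) :\: d_old (X u)].
Proof.
apply/setP => u; rewrite !inE /= eqxx /= orb_idl // => /and4P[_ _ _ /eqP/bucket_lt].
by rewrite ltnn.
Qed.

(** The announcements make up for the lag of [d_in]: the two together give the exact indegree. *)
Lemma d_in_next v : d_in (X v) + val_count (res v ord_max) = #|in_nbrs X v|.
Proof.
rewrite (inv_in iX) ffunE contributors_max (val_countE (v := v)); last first.
  apply: subset_trans (in_nbrs_sub v iX); apply/subsetP => u.
  by rewrite !inE => /andP[].
rewrite -(cardsID [set u | v \in d_old (X u)] (in_nbrs X v)); congr addn; apply: eq_card => u.
  by rewrite !inE andb_idl // => /(subsetP (inv_old iX u)).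
by rewrite !inE.
Qed.

Definition low v := #|nbrs e v| - #|in_nbrs X v| <= cap_deg m j.

Definition unknown v b : {set 'I_n} :=
  candidates j y v (nbrs e v) (X v) b :\: in_nbrs X v.

Lemma contributors_lt v (b : 'I_(nbuckets m).+1) : b < nbuckets m -> ~~ y.2 v ->
  contributors true j y X (v, b) = candidates j y v (nbrs e v) (X v) b :&: in_nbrs X v.
Proof.
move=> lb yv; apply/setP => u; rewrite !inE /= yv /= (ltn_eqF lb) /= orbF.
case: (boolP (v \in d_out (X u))) => vu; rewrite ?andbF //= andbT.
have -> : e v u by have := subsetP (inv_out iX u) _ vu; rewrite inE sym_e.
by rewrite (inv_asym iX vu).
Qed.

(** The reports come exactly from the candidates that are in-neighbours. Comparing counts tells [v]
    that a single candidate is unreported; the difference of the sums, known modulo [2 ^ L], is then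
    its identifier. *)
Lemma identifiedE v (b : 'I_(nbuckets m).+1) : b < nbuckets m -> ~~ y.2 v ->
  identified j y v (nbrs e v) (X v) b (res v b) =
  if #|unknown v b| == 1 then unknown v b else set0.
Proof.
move=> lb yv; set F := candidates j y v (nbrs e v) (X v) b.
have CE := contributors_lt lb yv; rewrite -/F in CE.
have cF := cardsID (in_nbrs X v) F; rewrite -[_ :\: _]/(unknown v b) in cF.
have cnt : val_count (res v b) = #|F :&: in_nbrs X v|.
  rewrite ffunE (val_countE (v := v)) CE //; apply: subset_trans (in_nbrs_sub v iX).
  exact: subsetIr.
have sF : \sum_(x in F) x = \sum_(x in F :&: in_nbrs X v) x + \sum_(x in unknown v b) x.
  rewrite (bigID (fun x => x \in in_nbrs X v)) /=; congr addn; apply: eq_bigl => x.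
    by rewrite in_setI.
  by rewrite in_setD andbC.
rewrite /identified -/F cnt.
have -> : (#|F| == #|F :&: in_nbrs X v| + 1) = (#|unknown v b| == 1).
  by rewrite -cF eqn_add2l.
case: ifP => [/cards1P[w0 Rw]|_]; last by apply/setP => w; rewrite !inE andbF.
apply/setP => w; rewrite in_set /= Rw in_set1.
have w0F : w0 \in F by have : w0 \in unknown v b by [rewrite Rw inE]; rewrite inE => /andP[].
have lt (x : 'I_n) : x < 2 ^ L by exact: leq_trans (ltn_ord x) (leq_pow_lg m).
have -> : (modI L (\sum_(x in F) x) == modI L (val_sum (res v b) + w)) = (w == w0).
  rewrite -val_eqE /= ffunE val_sumE CE modnDml sF Rw big_set1 eqn_modDl.
  by rewrite !modn_small // eq_sym.
by case: eqP => [->|_]; rewrite ?w0F ?andbF.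
Qed.

Lemma freshP v w : reflect
  [/\ ~~ y.2 v, low v & exists2 b, b < nbuckets m & unknown v b = [set w]]
  (w \in fresh j y v (nbrs e v) (X v) (res v)).
Proof.
rewrite /fresh d_in_next; apply: (iffP idP) => [|[yv lv [b lb ub]]].
  case: ifP; last by rewrite inE.
  case/andP=> yv lv; rewrite inE => /existsP[b /andP[lb]]; rewrite identifiedE //.
  case: ifP; last by rewrite inE.
  case/cards1P=> w0 E; rewrite E => /set1P->; split=> //; by exists b.
have lb' : b < (nbuckets m).+1 by exact: ltnW.
rewrite yv -/(low v) lv inE /=; apply/existsP; exists (Ordinal lb').
by rewrite (@identifiedE v (Ordinal lb')) //= lb ub cards1 eqxx inE eqxx.
Qed.

(** Fresh edges lead from tails to heads, so the two endpoints cannot orient the same edge in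
    opposite directions in one step. *)
Lemma fresh_sound v w : w \in fresh j y v (nbrs e v) (X v) (res v) ->
  [/\ ~~ y.2 v, y.2 w, w \in nbrs e v, w \notin d_out (X v) & v \notin d_out (X w)].
Proof.
case/freshP=> yv _ [b _ ub]; have : w \in unknown v b by rewrite ub inE.
by rewrite !inE => /andP[-> /andP[/andP[-> ->] /andP[-> _]]].
Qed.

Lemma step_orient v : step e true j X y v =
  upd_orient j y v (nbrs e v) (X v) (res v).
Proof.
by rewrite /step; case: pickP.
Qed.

Lemma out_step_orient v : d_out (step e true j X y v) =
  d_out (X v) :|: fresh j y v (nbrs e v) (X v) (res v).
Proof. by rewrite step_orient. Qed.

Lemma card_fresh v : #|fresh j y v (nbrs e v) (X v) (res v)| <= nbuckets m.
Proof.
pose F (b : 'I_(nbuckets m)) := if #|unknown v b| == 1 then unknown v b else set0.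
apply: leq_trans (_ : #|\bigcup_(b | xpredT b) F b| <= _).
  apply: subset_leq_card; apply/subsetP => w /freshP[_ _ [b lb ub]].
  by apply/bigcupP; exists (Ordinal lb) => //; rewrite /F /= ub cards1 eqxx inE.
apply: leq_trans (card_bigcup_leq _ _) _.
rewrite -[X in _ <= X]card_ord -sum1_card; apply: leq_sum => b _.
by rewrite /F; case: eqP => [->|_]; rewrite ?cards0.
Qed.

Lemma inv_step_orient : sound (step e true j X y).
Proof.
split.
- move=> v; rewrite out_step_orient subUset (inv_out iX) /=.
  by apply/subsetP => w /fresh_sound[].
- by move=> v; rewrite step_orient /= subsetUl.
- move=> v w; rewrite !out_step_orient !inE negb_or => /orP[wv|/fresh_sound[yv yw _ _ ->]] /=.
    rewrite (inv_asym iX wv) /=; apply/negP => /fresh_sound[_ _ _ _].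
    by rewrite wv.
  by apply/negP => /fresh_sound[]; rewrite yw.
- move=> v; rewrite step_orient /= d_in_next; apply: eq_card => u.
  by rewrite !inE step_orient.
- move=> v; rewrite step_orient /= d_in_next.
  case: (set_0Vmem (fresh j y v (nbrs e v) (X v) (res v))) => [->|[w /freshP[_ lv _]]]; last by right.
  (* Without a fresh edge the old bound persists because [d_in] only grows; with one, [v] has just
     passed the test [low]. *)
  rewrite setU0; case: (inv_cap iX v) => [->|h]; [by left|right].
  by apply: leq_trans h; rewrite leq_sub2l // -d_in_next leq_addr.
- move=> v; rewrite step_orient /=; apply: leq_trans (card_fresh v); apply: subset_leq_card.
  by rewrite subDset.
- by move=> v u; rewrite !step_orient /=; exact: (inv_mate iX).
- by move=> v; rewrite step_orient.
- by move=> u w; rewrite !step_orient /= => ->.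
Qed.
End OrientStep.

(** * Matching steps preserve the invariant *)

Section MatchStep.
Variables (X : global m) (iX : sound X) (y : coins m).
Let X1 := mid_step e false j y X.
Let X' := step e false j X y.

Lemma proposeP u w : propose y u (X u) = Some w ->
  [/\ d_mate (X u) = None, ~~ y.2 u, w \in d_todo (X u) & y.2 w].
Proof.
rewrite /propose; case: ifP => // /andP[/eqP mu yu].
by case: pickP => // w' /andP[tw yw] [<-].
Qed.

Lemma winP u v : d_win (X1 u) = Some v ->
  [/\ [/\ d_mate (X u) = None, d_mate (X v) = None & propose y v (X v) = Some u],
      y.2 u, ~~ y.2 v & u \in d_todo (X v)].
Proof. by case/win_propose=> _ pv yu mu; have [mv yv tv _] := proposeP pv. Qed.

Lemma mate_win u v : d_win (X1 u) = Some v -> d_mate (X' u) = Some v /\ d_mate (X' v) = Some u.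
Proof.
move=> win; have [[mu mv pv] yu yv tv] := winP win; split; rewrite /X' /step -/X1.
  case: pickP => [z /eqP/winP[_ _]|_]; first by rewrite yu.
  by move: win; rewrite /X1 /mid_step /= => ->.
case: pickP => [z /eqP/winP[[_ _ pz] _ _ _]|/(_ u)]; last by rewrite win eqxx.
by move: pz; rewrite pv => -[->].
Qed.

Lemma mate_keep v : (forall u, d_win (X1 u) <> Some v) -> d_win (X1 v) = None ->
  d_mate (X' v) = d_mate (X v).
Proof.
move=> nw nv; rewrite /X' /step -/X1; case: pickP => [u /eqP/nw//|_].
by move: nv; rewrite /X1 /mid_step /= => ->.
Qed.

Lemma mate_old v u : d_mate (X v) = Some u -> d_mate (X' v) = Some u.
Proof.
move=> mv; rewrite mate_keep // => [z /winP[[_]]|]; first by rewrite mv.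
by case E: (d_win _) => [z|] //; move/winP: E => [[]]; rewrite mv.
Qed.

Lemma mate_new v u : d_mate (X' v) = Some u ->
  [\/ d_mate (X v) = Some u, d_win (X1 v) = Some u | d_win (X1 u) = Some v].
Proof.
case E: (d_win (X1 v)) => [z|].
  by have [-> _] := mate_win E => -[->]; constructor 2.
case: (pickP (fun z => d_win (X1 z) == Some v)) => [z /eqP hz|nz].
  by have [_ ->] := mate_win hz => -[<-]; constructor 3.
rewrite mate_keep // => [h|z hz]; first by constructor 1.
by have := nz z; rewrite hz eqxx.
Qed.

Lemma fields_match v :
  [/\ d_out (X' v) = d_out (X v), d_old (X' v) = d_old (X v), d_in (X' v) = d_in (X v)
    & d_todo (X' v) = if propose y v (X v) is Some w then d_todo (X v) :\ w else d_todo (X v)].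
Proof. by rewrite /X' /step; case: pickP. Qed.

(** An unmatched head that receives proposals accepts one of them, possibly not this one. *)
Lemma propose_done u w : propose y u (X u) = Some w -> d_mate (X' w) != None.
Proof.
move=> pu; have [mu yu tw yw] := proposeP pu.
case mw: (d_mate (X w)) => [z|]; first by rewrite (mate_old mw).
case E: (d_win (X1 w)) => [z|]; first by have [-> _] := mate_win E.
move: E; rewrite /X1 /mid_step /= /accept mw yw /= ffunE /enc.
case: eqP => // /setP/(_ u); rewrite !inE /=.
by rewrite pu !eqxx.
Qed.

Lemma inv_step_match : sound X'.
Proof.
have outE v : d_out (X' v) = d_out (X v) by case: (fields_match v).
have oldE v : d_old (X' v) = d_old (X v) by case: (fields_match v).
have inE' v : d_in (X' v) = d_in (X v) by case: (fields_match v).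
have todoE v : d_todo (X' v)
    = if propose y v (X v) is Some w then d_todo (X v) :\ w else d_todo (X v).
  by case: (fields_match v).
have todoS v : d_todo (X' v) \subset d_todo (X v).
  by rewrite todoE; case: propose => // w; exact: subD1set.
split.
- by move=> v; rewrite outE (inv_out iX).
- by move=> v; rewrite outE oldE (inv_old iX).
- by move=> v w; rewrite !outE; exact: (inv_asym iX).
- by move=> v; rewrite inE' (inv_in iX); apply: eq_card => u; rewrite !inE oldE.
- by move=> v; rewrite outE inE'; exact: (inv_cap iX).
- by move=> v; rewrite outE oldE; exact: (inv_new iX).
- move=> v u /mate_new[mv|wv|wu].
  + by have [evu mu] := inv_mate iX mv; rewrite (mate_old mu).
  + have [_ _ _ tu] := winP wv; have [_ ->] := mate_win wv; split=> //.
    by have := subsetP (inv_out iX u) _ (subsetP (inv_todo iX u) _ tu); rewrite inE sym_e.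
  have [_ _ _ tu] := winP wu; have [-> _] := mate_win wu; split=> //.
  by have := subsetP (inv_out iX v) _ (subsetP (inv_todo iX v) _ tu); rewrite inE.
- by move=> v; rewrite outE (subset_trans (todoS v)) ?(inv_todo iX).
move=> u w; rewrite outE => wu nw.
have keep z : d_mate (X z) != None -> d_mate (X' z) != None.
  by case E: (d_mate (X z)) => [t|] // _; rewrite (mate_old E).
case: (boolP (w \in d_todo (X u))) => tw.
  move: nw; rewrite todoE; case E: (propose y u (X u)) => [w'|]; last by rewrite tw.
  rewrite !inE tw andbT negbK => /eqP ww; rewrite -ww in E.
  by rewrite (propose_done E) orbT.
by case/orP: (inv_done iX wu tw) => /keep->; rewrite ?orbT.
Qed.
End MatchStep.

Lemma inv_step orient X y : sound X -> sound (step e orient j X y).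
Proof. by case: orient => iX; [exact: inv_step_orient|exact: inv_step_match]. Qed.

(** Out-neighbours and announced in-neighbours are disjoint sets of neighbours, so the outdegree is
    at most the degree minus [d_in], which [inv_cap] bounds. *)
Lemma card_out X v : sound X -> #|d_out (X v)| <= cap_deg m j.
Proof.
move=> iX; case: (inv_cap iX v) => [->|]; first by rewrite cards0.
apply: leq_trans; rewrite (inv_in iX).
set A := [set u | _]; have sA : A \subset in_nbrs X v.
  by apply/subsetP => u; rewrite !inE => /(subsetP (inv_old iX u)).
have dA : d_out (X v) :&: A = set0.
  apply/setP => w; rewrite !inE; apply/negP => /andP[wv /(subsetP (inv_old iX w))].
  by apply/negP; exact: (inv_asym iX).
have cU := cardsU (d_out (X v)) A; rewrite dA cards0 subn0 in cU.
rewrite -(leq_add2r #|A|) subnK.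
  rewrite -cU; apply: subset_leq_card.
  by rewrite subUset (inv_out iX) (subset_trans sA) ?in_nbrs_sub.
by apply: subset_leq_card; rewrite (subset_trans sA) ?in_nbrs_sub.
Qed.

(** With nothing pending, out- and in-neighbours exhaust the neighbourhood, so every edge is
    oriented; its tail is matched or has an empty [d_todo], and then [inv_done] applies. *)
Lemma maximal_matching X : sound X -> (forall v, ~~ pending (nbrs e v) (X v)) ->
  is_maximal_matching e (fun v => d_mate (X v)).
Proof.
move=> iX np; apply/andP; split; apply/forallP => u; apply/forallP => v; apply/implyP.
  by move/eqP=> /(inv_mate iX)[-> ->]; rewrite eqxx.
move=> euv.
have orient_all : (v \in d_out (X u)) || (u \in d_out (X v)).
  have := np u; rewrite /pending negb_or negbK => /andP[/eqP h _].
  have dA : d_out (X u) :&: in_nbrs X u = set0.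
    apply/setP => w; rewrite !inE; apply/negP => /andP[wu].
    by apply/negP; exact: (inv_asym iX).
  have sU : d_out (X u) :|: in_nbrs X u \subset nbrs e u.
    by rewrite subUset (inv_out iX) in_nbrs_sub.
  have le_in : d_in (X u) <= #|in_nbrs X u|.
    rewrite (inv_in iX); apply: subset_leq_card; apply/subsetP => w.
    by rewrite !inE => /(subsetP (inv_old iX w)).
  have /eqP E : d_out (X u) :|: in_nbrs X u == nbrs e u.
    rewrite eqEcard sU cardsU dA cards0 subn0 /=.
    by apply: leq_trans (_ : #|d_out (X u)| + d_in (X u) <= _); [by rewrite -subn_eq0 subnDA h|rewrite leq_add2l].
  by move/setP/(_ v): E; rewrite !inE euv => ->.
have key u' v' : v' \in d_out (X u') -> (d_mate (X u') != None) || (d_mate (X v') != None).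
  move=> vu; case: (boolP (d_mate (X u') == None)) => //= mu.
  have := np u'; rewrite /pending negb_or mu /= => /andP[_]; rewrite negbK => /eqP t0.
  by have := inv_done iX vu; rewrite t0 inE mu /= => ->.
by case/orP: orient_all => /key //; rewrite orbC.
Qed.

End Invariants.

(** * Progress of a random step *)

Lemma card_ord_lt (N k : nat) : k <= N -> #|[set i : 'I_N | i < k]| = k.
Proof.
move=> kN; have injw : injective (widen_ord kN) by move=> a b [] /val_inj.
rewrite -[RHS]card_ord -cardsT -(card_imset _ injw); apply: eq_card => i; rewrite inE.
apply/idP/imsetP => [ik|[x _ ->] /=]; last exact: ltn_ord.
by exists (Ordinal ik) => //; apply: val_inj.
Qed.

Lemma exp_mono a b k : a <= b -> a ^ k <= b ^ k.
Proof. by case: k => [|k] h //; rewrite leq_exp2r. Qed.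

Lemma card_set_sum (T : finType) (P : pred T) : #|[set t | P t]| = \sum_t P t.
Proof. by rewrite -sum1_card big_mkcond /=; apply: eq_bigr => t _; rewrite inE; case: (P t). Qed.

Lemma nbuckets_gt0 m : 0 < nbuckets m.
Proof. by rewrite expn_gt0. Qed.

Lemma nbuckets_le m : nbuckets m <= 2 * lg m.+2.
Proof.
rewrite /nbuckets; have := lg_gt0 m; move: (lg m.+2) => l l0.
case: (ltnP 1 l) => l1; last by have -> : l = 1 by lia.
have := up_log_gtn (isT : 1 < 2) l1.
have : 0 < up_log 2 l by rewrite up_log_gt0.
by case: (up_log 2 l) => // k _; rewrite expnS /=; lia.
Qed.

Lemma nbuckets_ge m : lg m.+2 <= nbuckets m.
Proof. exact: up_logP. Qed.

Section Progress.
Variables (m : nat) (e : rel 'I_m.+2) (j : nat).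
Local Notation n := m.+2.
Local Notation L := (lg m.+2).
Local Notation B := (nbuckets m).
Hypotheses (sym_e : symmetric e) (irr_e : irreflexive e) (le_jL : j <= L).
Implicit Types (X : global m) (y : coins m) (u v w : 'I_n).
Local Notation hashes := {ffun 'I_n * 'I_n -> hashval m}.
Local Notation roles := {ffun 'I_n -> bool}.

Lemma card_hashval : #|hashval m| = 2 ^ (L - j) * (2 ^ (j + 4) * B).
Proof.
rewrite card_prod !card_ord mulnA -expnD; congr (2 ^ _ * _); lia.
Qed.

Lemma card_sampled : #|[set h : hashval m | bucket j h != None]| * 2 ^ (j + 4) = #|hashval m|.
Proof.
have -> : [set h : hashval m | bucket j h != None]
  = setX [set i : 'I_(2 ^ (L + 4)) | i < 2 ^ (L - j)] [set: 'I_B].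
  by apply/setP => -[a b]; rewrite !inE andbT /bucket /=; case: ifP.
rewrite cardsX cardsT card_ord card_ord_lt; last by rewrite leq_exp2l //; lia.
by rewrite card_hashval -mulnA [B * _]mulnC.
Qed.

Lemma card_bucket b : b < B ->
  #|[set h : hashval m | bucket j h == Some b]| * (2 ^ (j + 4) * B) = #|hashval m|.
Proof.
move=> lb.
have -> : [set h : hashval m | bucket j h == Some b]
  = setX [set i : 'I_(2 ^ (L + 4)) | i < 2 ^ (L - j)] [set Ordinal lb].
  by apply/setP => -[a b']; rewrite !inE /bucket /=; case: ifP.
rewrite cardsX cards1 muln1 card_ord_lt; last by rewrite leq_exp2l //; lia.
by rewrite card_hashval.
Qed.

(** Unoriented edges, each counted in both directions. *)
Definition remaining X : {set 'I_n * 'I_n} :=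
  [set p | [&& e p.1 p.2, p.2 \notin d_out (X p.1) & p.1 \notin d_out (X p.2)]].

Definition remaining_low X := [set p in remaining X | low e j X p.1].

Lemma remaining_swap X v w : ((v, w) \in remaining X) = ((w, v) \in remaining X).
Proof. by rewrite !inE /= sym_e; congr andb; rewrite andbC. Qed.

Lemma remaining_row X v : sound e j X ->
  #|[set w | (v, w) \in remaining X]| <= #|nbrs e v| - #|in_nbrs X v|
  /\ (d_out (X v) = set0 ->
      #|[set w | (v, w) \in remaining X]| = #|nbrs e v| - #|in_nbrs X v|).
Proof.
move=> iX; have sI := in_nbrs_sub sym_e v iX.
have cD : #|nbrs e v| - #|in_nbrs X v| = #|nbrs e v :\: in_nbrs X v|.
  by rewrite cardsD; move/setIidPr: sI => ->.
rewrite cD; split=> [|o0].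
  by apply: subset_leq_card; apply/subsetP => w; rewrite !inE /= => /and3P[-> _ ->].
by apply: eq_card => w; rewrite !inE /= o0 inE andbC.
Qed.

(* In the high part the edges are few by sparsity, while every high node has
   more than [cap_deg] remaining edges. *)
Lemma remaining_low_large X : sound e j X ->
  (forall W, #|pairs_in e W| <= 2 * (2 ^ j * B) * #|W|) \/ n <= cap_deg m j ->
  3 * #|remaining X| <= 8 * #|remaining_low X|.
Proof.
move=> iX hyp; pose Hi := [set v | ~~ low e j X v].
have swap_inj : injective (fun p : 'I_n * 'I_n => (p.2, p.1)) by move=> [? ?] [? ?] [-> ->].
pose P1 := [set p in remaining X | p.1 \in Hi].
pose P2 := [set p in remaining X | (p.1 \in Hi) && (p.2 \in Hi)].
have c1 : #|remaining X| = #|remaining_low X| + #|P1|.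
  rewrite -(cardsID [set p | low e j X p.1] (remaining X)); congr addn; apply: eq_card => p.
    by rewrite in_setI !in_set.
  by rewrite in_setD !in_set andbC.
have c2 : #|P1| <= #|P2| + #|remaining_low X|.
  rewrite -(cardsID [set p | p.2 \in Hi] P1); apply: leq_add.
    apply: subset_leq_card; by apply/subsetP => p; rewrite in_setI !in_set => /andP[/andP[-> ->] /= ->].
  rewrite -(card_imset (remaining_low X) swap_inj); apply: subset_leq_card.
  apply/subsetP => -[v w]; rewrite in_setD => /andP[]; rewrite !in_set negbK /= => lw.
  move=> /andP[r _]; apply/imsetP; exists (w, v) => //.
  by rewrite in_set remaining_swap lw andbT in_set.
(* With [D] standing for [2 ^ j * B], sparsity allows at most [2 * D] pairs per high node inside
   [Hi], whereas each high node has at least [8 * D] remaining pairs. If the cap is at least [n], no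
   node is high. *)
have c3 : 4 * #|P2| <= #|P1|.
  case: hyp => [sparse|small]; last first.
    have -> : P2 = set0; last by rewrite cards0.
    apply/setP => p; rewrite in_set0 !in_set; apply/negP => /andP[_ /andP[]].
    rewrite /low => /negP h _; case: h; apply: leq_trans (leq_subr _ _) _.
    exact: leq_trans (ltnW (nbrs_small irr_e (subxx (nbrs e p.1)))) small.
  have : #|P2| <= 2 * (2 ^ j * B) * #|Hi|.
    apply: leq_trans (sparse Hi); apply: subset_leq_card; apply/subsetP => p.
    by rewrite !in_set => /andP[/and3P[-> _ _] /andP[-> ->]].
  have : cap_deg m j * #|Hi| <= #|P1|.
    rewrite mulnC -sum_nat_const.
    have -> : #|P1| = \sum_(v in Hi) #|[set w | (v, w) \in remaining X]|.
      rewrite -sum1_card (eq_bigl (fun p : 'I_n * 'I_n => (p.1 \in Hi) && ((p.1, p.2) \in remaining X))).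
        rewrite -(pair_big_dep (mem Hi) (fun v w => (v, w) \in remaining X) (fun _ _ => 1)) /=.
        by apply: eq_bigr => v _; rewrite -sum1_card; apply: eq_bigl => w; rewrite inE.
      by move=> p; rewrite in_set andbC -surjective_pairing.
    apply: leq_sum => v; rewrite inE /low -ltnNge => hv.
    have [_ ->] := remaining_row v iX; first exact: ltnW.
    (* A node with outgoing edges satisfies the cap and is low; so a high node has none, and all its
       edges that are not incoming remain. *)
    case: (inv_cap iX v) => // h; have : d_in (X v) <= #|in_nbrs X v|.
      rewrite (inv_in iX); apply: subset_leq_card; apply/subsetP => w.
      by rewrite !inE => /(subsetP (inv_old iX w)).
    by move=> h'; have := leq_trans (leq_sub2l #|nbrs e v| h') h; rewrite leqNgt hv.
  rewrite /cap_deg; set a := 2 ^ j * B; nia.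
lia.
Qed.

Lemma card_roles v w : v != w ->
  #|[set r : roles | ~~ r v && r w]| * 4 = #|roles|.
Proof.
move=> nvw; rewrite -(@card_ffun_constrained _ _ [set v; w] (fun x => [set x == w]) 2).
  rewrite cards2 nvw; congr (_ * _); apply: eq_card => r; rewrite !inE.
  apply/andP/forall_inP => [[rv rw] x|h].
    by rewrite !inE => /orP[]/eqP->; rewrite ?eqxx ?rw ?(negbTE nvw) ?(negbTE rv).
  have := h v; have := h w; rewrite !inE !eqxx orbT (negbTE nvw) => /(_ isT)/eqP->.
  by move=> /(_ isT)/eqP->.
by move=> d _; rewrite cards1 card_bool.
Qed.

Lemma card_hash_at v w :
  #|[set g : hashes | bucket j (g (v, w)) != None]| * 2 ^ (j + 4) = #|hashes|.
Proof.
rewrite -(@card_ffun_constrained _ _ [set (v, w)]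
  (fun=> [set h : hashval m | bucket j h != None]) (2 ^ (j + 4))); last by move=> ? _; exact: card_sampled.
rewrite cards1 expn1; congr (_ * _); apply: eq_card => g; rewrite !in_set.
apply/idP/forall_inP => [h p|h]; first by rewrite in_set1 => /eqP->; rewrite in_set.
by have := h (v, w); rewrite in_set1 eqxx in_set => /(_ isT).
Qed.

(** Sum over the [B] buckets of the probability that both pairs fall into that bucket. *)
Lemma card_hash_collision v w w' : w != w' ->
  #|[set g : hashes | (bucket j (g (v, w)) != None) && (bucket j (g (v, w')) == bucket j (g (v, w)))]|
    * (2 ^ (j + 4) * (2 ^ (j + 4) * B)) <= #|hashes|.
Proof.
move=> nw; set E := [set g | _].
rewrite -(leq_pmul2l (nbuckets_gt0 m)).
have -> : B * (#|E| * (2 ^ (j + 4) * (2 ^ (j + 4) * B))) = #|E| * (2 ^ (j + 4) * B) ^ 2.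
  by rewrite -mulnn; lia.
have /subset_leq_card sE : E \subset [set g : hashes | [exists (b : 'I_B | xpredT b),
   [forall p in [set (v, w); (v, w')], g p \in [set h | bucket j h == Some (b : nat)]]]].
  apply/subsetP => g; rewrite !in_set => /andP[].
  case E1: (bucket j (g (v, w))) => [b|] // _ E2.
  have lb : b < B by move: E1; rewrite /bucket; case: ifP => // _ [<-].
  apply/existsP; exists (Ordinal lb) => /=; apply/forall_inP => p.
  by rewrite in_set2 => /orP[]/eqP->; rewrite in_set ?E1.
apply: leq_trans (leq_mul sE (leqnn _)) _.
have -> : B * #|hashes| = #|xpredT : pred 'I_B| * #|hashes| by rewrite card_ord.
apply: card_exists_mul_leq => b _.
rewrite -(@card_ffun_constrained _ _ [set (v, w); (v, w')]
  (fun=> [set h | bucket j h == Some (b : nat)]) (2 ^ (j + 4) * B)); last first.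
  by move=> ? _; exact: card_bucket.
by rewrite cards2 xpair_eqE eqxx /= nw.
Qed.

(** The roles are right with probability 1/4. The pair is sampled with probability [2 ^ -(j + 4)],
    and at most [8 * 2 ^ j * B] rivals collide with it, with total probability at most
    [2 ^ -(j + 5)]; so it is alone in its bucket with probability at least [2 ^ -(j + 5)]. The
    sampling rate is chosen for this subtraction. *)
Lemma fresh_likely X v w : sound e j X -> (v, w) \in remaining X -> low e j X v ->
  #|coins m| <= 2 ^ (j + 7) * #|[set y | w \in d_out (step e true j X y v)]|.
Proof.
move=> iX r lv.
have nvw : v != w.
  by apply: contraTneq r => ->; rewrite in_set /= irr_e.
pose R := [set w' | (v, w') \in remaining X] :\ w.
pose Es := [set g : hashes | bucket j (g (v, w)) != None].
pose Ec w' := [set g : hashes | (bucket j (g (v, w)) != None) && (bucket j (g (v, w')) == bucket j (g (v, w)))].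
pose Eg := Es :\: \bigcup_(w' in R) Ec w'.
have good (g : hashes) (rl : roles) : g \in Eg -> ~~ rl v && rl w ->
    w \in d_out (step e true j X (g, rl) v).
  rewrite in_setD => /andP[/bigcupP nc] ; rewrite in_set => sg /andP[rv rw].
  rewrite out_step_orient // in_setU; apply/orP; right; apply/freshP => //; split=> //.
  case E1: (bucket j (g (v, w))) sg => [b|] // _; exists b.
    by move: E1; rewrite /bucket; case: ifP => // _ [<-].
  move: r; rewrite in_set /= => /and3P[evw now nov].
  apply/setP => w'; rewrite !inE /=; apply/idP/eqP => [/and3P[nov' /andP[now' evw'] /andP[rw' /eqP bw']]|->].
    apply/eqP; apply: contraT => nw'; case: nc; exists w'.
      by rewrite !inE nw' /= evw' now' nov'.
    by rewrite in_set E1 bw' eqxx.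
  by rewrite nov now evw rw E1 eqxx.
have cR : #|R| <= cap_deg m j.
  apply: leq_trans lv; apply: leq_trans (proj1 (remaining_row v iX)).
  by apply: subset_leq_card; exact: subD1set.
have p4 : 2 ^ (j + 4) = 2 ^ j * 16 by rewrite expnD.
have p5 : 2 ^ (j + 5) = 2 ^ j * 32 by rewrite expnD.
have cg : #|hashes| <= 2 ^ (j + 5) * #|Eg|.
  have cU : #|\bigcup_(w' in R) Ec w'| * (2 ^ (j + 4) * (2 ^ (j + 4) * B)) <= cap_deg m j * #|hashes|.
    apply: leq_trans (_ : (\sum_(w' in R) #|Ec w'|) * (2 ^ (j + 4) * (2 ^ (j + 4) * B)) <= _).
      by rewrite leq_mul2r card_bigcup_leq orbT.
    rewrite big_distrl /=; apply: leq_trans (_ : #|R| * #|hashes| <= _); last by rewrite leq_mul2r cR orbT.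
    rewrite -sum_nat_const; apply: leq_sum => w' wR; apply: card_hash_collision.
    by move: wR; rewrite !inE eq_sym => /andP[].
  have cU' : #|\bigcup_(w' in R) Ec w'| * 2 ^ (j + 5) <= #|hashes|.
    have p0 : 0 < cap_deg m j by rewrite !muln_gt0 expn_gt0 nbuckets_gt0.
    rewrite -(leq_pmul2l p0); apply: leq_trans cU; apply: eq_leq.
    rewrite /cap_deg; move: #|\bigcup_(w' in R) Ec w'| => a; rewrite p4 p5.
    by move: (2 ^ j) B => b c; nia.
  have cs := card_hash_at v w; rewrite -/Es in cs.
  have : #|Es| <= #|Eg| + #|\bigcup_(w' in R) Ec w'|.
    by rewrite -(cardsID (\bigcup_(w' in R) Ec w') Es) addnC leq_add2l subset_leq_card // subsetIr.
  move: #|_| #|Es| #|Eg| #|hashes| cU' cs => a b c d; rewrite p4 p5 => h1 h2 h3.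
  have := leq_mul (leqnn (2 ^ j * 32)) h3; move: (2 ^ j) h1 h2 => f; nia.
have cr := card_roles nvw.
have sub : setX Eg [set r : roles | ~~ r v && r w] \subset [set y | w \in d_out (step e true j X y v)].
  by apply/subsetP => -[g rl]; rewrite in_setX in_set => /andP[hg hr]; rewrite in_set good.
apply: leq_trans (leq_mul (leqnn _) (subset_leq_card sub)).
rewrite cardsX card_prod -cr.
have -> : 2 ^ (j + 7) = 2 ^ (j + 5) * 4 by rewrite !expnD -mulnA.
by rewrite mulnACA [4 * _]mulnC leq_mul2r cg orbT.
Qed.

Lemma remaining_step X y : sound e j X ->
  #|remaining (step e true j X y)| +
    #|[set p in remaining_low X | p.2 \in d_out (step e true j X y p.1)]| <= #|remaining X|.
Proof.
move=> iX; set A := [set p in remaining_low X | _].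
have dis : [disjoint remaining (step e true j X y) & A].
  rewrite disjoints_subset; apply/subsetP => p; rewrite in_setC in_set => /and3P[_ h _].
  by rewrite in_set (negbTE h) andbF.
have -> : #|remaining (step e true j X y)| + #|A| = #|remaining (step e true j X y) :|: A|.
  by rewrite cardsU disjoint_setI0 // cards0 subn0.
apply: subset_leq_card; rewrite subUset; apply/andP; split; apply/subsetP => p.
  rewrite !in_set => /and3P[->]; rewrite !out_step_orient // !in_setU !negb_or /=.
  by move=> /andP[-> _] /andP[->].
by rewrite in_set => /andP[]; rewrite in_set => /andP[].
Qed.

(** At least 3/8 of the remaining pairs have a low first endpoint, and each of these disappears with
    probability at least [2 ^ -(j + 7)]; 3/8 is rounded down to 1/4. *)
Lemma orient_decay X : sound e j X ->
  (forall W, #|pairs_in e W| <= 2 * (2 ^ j * B) * #|W|) \/ n <= cap_deg m j ->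
  2 ^ (j + 9) * \sum_y #|remaining (step e true j X y)|
    <= (2 ^ (j + 9)).-1 * #|coins m| * #|remaining X|.
Proof.
move=> iX hyp; have low_large := remaining_low_large iX hyp.
have tot : \sum_y #|remaining (step e true j X y)| +
    \sum_(p in remaining_low X) #|[set y | p.2 \in d_out (step e true j X y p.1)]|
    <= #|coins m| * #|remaining X|.
  have -> : \sum_(p in remaining_low X) #|[set y | p.2 \in d_out (step e true j X y p.1)]|
      = \sum_y #|[set p in remaining_low X | p.2 \in d_out (step e true j X y p.1)]|.
    under eq_bigr => p _ do rewrite card_set_sum.
    rewrite exchange_big /=; apply: eq_bigr => y _.
    rewrite -sum1_card big_mkcond [RHS]big_mkcond; apply: eq_bigr => p _.
    by rewrite [X in _ = if X then _ else _]in_set; case: (p \in remaining_low X) => //=; case: (_ \in _).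
  rewrite -big_split /= -sum_nat_const; apply: leq_sum => y _; exact: remaining_step.
have gain : #|remaining_low X| * #|coins m| <=
    2 ^ (j + 7) * \sum_(p in remaining_low X) #|[set y | p.2 \in d_out (step e true j X y p.1)]|.
  rewrite -sum_nat_const big_distrr /=; apply: leq_sum => -[v w]; rewrite in_set => /andP[r l].
  exact: fresh_likely.
have p9 : 2 ^ (j + 9) = 2 ^ (j + 7) * 4 by rewrite !expnD -mulnA.
move: tot gain; rewrite p9; have : 0 < 2 ^ (j + 7) by rewrite expn_gt0.
move: (2 ^ (j + 7)) (\sum_y _) (\sum_(p in _) _) #|coins m| #|remaining X| #|remaining_low X| low_large.
move=> q s1 s2 c r l h0 q0 h1 h2.
have k1 : q * 4 * (s1 + s2) <= q * 4 * (c * r) by rewrite leq_mul2l h1 orbT.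
have k2 : c * r <= 4 * (l * c) by nia.
have -> : (q * 4).-1 * c * r = q * 4 * (c * r) - c * r.
  by rewrite -subn1 mulnBl mulnBl mul1n mulnA.
nia.
Qed.

(** One further step is taken after the last orientation because only then has every head been told
    of its incoming edges. *)
Lemma orient_complete X y v : sound e j X -> remaining X = set0 ->
  #|nbrs e v| - #|d_out (step e true j X y v)| - d_in (step e true j X y v) = 0.
Proof.
move=> iX r0; apply/eqP; rewrite -subnDA subn_eq0.
have -> : d_in (step e true j X y v) = #|in_nbrs X v|.
  by rewrite step_orient /= (d_in_next sym_e irr_e iX).
apply: leq_trans (_ : #|d_out (X v) :|: in_nbrs X v| <= _).
  apply: subset_leq_card; apply/subsetP => w; rewrite !inE => evw.
  move/setP/(_ (v, w)): r0; rewrite !inE /= evw /=.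
  by case: (w \in _) => //=; case: (v \in _).
apply: leq_trans (leq_card_setU _ _) _; rewrite leq_add2r; apply: subset_leq_card.
by rewrite out_step_orient // subsetUl.
Qed.

Definition oversampled k X y : bool :=
  [exists u, k <= #|[set v in d_out (X u) | bucket j (y.1 (v, u)) != None]|].

(** Binomial tail: the outdegree is at most [8 * 2 ^ j * B] and the sampling rate [2 ^ -(j + 4)], so
    at least [k] samples occur with probability at most [(2 * B / k) ^ k]; union bound over the
    nodes. *)
Lemma oversampled_rare X k : sound e j X -> 4 * B <= k ->
  #|[set y | oversampled k X y]| * 2 ^ k <= n * #|coins m|.
Proof.
move=> iX hk.
have -> : n * #|coins m| = #|xpredT : pred 'I_n| * #|coins m| by rewrite card_ord.
apply: (@card_exists_mul_leq _ _ xpredT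
  (fun u y => k <= #|[set v in d_out (X u) | bucket j (y.1 (v, u)) != None]|)) => u _.
have cap0 : 0 < cap_deg m j by rewrite !muln_gt0 expn_gt0 nbuckets_gt0.
have := @card_many_events _ (coins m) (d_out (X u)) (fun v y => bucket j (y.1 (v, u)) != None)
  k ((2 ^ (j + 4)) ^ k) _.
have ev (J : {set 'I_n}) : J \subset d_out (X u) -> #|J| = k ->
   #|[set y : coins m | [forall c in J, bucket j (y.1 (c, u)) != None]]| * (2 ^ (j + 4)) ^ k <= #|coins m|.
  move=> _ cJ.
  have -> : [set y : coins m | [forall c in J, bucket j (y.1 (c, u)) != None]] =
    setX [set g : hashes | [forall p in [set (c, u) | c in J], g p \in [set h | bucket j h != None]]] [set: roles].
    apply/setP => -[g r]; rewrite in_setX in_setT andbT !in_set /=.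
    apply/forall_inP/forall_inP => [h p /imsetP[c cJ' ->]|h c cJ']; first by rewrite in_set h.
    by have := h (c, u); rewrite in_set; apply; apply: imset_f.
  rewrite cardsX cardsT card_prod mulnAC leq_mul2r; apply/orP; right.
  have cI : #|[set (c, u) | c in J]| = k by rewrite card_imset // => a b [].
  rewrite -{1}cI (@card_ffun_constrained _ _ _ (fun=> [set h | bucket j h != None])) //.
  by move=> ? _; exact: card_sampled.
move/(_ ev); set E := #|[set y | _]| => hE.
have c0 : 0 < (4 * cap_deg m j) ^ k by rewrite expn_gt0 muln_gt0 cap0.
rewrite -(leq_pmul2l c0).
apply: leq_trans (_ : E * (2 ^ (j + 4)) ^ k * k ^ k <= _).
  rewrite mulnCA -mulnA leq_mul2l -!expnMn exp_mono ?orbT //.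
  rewrite /cap_deg (expnD 2 j 4) -[2 ^ 4]/16; move: (2 ^ j) hk => q; nia.
apply: leq_trans (_ : 'C(#|d_out (X u)|, k) * #|coins m| * k ^ k <= _).
  by rewrite leq_mul2r hE orbT.
rewrite mulnAC leq_mul2r; apply/orP; right; apply: leq_trans (bin_exp_leq _ _) _.
by rewrite exp_mono // leq_mul2l (card_out sym_e u iX).
Qed.

(** The exponential makes the loss of one edge halve the weight, however many edges are left. *)
Definition weight (d : data m) : nat :=
  if (d_mate d == None) && (d_todo d != set0) then 2 ^ #|d_todo d| else 0.

(** Fix [w] in [d_todo (X u)]. With probability 1/4, [u] is a tail and [w] a head; then [u] does
    propose and its weight at least halves. Otherwise the weight does not grow, whence the factor
    7/8. *)
Lemma match_decay X : sound e j X ->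
  8 * \sum_y \sum_u weight (step e false j X y u) <= 7 * #|coins m| * \sum_u weight (X u).
Proof.
move=> iX; rewrite exchange_big /= !big_distrr /=; apply: leq_sum => u _.
have todoE y := let: And4 _ _ _ h := fields_match e j X y u in h.
have todoS y : d_todo (step e false j X y u) \subset d_todo (X u).
  by rewrite todoE; case: propose => // w; exact: subD1set.
have le_all y : weight (step e false j X y u) <= weight (X u).
  rewrite /weight; case mu : (d_mate (X u)) => [z|].
    by rewrite (mate_old e j y mu).
  case: (eqVneq (d_todo (X u)) set0) => [t0|_] /=.
    by move: (todoS y); rewrite t0 subset0 => /eqP->; rewrite eqxx andbF.
  by case: ifP => // _; rewrite leq_exp2l // subset_leq_card.
case W0 : (weight (X u)) => [|k].
  rewrite muln0 leqn0 muln_eq0 /=; rewrite sum_nat_eq0; apply/forallP => y.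
  by rewrite -leqn0 -W0 le_all.
rewrite -W0; have {W0 k} : weight (X u) != 0 by rewrite W0.
rewrite {1}/weight; case: ifP => // /andP[mu /set0Pn[w tw]] _.
have nuw : u != w.
  apply: contraTneq tw => <-; apply/negP => /(subsetP (inv_todo iX u))/(subsetP (inv_out iX u)).
  by rewrite inE irr_e.
pose E := [set y : coins m | ~~ y.2 u && y.2 w].
have cE : #|E| * 4 = #|coins m|.
  have -> : E = setX [set: hashes] [set r : roles | ~~ r u && r w].
    by apply/setP => -[g r]; rewrite in_setX in_setT !in_set.
  by rewrite cardsX cardsT card_prod -mulnA card_roles.
have onE y : y \in E -> 2 * weight (step e false j X y u) <= weight (X u).
  rewrite in_set => /andP[yu yw].
  have tn : d_todo (X u) != set0 by apply/set0Pn; exists w.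
  rewrite {2}/weight mu tn /= /weight; case: ifP => // _; rewrite -expnS leq_exp2l //.
  rewrite todoE /propose mu yu /=; case: pickP => [w' /andP[tw' _]|/(_ w)]; last by rewrite tw yw.
  by rewrite [X in _ <= X](cardsD1 w') tw'.
have : 2 * \sum_y weight (step e false j X y u) + #|E| * weight (X u) <= 2 * (#|coins m| * weight (X u)).
  rewrite -!sum_nat_const big_distrr big_distrr /= [X in _ + X]big_mkcond -big_split /=.
  apply: leq_sum => y _; case: ifP => yE; last by rewrite addn0 leq_mul2l le_all.
  by rewrite [X in _ <= X]mul2n -addnn leq_add2r onE.
move: (\sum_y _) #|E| #|coins m| (weight (X u)) cE => s a c x; nia.
Qed.

Lemma no_weight_no_pending X v : sound e j X ->
  \sum_u weight (X u) = 0 -> #|nbrs e v| - #|d_out (X v)| - d_in (X v) = 0 ->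
  ~~ pending (nbrs e v) (X v).
Proof.
move=> iX /eqP; rewrite sum_nat_eq0 => /forallP/(_ v) /= + h.
by rewrite /pending h eqxx /= /weight; case: ifP => // _; rewrite expn_eq0.
Qed.
End Progress.

(** * Random placement balances the load *)

Lemma sqr_le_exp2 l : l ^ 2 <= 2 * 2 ^ l.
Proof.
rewrite -mulnn; elim: l => [|l IH] //; rewrite [2 ^ l.+1]expnS.
by case: (ltnP l 3) => [|l3]; [case: l {IH} => [|[|[|l]]]|nia].
Qed.

Section Placement.
Variables (cc rho Q m Kc a r0 g Q1 : nat).
Local Notation n := m.+2.
Local Notation L := (lg m.+2).
Local Notation B := (nbuckets m).
Local Notation Key := (key n B.+1).
Local Notation Item := (item n L B.+1).
Local Notation Cell := (cell n rho).
Local Notation Place := (placement cc rho m).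
Local Notation Z := ('I_(2 ^ L.-1) * 'I_(2 ^ rho))%type.
Local Notation M := (2 ^ (L.-1 + rho)).
(** [Kc * L] bounds the tokens of a node. The slots keep the expected load of a random cell below
    [L / 2 ^ a], and [a] and [Q1] are large enough for a total failure probability of
    [2 ^ -(g * L)]. *)
Hypotheses (Kc_gt0 : 0 < Kc) (rho_def : rho = a + r0) (Kc_le : 8 * Kc <= 2 ^ r0).
Hypotheses (a_big : g + 3 + r0 <= a) (Q_def : Q.+2 = 2 * Q1) (Q1_big : g + 7 <= Q1).

Variable p : ((maxsteps cc m).-tuple (coins m) * (maxsteps cc m).-tuple (coins m))%type.
Variable s : nat.
Variable K : 'I_n -> {set Key}.
Hypothesis K_small : forall u, #|K u| <= Kc * L.
Let C (k : Key) : {set 'I_n} := [set u | k \in K u].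
Local Notation pl H lev := (place ((p, H) : Omega cc rho m) s lev).

Let L_gt0 : 0 < L := lg_gt0 m.
Let rho_big : 8 * Kc * 2 ^ a <= 2 ^ rho.
Proof. by rewrite rho_def expnD mulnC leq_mul2l Kc_le orbT. Qed.
Let Kc_rho : 8 * Kc <= 2 ^ rho.
Proof. by apply: leq_trans rho_big; rewrite leq_pmulr ?pow2_gt0. Qed.
Let rho_ge8 : 8 <= 2 ^ rho.
Proof. by apply: leq_trans Kc_rho; rewrite leq_pmulr. Qed.

Definition items lev : {set Item} := [set c | below C lev c != set0].

(** On a given level a pair of contributor and key touches a single tree vertex. *)
Lemma card_items lev : #|items lev| <= n * Kc * L.
Proof.
pose f (q : 'I_n * Key) : Item := (q.2, modI L (q.1 %/ 2 ^ (L - lev))).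
apply: leq_trans (_ : #|[set f q | q in [set q | q.2 \in K q.1]]| <= _).
  apply: subset_leq_card; apply/subsetP => c; rewrite in_set => /set0Pn[u].
  rewrite !in_set => /andP[cu /eqP hu]; apply/imsetP; exists (u, c.1); first by rewrite in_set.
  rewrite [c in LHS]surjective_pairing; congr pair; apply: val_inj.
  by rewrite /= hu modn_small.
apply: leq_trans (leq_imset_card _ _) _; rewrite -sum1_card.
rewrite (eq_bigl (fun q : 'I_n * Key => xpredT q.1 && (q.2 \in K q.1))); last by move=> q; rewrite in_set.
rewrite -(pair_big_dep xpredT (fun u k => k \in K u) (fun _ _ => 1)) /=.
rewrite -mulnA -[n in X in _ <= X]card_ord -sum_nat_const; apply: leq_sum => u _.
by rewrite sum1_card card_ord K_small.
Qed.

Lemma card_Z : #|{: Z}| = M.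
Proof. by rewrite card_prod !card_ord expnD. Qed.

Definition cellz (x : Cell) : Z := (modI L.-1 x.1, x.2).

Lemma place_cellz H lev c x : 0 < lev -> pl H lev c == x ->
  H (inord s, inord lev, c) == cellz x.
Proof.
rewrite /place lt0n => /negbTE-> /eqP <- /=; rewrite /cellz /=.
case: (H _) => [h1 h2] /=; apply/eqP; congr pair; apply: val_inj => /=.
rewrite inordK; first by rewrite modn_small.
exact: leq_trans (ltn_ord h1) (ltnW (ltn_pow_lg_pred m)).
Qed.

Lemma card_placed (T : finType) (I : {set T}) (f : T -> 'I_(2 * maxsteps cc m).+1 * 'I_L.+1 * Item)
    (z : Z) k : {in I &, injective f} ->
  #|[set H : Place | k <= #|[set c in I | H (f c) == z]|]| * M ^ k <= 'C(#|I|, k) * #|Place|.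
Proof.
move=> injf; apply: card_many_events => J sJ cJ.
have injJ : {in J &, injective f} by move=> ? ? /(subsetP sJ) h /(subsetP sJ); exact: injf.
rewrite -card_Z -{1}cJ -(card_in_imset injJ).
rewrite -(@card_ffun_constrained _ _ (f @: J) (fun=> [set z]) #|{: Z}|).
  rewrite leq_mul2r; apply/orP; right; apply: subset_leq_card; apply/subsetP => H.
  rewrite !in_set => /forall_inP h; apply/forall_inP => d /imsetP[c cJ' ->].
  by rewrite in_set1 h.
by move=> ? _; rewrite cards1 mul1n.
Qed.

(** Items on one side have distinct parents, and parents live on another level, so [k] items involve
    [2 * k] independent random cells. *)
Lemma card_placed2 (lev k : nat) b (z1 z2 : Z) : lev < L ->
  #|[set H : Place | k <= #|[set c in [set c in items lev.+1 | odd c.2 == b] |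
       (H (inord s, inord lev.+1, c) == z1) && (H (inord s, inord lev, parent c) == z2)]|]|
    * M ^ (2 * k) <= (n * Kc * L) ^ k * #|Place|.
Proof.
move=> lL; set I := [set c in _ | _].
apply: leq_trans (_ : 'C(#|I|, k) * #|Place| <= _); last first.
  rewrite leq_mul2r; apply/orP; right; apply: leq_trans (bin_leq_exp _ _) _.
  apply: exp_mono; apply: leq_trans (card_items lev.+1); apply: subset_leq_card.
  by apply/subsetP => c; rewrite in_set => /andP[].
apply: (@card_many_events _ _ I (fun c (H : Place) =>
  (H (inord s, inord lev.+1, c) == z1) && (H (inord s, inord lev, parent c) == z2))) => J sJ cJ.
pose f1 (c : Item) : 'I_(2 * maxsteps cc m).+1 * 'I_L.+1 * Item := (inord s, inord lev.+1, c).
pose f2 (c : Item) : 'I_(2 * maxsteps cc m).+1 * 'I_L.+1 * Item := (inord s, inord lev, parent c).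
have inj1 : {in J &, injective f1} by move=> c c' _ _ [].
have inj2 : {in J &, injective f2}.
  move=> c c' /(subsetP sJ) + /(subsetP sJ); rewrite !in_set => /andP[_ /eqP o1] /andP[_ /eqP o2] h.
  by apply: parent_inj; [rewrite o1 o2|case: h => h1 h2; congr pair => //; apply: val_inj].
have lev_ne : (inord lev.+1 : 'I_L.+1) != inord lev.
  apply/eqP => /(congr1 val) /=; rewrite !inordK; lia.
have dis : [disjoint f1 @: J & f2 @: J].
  rewrite disjoints_subset; apply/subsetP => d /imsetP[c _ ->]; rewrite in_setC; apply/imsetP => -[c' _ [h _]].
  by move: lev_ne; rewrite h eqxx.
have cD : #|f1 @: J :|: f2 @: J| = 2 * k.
  by rewrite cardsU disjoint_setI0 // cards0 subn0 !card_in_imset // cJ mul2n addnn.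
rewrite -cD -card_Z.
rewrite -(@card_ffun_constrained _ _ (f1 @: J :|: f2 @: J)
   (fun d => if d.1.2 == inord lev.+1 then [set z1] else [set z2]) #|{: Z}|).
  rewrite leq_mul2r; apply/orP; right; apply: subset_leq_card; apply/subsetP => H.
  rewrite !in_set => /forall_inP h; apply/forall_inP => d; rewrite in_setU => /orP[]/imsetP[c cJ' ->] /=.
    by rewrite eqxx in_set1; have /andP[] := h c cJ'.
  by rewrite eq_sym (negbTE lev_ne) in_set1; have /andP[] := h c cJ'.
by move=> d _; case: ifP; rewrite cards1 mul1n.
Qed.

Lemma leaf_load x : #|load C L (leaf_place rho K) x| <= L.
Proof.
have keyP c : c \in load C L (leaf_place rho K) x ->
    [/\ c.2 = x.1 :> nat, c.1 \in K x.1, x.2 * L <= index c.1 (enum (K x.1))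
      & index c.1 (enum (K x.1)) - x.2 * L < L].
  rewrite in_load => /andP[/set0Pn[u]]; rewrite !in_set subnn divn1 => /andP[cu /eqP uc].
  have ucE : inord c.2 = u by apply: val_inj; rewrite /= inordK -uc.
  rewrite /leaf_place ucE => /eqP <- /=.
  have : index c.1 (enum (K u)) < Kc * L.
    by apply: leq_trans (K_small u); rewrite cardE index_mem mem_enum.
  rewrite -ltn_divLR // => lt; rewrite modn_small; last first.
    by apply: leq_trans lt _; apply: leq_trans Kc_rho; rewrite leq_pmull.
  by split; rewrite ?leq_divM // ltn_subLR ?leq_divM // -mulSnr ltn_ceil.
pose f (c : Item) : 'I_L.+1 := inord (index c.1 (enum (K x.1)) - x.2 * L).
have injf : {in load C L (leaf_place rho K) x &, injective f}.
  move=> c c' /keyP[h1 k1 i1 j1] /keyP[h2 k2 i2 j2] /(congr1 val) /=; rewrite !inordK; try exact: ltnW.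
  move=> ei; rewrite [c]surjective_pairing [c']surjective_pairing; congr pair; last first.
    by apply: val_inj; rewrite /= h1 h2.
  have idx : index c.1 (enum (K x.1)) = index c'.1 (enum (K x.1)) by rewrite -(subnK i1) -(subnK i2) ei.
  by apply: (index_inj c.1 _ _ idx); rewrite mem_enum.
rewrite -(card_in_imset injf) -[X in _ <= X](card_ord_lt (leqnSn L)); apply: subset_leq_card.
by apply/subsetP => i /imsetP[c /keyP[_ _ _ hi] ->]; rewrite in_set inordK // ltnW.
Qed.

Lemma root_load H x : #|load C 0 (pl H 0) x| <= L.
Proof.
have keyP c : c \in load C 0 (pl H 0) x ->
    [/\ c.2 = 0 :> nat, c.1.1 = x.1, x.2 * L <= c.1.2 & c.1.2 - x.2 * L < L].
  rewrite in_load => /andP[/set0Pn[u]]; rewrite !in_set subn0 => /andP[_ /eqP uc].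
  have c0 : c.2 = 0 :> nat.
    by rewrite -uc divn_small //; apply: leq_trans (ltn_ord u) (leq_pow_lg m).
  rewrite /place eqxx => /eqP <- /=.
  have lt : c.1.2 %/ L < 3.
    rewrite ltn_divLR //; have := ltn_ord c.1.2; have := nbuckets_le m; lia.
  rewrite modn_small; last by lia.
  by split; rewrite ?leq_divM // ltn_subLR ?leq_divM // -mulSnr ltn_ceil.
pose f (c : Item) : 'I_L.+1 := inord (c.1.2 - x.2 * L).
have injf : {in load C 0 (pl H 0) x &, injective f}.
  move=> c c' /keyP[h1 k1 i1 j1] /keyP[h2 k2 i2 j2] /(congr1 val) /=; rewrite !inordK; try exact: ltnW.
  move=> ei; rewrite [c]surjective_pairing [c']surjective_pairing; congr pair; last first.
    by apply: val_inj; rewrite /= h1 h2.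
  rewrite [c.1]surjective_pairing [c'.1]surjective_pairing k1 k2; congr pair.
  by apply: val_inj; rewrite /= -(subnK i1) -(subnK i2) ei.
rewrite -(card_in_imset injf) -[X in _ <= X](card_ord_lt (leqnSn L)); apply: subset_leq_card.
by apply/subsetP => i /imsetP[c /keyP[_ _ _ hi] ->]; rewrite in_set inordK // ltnW.
Qed.

Lemma pow_lg_double : 2 ^ L = 2 * 2 ^ L.-1.
Proof. by rewrite -expnS prednK. Qed.

Lemma M_def : M = 2 ^ L.-1 * 2 ^ rho.
Proof. exact: expnD. Qed.

(** Union bound over sets of [L.+1] items. [bin_exp_leq] divides their number by [L.+1 ^ L.+1],
    which cancels the factor [L] in the number of items. *)
Lemma load_rare lev x : 0 < lev ->
  #|[set H : Place | L < #|load C lev (pl H lev) x|]| * 2 ^ (a * L.+1) <= #|Place|.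
Proof.
move=> lev0; set k := L.+1.
have sub : [set H : Place | L < #|load C lev (pl H lev) x|] \subset
    [set H : Place | k <= #|[set c in items lev | H (inord s, inord lev, c) == cellz x]|].
  apply/subsetP => H; rewrite !in_set => h; apply: leq_trans h _; apply: subset_leq_card.
  apply/subsetP => c; rewrite in_load => /andP[nb hc].
  by rewrite in_set [c \in items _]in_set nb place_cellz.
have inj : {in items lev &, injective (fun c : Item =>
   (inord s, inord lev, c) : 'I_(2 * maxsteps cc m).+1 * 'I_L.+1 * Item)} by move=> c c' _ _ [].
have hE := card_placed (cellz x) k inj.
apply: leq_trans (leq_mul (subset_leq_card sub) (leqnn _)) _.
set E := #|[set H : Place | _]| in hE *.
set A := 4 * (n * Kc * L).
have A0 : 0 < A ^ k by rewrite expn_gt0 !muln_gt0 Kc_gt0 L_gt0.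
rewrite -(leq_pmul2l A0).
apply: leq_trans (_ : E * M ^ k * k ^ k <= _).
  rewrite mulnCA -mulnA leq_mul2l expnM -!expnMn exp_mono ?orbT //.
  rewrite /A M_def; have := leq_pow_lg m; rewrite pow_lg_double /k.
  move: (2 ^ L.-1) (2 ^ rho) (2 ^ a) rho_big => h r b hb hn.
  apply: leq_trans (_ : 4 * (2 * h * Kc * L) * b <= _).
    by rewrite leq_mul2r leq_mul2l !leq_mul2r hn !orbT.
  have -> : 4 * (2 * h * Kc * L) * b = h * L * (8 * Kc * b) by nia.
  apply: leq_trans (leq_mul (leqnn _) hb) _.
  by rewrite mulnAC leq_mul2l leqnSn orbT.
apply: leq_trans (_ : 'C(#|items lev|, k) * #|Place| * k ^ k <= _).
  by rewrite leq_mul2r hE orbT.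
rewrite mulnAC leq_mul2r; apply/orP; right; apply: leq_trans (bin_exp_leq _ _) _.
by rewrite exp_mono // leq_mul2l card_items.
Qed.

Lemma L_sqr_M : L ^ 2 <= M.
Proof.
apply: leq_trans (sqr_le_exp2 L) _; rewrite pow_lg_double M_def.
by rewrite mulnA mulnC leq_mul2l (leq_trans _ rho_ge8) ?orbT.
Qed.

(** Choosing an item costs at most [M] to the power 3/2, against the probability [M ^ -2] that both
    its cell and that of its parent are the given ones: each item gains the square root of [M]. *)
Lemma items_sqr_M : (n * Kc * L) ^ 2 <= M ^ 3.
Proof.
have := leq_pow_lg m; have := sqr_le_exp2 L; rewrite M_def pow_lg_double.
move: (2 ^ L.-1) (2 ^ rho) Kc_rho => h r hr hL hn.
rewrite !expnMn.
apply: leq_trans (_ : (2 * h) ^ 2 * Kc ^ 2 * (2 * (2 * h)) <= _).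
  by rewrite leq_mul // leq_mul2r exp_mono ?orbT.
have : Kc ^ 2 * 16 <= r ^ 3.
  have : (8 * Kc) ^ 2 <= r ^ 2 by rewrite exp_mono.
  rewrite [r ^ 3]expnS; have : 0 < r by apply: leq_trans hr; rewrite muln_gt0.
  by rewrite expnMn; nia.
by rewrite !expnS !expn0; nia.
Qed.

Definition placed H lev := if lev == L then leaf_place rho K else pl H lev.

(** The same gain when only one end is random: an item then costs [b], at most the square root of
    [M], against the probability [1 / M]. *)
Lemma few_events E k b : E * M ^ (2 * Q1) <= b ^ (2 * Q1) * k -> b ^ 2 <= M -> E * M ^ Q1 <= k.
Proof.
move=> hE hb; have M0 : 0 < M ^ Q1 by rewrite !expn_gt0.
rewrite -(leq_pmul2l M0) mulnCA -expnD addnn -mul2n; apply: leq_trans hE _.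
by rewrite expnM leq_mul2r exp_mono ?orbT.
Qed.

(** Leaves and roots have fixed places. An edge of the tree at such an end has only one random cell,
    but then the fixed cell admits at most [L] items. *)
Lemma traffic_rare lev b (x x' : Cell) : lev < L ->
  #|[set H : Place | Q.+1 < #|traffic C lev (placed H lev.+1) (placed H lev) b x x'|]| * M ^ Q1
    <= #|Place|.
Proof.
move=> lL; rewrite /placed (ltn_eqF lL).
case: (eqVneq lev.+1 L) => [levL|nlevL]; case: (posnP lev) => [lev0|lev0].
(* For [L = 1] leaves are attached to roots and nothing is random, but the whole type of items has
   at most 12 elements. *)
- rewrite (_ : [set H | _] = set0) ?cards0 // ; apply/setP => H; rewrite in_set0 in_set.
  apply/negbTE; rewrite -leqNgt; apply: leq_trans (max_card _) _.
  rewrite !card_prod !card_ord; have := nbuckets_le m; have := leq_pow_lg m.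
  have -> : L = 1 by rewrite -levL lev0.
  move: Q_def Q1_big; nia.
- have sub : [set H : Place | Q.+1 < #|traffic C lev (leaf_place rho K) (pl H lev) b x x'|] \subset
     [set H : Place | Q.+2 <= #|[set c in [set c in load C L (leaf_place rho K) x | odd c.2 == b] |
        H (inord s, inord lev, parent c) == cellz x']|].
    apply/subsetP => H; rewrite !in_set => h; apply: leq_trans h _; apply: subset_leq_card.
    apply/subsetP => c; rewrite in_traffic levL => /and4P[nb hx ob hp].
    by rewrite in_set in_set in_load nb hx ob place_cellz.
  apply: leq_trans (leq_mul (subset_leq_card sub) (leqnn _)) _.
  apply: (few_events (b := L)); last exact: L_sqr_M.
  rewrite -Q_def; apply: leq_trans (card_placed _ _ _) _.
    move=> c c'; rewrite !in_set => /andP[_ /eqP o1] /andP[_ /eqP o2] h.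
    by apply: parent_inj; [rewrite o1 o2|case: h => h1 h2; congr pair => //; apply: val_inj].
  rewrite leq_mul2r; apply/orP; right; apply: leq_trans (bin_leq_exp _ _) _.
  apply: exp_mono; apply: leq_trans (leaf_load x); apply: subset_leq_card.
  by apply/subsetP => c; rewrite in_set => /andP[].
(* Level 0 ignores the random placement, so an arbitrary one may be inserted here. *)
- pose D := [set c : Item | [&& below C 1 c != set0, odd c.2 == b & pl (finfun (fun=> cellz x)) 0 (parent c) == x']].
  have injD : {in D &, injective (@parent n L B.+1)}.
    move=> c c'; rewrite !in_set => /and3P[_ /eqP o1 _] /and3P[_ /eqP o2 _].
    by apply: parent_inj; rewrite o1 o2.
  have cD : #|D| <= L.
    rewrite -(card_in_imset injD); apply: leq_trans (root_load (finfun (fun=> cellz x)) x').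
    apply: subset_leq_card; apply/subsetP => c /imsetP[c' + ->]; rewrite in_set => /and3P[nb _ hp].
    by rewrite in_load hp andbT below_parent // leq_pow_lg.
  have sub : [set H : Place | Q.+1 < #|traffic C lev (pl H lev.+1) (pl H lev) b x x'|] \subset
     [set H : Place | Q.+2 <= #|[set c in D | H (inord s, inord 1, c) == cellz x]|].
    apply/subsetP => H; rewrite !in_set => h; apply: leq_trans h _; apply: subset_leq_card.
    apply/subsetP => c; rewrite in_traffic lev0 => /and4P[nb hx ob hp].
    by rewrite in_set in_set nb ob place_cellz // andbT.
  apply: leq_trans (leq_mul (subset_leq_card sub) (leqnn _)) _.
  apply: (few_events (b := L)); last exact: L_sqr_M.
  rewrite -Q_def; apply: leq_trans (card_placed _ _ _) _; first by move=> c c' _ _ [].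
  rewrite leq_mul2r; apply/orP; right; apply: leq_trans (bin_leq_exp _ _) _.
  exact: exp_mono.
have sub : [set H : Place | Q.+1 < #|traffic C lev (pl H lev.+1) (pl H lev) b x x'|] \subset
  [set H : Place | Q.+2 <= #|[set c in [set c in items lev.+1 | odd c.2 == b] |
       (H (inord s, inord lev.+1, c) == cellz x) && (H (inord s, inord lev, parent c) == cellz x')]|].
  apply/subsetP => H; rewrite !in_set => h; apply: leq_trans h _; apply: subset_leq_card.
  apply/subsetP => c; rewrite in_traffic => /and4P[nb hx ob hp].
  by rewrite in_set in_set [c \in items _]in_set nb ob !place_cellz.
apply: leq_trans (leq_mul (subset_leq_card sub) (leqnn _)) _.
have := card_placed2 Q.+2 b (cellz x) (cellz x') lL; set E := #|_|; rewrite Q_def => hE.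
have M0 : 0 < M ^ (3 * Q1) by rewrite !expn_gt0.
rewrite -(leq_pmul2l M0) mulnCA -expnD.
have -> : 3 * Q1 + Q1 = 2 * (2 * Q1) by lia.
apply: leq_trans hE _; rewrite leq_mul2r; apply/orP; right.
by rewrite [X in X <= _]expnM [X in _ <= X]expnM exp_mono // items_sqr_M.
Qed.

Definition balanced H : bool :=
  [forall lev : 'I_L.+1, forall x : Cell, #|load C lev (placed H lev) x| <= L] &&
  [forall lev : 'I_L, forall b : bool, forall x : Cell, forall x' : Cell,
     #|traffic C lev (placed H lev.+1) (placed H lev) b x x'| <= Q.+1].

Lemma unbalanced_rare : #|[set H : Place | ~~ balanced H]| * (2 ^ L) ^ g <= #|Place|.
Proof.
pose E1 (i : 'I_L.+1 * Cell) (H : Place) := L < #|load C i.1 (pl H i.1) i.2|.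
pose E2 (i : 'I_L * bool * (Cell * Cell)) (H : Place) :=
  Q.+1 < #|traffic C i.1.1 (placed H i.1.1.+1) (placed H i.1.1) i.1.2 i.2.1 i.2.2|.
pose P1 (i : 'I_L.+1 * Cell) := 0 < i.1.
pose S1 := [set H : Place | [exists (i | P1 i), E1 i H]].
pose S2 := [set H : Place | [exists (i | xpredT i), E2 i H]].
have sub : [set H : Place | ~~ balanced H] \subset S1 :|: S2.
  apply/subsetP => H; rewrite in_set negb_and => /orP[]; rewrite negb_forall => /existsP[lev].
    rewrite negb_forall => /existsP[x]; rewrite -ltnNge /placed => h.
    case: (eqVneq (lev : nat) L) h => [-> h|nl h]; first by move: h; rewrite ltnNge leaf_load.
    case: (posnP lev) h => [-> h|l0 h]; first by move: h; rewrite ltnNge root_load.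
    by rewrite in_setU in_set; apply/orP; left; apply/existsP; exists (lev, x); rewrite /P1 l0.
  rewrite negb_forall => /existsP[b]; rewrite negb_forall => /existsP[x].
  rewrite negb_forall => /existsP[x']; rewrite -ltnNge => h.
  rewrite in_setU; apply/orP; right; rewrite in_set; apply/existsP.
  by exists (lev, b, (x, x')).
have N2 : 2 <= 2 ^ L by rewrite -{1}[2]expn1 leq_exp2l.
have LN : L.+1 <= 2 ^ L by exact: ltn_expl.
have cCell : #|{: Cell}| <= 2 * M.
  by rewrite card_prod !card_ord M_def mulnA -pow_lg_double leq_mul2r leq_pow_lg orbT.
have c1 : #|S1| * 2 ^ (a * L.+1) <= #|{: 'I_L.+1 * Cell}| * #|Place|.
  apply: leq_trans (card_exists_mul_leq (k := #|Place|) _) _ => [i i0|].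
    exact: load_rare.
  by rewrite leq_mul2r max_card orbT.
have c2 : #|S2| * M ^ Q1 <= #|{: 'I_L * bool * (Cell * Cell)}| * #|Place|.
  apply: leq_trans (card_exists_mul_leq (k := #|Place|) _) _ => [i i0|].
    exact: traffic_rare.
  by rewrite leq_mul2r max_card orbT.
have d1 : #|S1| * (2 * (2 ^ L) ^ g) <= #|Place|.
  have p0 : 0 < 2 ^ (a * L.+1) by rewrite expn_gt0.
  rewrite -(leq_pmul2l p0) mulnA [2 ^ (a * L.+1) * _]mulnC.
  apply: leq_trans (leq_mul c1 (leqnn _)) _.
  rewrite mulnAC leq_mul2r; apply/orP; right; rewrite card_prod card_ord.
  apply: leq_trans (_ : 2 ^ L * (2 * M) * (2 * (2 ^ L) ^ g) <= _).
    by rewrite leq_mul2r leq_mul ?orbT.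
  rewrite M_def [2 * (_ * _)]mulnA -pow_lg_double rho_def mulnS !expnD -!expnM.
  have -> : 2 ^ (a * L) = 2 ^ (L * (g + 3 + r0)) * 2 ^ (L * (a - (g + 3 + r0))).
    by rewrite -expnD -mulnDr subnKC // mulnC.
  have h1 : 2 ^ r0 <= 2 ^ (L * r0) by rewrite leq_exp2l // leq_pmull.
  rewrite mulnDr mulnDr !expnD.
  have h3 : 2 ^ (L * 3) = 2 ^ L * 2 ^ L * 2 ^ L by rewrite -!expnD; congr (2 ^ _); lia.
  have h4 : 0 < 2 ^ (L * (a - (g + 3 + r0))) by rewrite expn_gt0.
  rewrite h3; move: (2 ^ L) (2 ^ (L * g)) (2 ^ r0) (2 ^ (L * r0)) (2 ^ a) (2 ^ (L * (a - _))) N2 h1 h4.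
  move=> N G r r' A z N2' h1 h4.
  apply: leq_trans (_ : A * (G * (N * N * N) * r') <= _); last first.
    by rewrite leq_mul2l leq_pmulr ?orbT.
  have -> : N * (N * (A * r)) * (2 * G) = A * (G * (N * N * 2) * r) by nia.
  by rewrite leq_mul2l leq_mul ?orbT // leq_mul2l leq_mul2l N2' !orbT.
have d2 : #|S2| * (2 * (2 ^ L) ^ g) <= #|Place|.
  have NM : 2 ^ L <= M.
    by rewrite M_def pow_lg_double mulnC leq_mul2l (leq_trans _ rho_ge8) ?orbT.
  have M2 : 2 <= M by exact: leq_trans NM.
  have p0 : 0 < M ^ Q1 by rewrite !expn_gt0.
  rewrite -(leq_pmul2l p0) mulnA [M ^ Q1 * _]mulnC.
  apply: leq_trans (leq_mul c2 (leqnn _)) _.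
  rewrite mulnAC leq_mul2r; apply/orP; right; rewrite !card_prod card_ord card_bool -card_prod.
  apply: leq_trans (_ : M * 2 * (2 * M * (2 * M)) * (2 * M ^ g) <= _).
    apply: leq_mul; last by rewrite leq_mul2l exp_mono ?orbT.
    apply: leq_mul; last exact: leq_mul.
    by rewrite leq_mul2r (leq_trans (ltnW LN)) ?orbT.
  apply: leq_trans (_ : M ^ (g + 7) <= _); last by rewrite leq_exp2l.
  rewrite (expnD M g 7); move: M M2 => t t2.
  have h16 : 16 <= t ^ 4 by apply: leq_trans (exp_mono 4 t2).
  have -> : t ^ 7 = t ^ 4 * (t * t * t) by rewrite !expnS expn0; nia.
  have -> : t * 2 * (2 * t * (2 * t)) * (2 * t ^ g) = t ^ g * (16 * (t * t * t)) by nia.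
  by rewrite leq_mul2l leq_mul2r h16 !orbT.
apply: leq_trans (_ : (#|S1| + #|S2|) * (2 ^ L) ^ g <= _).
  rewrite leq_mul2r; apply/orP; right; apply: leq_trans (subset_leq_card sub) _.
  exact: leq_card_setU.
move: d1 d2; rewrite mulnDl !(mulnCA _ 2); lia.
Qed.

End Placement.

(** * Failure probability of a stage *)

Section Stage.
Variables (cc rho Q a r0 Q1 m : nat) (e : rel 'I_m.+2).
Local Notation n := m.+2.
Local Notation L := (lg m.+2).
Local Notation N := (2 ^ lg m.+2).
Local Notation Kc := (8 * (cc + 2) + 2).
Local Notation g := (2 * cc + 15).
Hypotheses (sym_e : symmetric e) (irr_e : irreflexive e).
Hypotheses (rho_def : rho = a + r0) (Kc_le : 8 * Kc <= 2 ^ r0).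
Hypotheses (a_big : g + 3 + r0 <= a) (Q_def : Q.+2 = 2 * Q1) (Q1_big : g + 7 <= Q1).
Local Notation T := (maxsteps cc m).
Local Notation Om := (Omega cc rho m).
Local Notation Coins := (T.-tuple (coins m)).
Local Notation Place := (placement cc rho m).
Local Notation S j := (nsteps cc m j).

Let L_gt0 : 0 < L := lg_gt0 m.
Let N_ge2 : 2 <= N.
Proof. by rewrite -{1}[2]expn1 leq_exp2l. Qed.
Let n_le_N : n <= N := leq_pow_lg m.

Lemma nsteps_mono j : j <= L -> S j <= T.
Proof.
by move=> jL; rewrite /maxsteps /nsteps leq_add2r !leq_mul2r leq_exp2l // leq_add2r jL !orbT.
Qed.

(** A union bound over all steps costs only a fixed power of [N]. *)
Lemma nsteps_le j : j <= L -> S j <= N ^ (cc + 14).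
Proof.
move=> jL; apply: leq_trans (nsteps_mono jL) _; rewrite /maxsteps /nsteps.
have h1 : 2 ^ (L + 9) <= N ^ 10.
  by rewrite -expnM leq_exp2l //; nia.
have h2 : cc + 2 <= N ^ (cc + 2).
  by apply: leq_trans (exp_mono (cc + 2) N_ge2); exact/ltnW/ltn_expl.
have h3 : L <= N by exact/ltnW/ltn_expl.
have -> : cc + 14 = 10 + (cc + 2) + 1 + 1 by lia.
rewrite (expnD _ _ 1) (expnD _ _ 1) (expnD _ 10) expn1.
apply: leq_trans (_ : N ^ 10 * N ^ (cc + 2) * N * 2 <= _); last by rewrite leq_mul2l N_ge2 orbT.
rewrite muln2 -addnn; apply: leq_add; first by rewrite !leq_mul.
by rewrite !muln_gt0 !expn_gt0.
Qed.

Lemma nsteps_gt0 j : 0 < S j.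
Proof. by rewrite /nsteps addn1. Qed.

Lemma nsteps_pred j : (S j).-1 = 2 ^ (j + 9) * ((cc + 2) * L).
Proof. by rewrite /nsteps addn1 mulnA. Qed.

(** The factor next to 8 is the number of halvings that [match_fails] needs, and 8 matching steps
    make one halving. *)
Lemma nsteps_ge j : 8 * ((1 + 16 * 2 ^ j + cc) * L) <= S j.
Proof.
apply: leq_trans (leq_addr _ _); rewrite (expnD 2 j 9) mulnA leq_mul2r; apply/orP; right.
by rewrite -[2 ^ 9]/512; have := pow2_gt0 j; nia.
Qed.

Local Opaque nsteps.

Definition orient_run j (w : seq (coins m)) : global m := foldl (step e true j) (@global0 m) w.

Lemma state_orient (om : Om) j s : j <= L -> s <= S j ->
  state e om j s = orient_run j (take s om.1.1).
Proof.
move=> jL; elim: s => [|s IH] ls /=; first by rewrite take0.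
have sT : s < size om.1.1 by rewrite size_tuple; apply: leq_trans ls (nsteps_mono jL).
rewrite (take_nth (coins0 m) sT) /orient_run -cats1 foldl_cat /= (IH (ltnW ls)).
by rewrite /coins_at ls.
Qed.

Lemma state_match (om : Om) j s : j <= L -> s <= S j ->
  state e om j (S j + s)
  = foldl (step e false j) (orient_run j (take (S j) om.1.1)) (take s om.1.2).
Proof.
move=> jL; elim: s => [|s IH] ls; first by rewrite addn0 take0 state_orient.
have sT : s < size om.1.2 by rewrite size_tuple; apply: leq_trans ls (nsteps_mono jL).
rewrite addnS /= (take_nth (coins0 m) sT) -cats1 foldl_cat /= -(IH (ltnW ls)).
by rewrite /coins_at ltnNge leq_addr /= addKn.
Qed.

Lemma sound_state (om : Om) j s : sound e j (state e om j s).
Proof.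
elim: s => [|s IH] /=; first exact: sound0.
by case: (s < S j); [apply: inv_step_orient|apply: inv_step_match].
Qed.

Lemma sound_foldl orient j X w : sound e j X -> sound e j (foldl (step e orient j) X w).
Proof.
elim: w X => [|y w IH] X iX //=; apply: IH.
by case: orient; [apply: inv_step_orient|apply: inv_step_match].
Qed.

Definition sample_cap := 8 * (cc + 2) * L.

Definition sampling_ok j (w : seq (coins m)) : bool :=
  ~~ has_bad (step e true j) (oversampled j sample_cap) (@global0 m) (take (S j) w).

(** A step oversamples with probability at most [n * 2 ^ -sample_cap], thus at most
    [N ^ -(8 * cc + 15)], and there are at most [N ^ (cc + 14)] steps. *)
Lemma sampling_fails j : j <= L ->
  #|[set w : Coins | ~~ sampling_ok j w]| * N ^ cc <= #|{: Coins}|.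
Proof.
move=> jL.
have hb X : sound e j X ->
    #|[set y | oversampled j sample_cap X y]| * N ^ (8 * cc + 15) <= #|coins m|.
  move=> iX; rewrite -(leq_pmul2l (ltn0Sn m.+1)).
  have hk : 4 * nbuckets m <= sample_cap by rewrite /sample_cap; have := nbuckets_le m; nia.
  apply: leq_trans _ (oversampled_rare sym_e jL iX hk).
  rewrite mulnCA leq_mul2l; apply/orP; right.
  apply: leq_trans (leq_mul n_le_N (leqnn _)) _; rewrite -expnS -expnM leq_exp2l // /sample_cap.
  by nia.
have := chain_union (fun x y => @inv_step m e j sym_e irr_e true x y) hb (nsteps_mono jL) (sound0 e j).
have -> : [set w : Coins | has_bad (step e true j) (oversampled j sample_cap) (@global0 m) (take (S j) w)]
   = [set w : Coins | ~~ sampling_ok j w].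
  by apply/setP => w; rewrite !in_set negbK.
rewrite card_tuple; set E := #|_| => hE.
have p0 : 0 < N ^ (cc + 14) by rewrite !expn_gt0.
rewrite -(leq_pmul2l p0) mulnCA -expnD.
apply: leq_trans (_ : E * N ^ (8 * cc + 15) <= _).
  by rewrite leq_mul2l leq_exp2l ?orbT //; lia.
by apply: leq_trans hE _; rewrite leq_mul2r nsteps_le ?orbT.
Qed.

(** [sample_cap] bounds the sampled reports, and [nbuckets], at most [2 * L], bounds the
    announcements; together they are [Kc * L]. A matching step has a single token. *)
Lemma contrib_small (om : Om) j s u : j <= L -> sampling_ok j om.1.1 -> s < 2 * S j ->
  #|contrib_at e om j s u| <= Kc * L.
Proof.
move=> jL ok ls; rewrite /contrib_at /contrib; case: ifP => sS; last first.
  apply: leq_trans (_ : 1 <= _); last by rewrite muln_gt0 L_gt0 andbT addnS.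
  apply/card_le1_eqP => k k'; rewrite !in_set => /andP[/eqP p1 /eqP z1] /andP[/eqP p2 /eqP z2].
  rewrite [k]surjective_pairing [k']surjective_pairing; congr pair.
    by move: p2; rewrite p1 => -[].
  by apply: val_inj; rewrite /= z1 z2.
have iX := sound_state om j s; set X := state e om j s in iX *; set y := coins_at om j s.
pose K1 := [set k : key n (nbuckets m).+1 |
  (k.1 \in d_out (X u)) && (bucket j (y.1 (k.1, u)) == Some (val k.2))].
pose K2 := [set k : key n (nbuckets m).+1 | (k.2 == nbuckets m :> nat) && (k.1 \in d_out (X u) :\: d_old (X u))].
have sub : contrib_orient j y u (X u) \subset K1 :|: K2.
  apply/subsetP => k; rewrite in_setU !in_set => /orP[/and4P[-> _ _ ->]//|/andP[-> ->]].
  by rewrite orbT.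
apply: leq_trans (subset_leq_card sub) _; apply: leq_trans (leq_card_setU _ _) _.
rewrite mulnDl; apply: leq_add; last first.
  apply: leq_trans (nbuckets_le m); apply: leq_trans (inv_new iX u).
  rewrite -(card_in_imset (f := fst) (D := K2)); last first.
    move=> k k'; rewrite !in_set => /andP[/eqP h1 _] /andP[/eqP h2 _] h.
    rewrite [k]surjective_pairing [k']surjective_pairing h; congr pair.
    by apply: val_inj; rewrite /= h1 h2.
  by apply: subset_leq_card; apply/subsetP => v /imsetP[k + ->]; rewrite in_set => /andP[].
have sT : s < size (take (S j) om.1.1).
  by rewrite size_take size_tuple; case: ifP => // _; apply: leq_trans sS (nsteps_mono jL).
have := has_badPn (coins0 m) ok sT; rewrite negb_exists => /forallP/(_ u).
rewrite -ltnNge (take_takel _ (ltnW sS)) (nth_take _ sS).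
have -> : foldl (step e true j) (@global0 m) (take s om.1.1) = X.
  by rewrite /X (state_orient om jL (ltnW sS)).
have -> : nth (coins0 m) om.1.1 s = y by rewrite /y /coins_at sS.
move=> h; apply: leq_trans (ltnW h).
rewrite -(card_in_imset (f := fst) (D := K1)); last first.
  move=> k k'; rewrite !in_set => /andP[_ /eqP h1] /andP[_ /eqP h2] hk.
  rewrite [k]surjective_pairing [k']surjective_pairing hk; congr pair.
  by move: h1; rewrite hk h2 => -[h1]; apply: val_inj.
apply: subset_leq_card; apply/subsetP => v /imsetP[k + ->]; rewrite in_set => /andP[h1 /eqP h2].
by rewrite in_set h1 h2.
Qed.

Lemma state_coins (om om' : Om) j s : om.1 = om'.1 -> state e om j s = state e om' j s.
Proof. by move=> h; elim: s => [|s IH] //=; rewrite IH /coins_at h. Qed.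

(** The states depend on the coins only. Computing the contributors with this dummy placement makes
    them independent of the true one, so the placement can be averaged with the coins fixed. *)
Definition placement0 : Place := [ffun=> (modI _ 0, modI _ 0)].

Definition placement_ok j (om : Om) : bool :=
  [forall s : 'I_(2 * S j),
     balanced Q om.1 s (contrib_at e ((om.1, placement0) : Om) j s) om.2].

Lemma placement_ok_loads (om : Om) j s : placement_ok j om -> s < 2 * S j ->
  loads_ok Q e om j s.
Proof.
move=> /forallP ok ls; have := ok (Ordinal ls); rewrite /=.
have cE : contrib_at e ((om.1, placement0) : Om) j s = contrib_at e om j s.
  rewrite /contrib_at (state_coins (om' := om)) //.
rewrite cE => /andP[/forallP h1 /forallP h2].
have pE lev : placed (cc := cc) om.1 s (contrib_at e om j s) om.2 lev = place_at e om j s lev.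
  by rewrite /placed /place_at; case: om {ok h1 h2 cE}.
split=> [lev x lL|lev b x x' lL].
  have lL' : lev < L.+1 by [].
  by have := forallP (h1 (Ordinal lL')) x; rewrite pE.
have := forallP (forallP (forallP (h2 (Ordinal lL)) b) x) x'.
by rewrite !pE.
Qed.

(** Conditioning on the first component. *)
Lemma card_pairs_leq (A B' : finType) (P : pred (A * B')) (d k : nat) :
  (forall x, #|[set z | P (x, z)]| * d <= k * #|B'|) ->
  #|[set x | P x]| * d <= k * #|{: A * B'}|.
Proof.
move=> h; have -> : #|[set x | P x]| = \sum_x #|[set z | P (x, z)]|.
  rewrite card_set_sum; under [RHS]eq_bigr => x _ do rewrite card_set_sum.
  by rewrite pair_big /=; apply: eq_bigr => -[].
rewrite big_distrl /= card_prod mulnCA -sum_nat_const; apply: leq_sum => x _; exact: h.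
Qed.

Lemma placement_fails j : j <= L ->
  #|[set om : Om | sampling_ok j om.1.1 && ~~ placement_ok j om]| * N ^ cc <= #|Om|.
Proof.
move=> jL; rewrite -[#|Om|]mul1n.
apply: (@card_pairs_leq _ _ (fun om : Om => sampling_ok j om.1.1 && ~~ placement_ok j om)) => p.
rewrite mul1n; case ok : (sampling_ok j p.1) => /=; last first.
  by rewrite (_ : [set z | _] = set0) ?cards0 //; apply/setP => z; rewrite !inE.
pose E (s : 'I_(2 * S j)) (H : Place) :=
  ~~ balanced Q p s (contrib_at e ((p, placement0) : Om) j s) H.
have -> : [set H | ~~ placement_ok j ((p, H) : Om)] = [set H | [exists (s | xpredT s), E s H]].
  by apply/setP => H; rewrite !in_set negb_forall.
have h : #|[set H | [exists (s | xpredT s), E s H]]| * N ^ g <= 2 * S j * #|Place|.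
  rewrite -[2 * S j in X in _ <= X]card_ord.
  apply: card_exists_mul_leq => s _.
  have Kc_gt0 : 0 < Kc by rewrite addnS.
  apply: (unbalanced_rare Kc_gt0 rho_def Kc_le a_big Q_def Q1_big p s) => u.
  exact: (@contrib_small ((p, placement0) : Om)).
have p0 : 0 < N ^ (cc + 15) by rewrite !expn_gt0.
rewrite -(leq_pmul2l p0) mulnCA -expnD.
have -> : cc + 15 + cc = g by lia.
apply: leq_trans h _; rewrite leq_mul2r; apply/orP; right.
have -> : cc + 15 = (cc + 14).+1 by lia.
by rewrite [N ^ _.+1]expnS leq_mul // nsteps_le.
Qed.

Lemma card_fst_pred (A B' : finType) (P : pred A) :
  #|[set x : A * B' | P x.1]| = #|[set x | P x]| * #|B'|.
Proof.
rewrite -[#|B'|]cardsT -cardsX; apply: eq_card => -[x z].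
by rewrite in_setX in_setT andbT !in_set.
Qed.

(** Markov's inequality: a nonempty [remaining] has size at least 1, and the expected size after [t]
    steps is at most [N ^ 2 * N ^ -(cc + 2)]. *)
Lemma orient_fails j : j <= L ->
  (forall W, #|pairs_in e W| <= 2 * (2 ^ j * nbuckets m) * #|W|) \/ n <= cap_deg m j ->
  #|[set w : Coins | remaining e (orient_run j (take (S j).-1 w)) != set0]| * N ^ cc <= #|{: Coins}|.
Proof.
move=> jL hyp; set q := 2 ^ (j + 9); set t := (S j).-1.
have tT : t <= T by apply: leq_trans (leq_pred _) (nsteps_mono jL).
have hphi X (iX : sound e j X) := orient_decay sym_e irr_e jL iX hyp.
have dec := chain_decay (fun x y => @inv_step m e j sym_e irr_e true x y) hphi tT (sound0 e j).
have cnt : #|[set w : Coins | remaining e (orient_run j (take t w)) != set0]|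
    <= \sum_(w : Coins) #|remaining e (orient_run j (take t w))|.
  rewrite card_set_sum; apply: leq_sum => w _.
  by case: eqP => //= /eqP; rewrite -card_gt0.
apply: leq_trans (leq_mul cnt (leqnn _)) _; move: dec; rewrite -card_tuple.
set Sg := \sum_(w : Coins) _; rewrite -/q => dec.
have r0n : #|remaining e (@global0 m)| <= N ^ 2.
  apply: leq_trans (max_card _) _; rewrite card_prod card_ord -mulnn.
  exact: leq_mul.
(* The exponent [t] consists of [(cc + 2) * L] blocks of length [q], each a halving by
   [halving_exp]. *)
have hq : q.-1 ^ t * N ^ (cc + 2) <= q ^ t.
  have -> : N ^ (cc + 2) = 2 ^ ((cc + 2) * L) by rewrite -expnM mulnC.
  rewrite /t nsteps_pred -/q !(expnM _ q) -expnMn mulnC exp_mono //.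
  by have := halving_exp q.-1; rewrite prednK ?expn_gt0.
have p0 : 0 < q ^ t * N ^ 2 by rewrite muln_gt0 !expn_gt0.
rewrite -(leq_pmul2l p0).
apply: leq_trans (_ : q ^ t * Sg * N ^ (cc + 2) <= _).
  by rewrite expnD; apply: eq_leq; lia.
apply: leq_trans (leq_mul dec (leqnn _)) _.
apply: leq_trans (_ : q.-1 ^ t * N ^ (cc + 2) * (N ^ 2 * #|{: Coins}|) <= _).
  rewrite [X in X <= _](_ : _ = q.-1 ^ t * N ^ (cc + 2) * (#|remaining e (@global0 m)| * #|{: Coins}|)).
    by rewrite leq_mul2l leq_mul2r r0n !orbT.
  by rewrite mulnAC -!mulnA; congr muln; rewrite mulnC -mulnA.
by rewrite -[X in _ <= X]mulnA leq_mul.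
Qed.

(** Markov again. Initially each weight is at most 2 to the outdegree bound [16 * 2 ^ j * L], and
    [7 ^ 8] is at most half of [8 ^ 8]. *)
Lemma match_fails j X : j <= L -> sound e j X ->
  #|[set w : Coins | \sum_u weight (foldl (step e false j) X (take (S j) w) u) != 0]| * N ^ cc
    <= #|{: Coins}|.
Proof.
move=> jL iX; set t := S j; pose psi (X : global m) := \sum_u weight (X u).
have hpsi Y (iY : sound e j Y) : 8 * \sum_y psi (step e false j Y y) <= 7 * #|coins m| * psi Y.
  exact: match_decay.
have dec := chain_decay (fun x y => @inv_step m e j sym_e irr_e false x y) hpsi (nsteps_mono jL) iX.
have cnt : #|[set w : Coins | \sum_u weight (foldl (step e false j) X (take t w) u) != 0]|
    <= \sum_(w : Coins) psi (foldl (step e false j) X (take t w)).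
  rewrite card_set_sum; apply: leq_sum => w _.
  by rewrite -/(psi _); case: (psi _).
apply: leq_trans (leq_mul cnt (leqnn _)) _; move: dec; rewrite -card_tuple -/t.
set Sg := \sum_(w : Coins) _ => dec.
have psi0 : psi X <= N * 2 ^ (16 * 2 ^ j * L).
  apply: leq_trans (_ : \sum_(u < n) 2 ^ (16 * 2 ^ j * L) <= _).
    apply: leq_sum => u _; rewrite /weight; case: ifP => // _; rewrite leq_exp2l //.
    apply: leq_trans (subset_leq_card (inv_todo iX u)) _.
    apply: leq_trans (card_out sym_e u iX) _; rewrite /cap_deg.
    by have := nbuckets_le m; nia.
  by rewrite sum_nat_const card_ord leq_mul2r n_le_N orbT.
set r := (1 + 16 * 2 ^ j + cc) * L.
have hr : 2 ^ r = N * 2 ^ (16 * 2 ^ j * L) * N ^ cc.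
  by rewrite /r !mulnDl mul1n !expnD -expnM [L * cc]mulnC.
have h8 : 7 ^ t * 2 ^ r <= 8 ^ t.
  have h k l : 8 * k <= l -> 7 ^ l * 2 ^ k <= 8 ^ l.
    move=> /subnKC <-; rewrite !(expnD _ (8 * k)) mulnAC; apply: leq_mul; last exact: exp_mono.
    rewrite !(expnM _ 8) -expnMn mulnC; apply: exp_mono; exact: (halving_exp 7).
  exact/h/nsteps_ge.
have p0 : 0 < 8 ^ t * (N * 2 ^ (16 * 2 ^ j * L)) by rewrite !muln_gt0 !expn_gt0.
rewrite -(leq_pmul2l p0).
apply: leq_trans (_ : 8 ^ t * Sg * 2 ^ r <= _); first by rewrite hr; apply: eq_leq; lia.
apply: leq_trans (leq_mul dec (leqnn _)) _.
apply: leq_trans (_ : 7 ^ t * 2 ^ r * ((N * 2 ^ (16 * 2 ^ j * L)) * #|{: Coins}|) <= _).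
  rewrite [X in X <= _](_ : _ = 7 ^ t * 2 ^ r * (psi X * #|{: Coins}|)).
    by rewrite leq_mul2l leq_mul2r psi0 !orbT.
  by rewrite mulnAC -!mulnA; congr muln; rewrite mulnC -mulnA.
by rewrite -[X in _ <= X]mulnA leq_mul.
Qed.

(** Only stage [J] has to finish its work. The earlier ones must merely not overload the network: an
    unfinished stage is noticed by the final disjunction. *)
Definition good_until J (om : Om) : bool :=
  [&& [forall j : 'I_J.+1, sampling_ok j om.1.1 && placement_ok j om],
      remaining e (orient_run J (take (S J).-1 om.1.1)) == set0
    & \sum_u weight (state e om J (2 * S J) u) == 0].

(** Two bad events for each of the [J.+1] stages and two for stage [J]. The factor [N ^ 3] lost here
    is recovered by [cc = c + 3]. *)
Lemma good_until_likely J : J <= L ->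
  (forall W, #|pairs_in e W| <= 2 * (2 ^ J * nbuckets m) * #|W|) \/ n <= cap_deg m J ->
  #|[set om : Om | ~~ good_until J om]| * N ^ cc <= N ^ 3 * #|Om|.
Proof.
move=> JL hyp.
pose B1 := [set om : Om | [exists (j : 'I_J.+1 | xpredT j), ~~ sampling_ok j om.1.1]].
pose B2 := [set om : Om | [exists (j : 'I_J.+1 | xpredT j), sampling_ok j om.1.1 && ~~ placement_ok j om]].
pose B3 := [set om : Om | remaining e (orient_run J (take (S J).-1 om.1.1)) != set0].
pose B4 := [set om : Om | \sum_u weight (state e om J (2 * S J) u) != 0].
have sub : [set om : Om | ~~ good_until J om] \subset B1 :|: B2 :|: (B3 :|: B4).
  apply/subsetP => om; rewrite in_set !negb_and => /or3P[|h|h].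
  - rewrite negb_forall => /existsP[j]; rewrite negb_and => hj.
    rewrite in_setU; apply/orP; left; rewrite in_setU.
    case sj : (sampling_ok j om.1.1) hj => /= hj.
      by apply/orP; right; rewrite in_set; apply/existsP; exists j; rewrite sj.
    by apply/orP; left; rewrite in_set; apply/existsP; exists j; rewrite sj.
  - by rewrite !in_setU [om \in B3]in_set h orbT.
  by rewrite !in_setU [om \in B4]in_set h !orbT.
have jL (j : 'I_J.+1) : j <= L by apply: leq_trans JL; rewrite -ltnS.
have cOm : #|Om| = #|{: Coins}| * #|{: Coins}| * #|Place| by rewrite card_prod card_prod.
have lift (P : pred Coins) : #|[set w | P w]| * N ^ cc <= #|{: Coins}| ->
    #|[set om : Om | P om.1.1]| * N ^ cc <= #|Om|.
  move=> h; rewrite (@card_fst_pred _ _ (fun x : Coins * Coins => P x.1)) card_fst_pred cOm.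
  by rewrite mulnAC leq_mul2r mulnAC leq_mul2r h !orbT.
have J1 : #|(xpredT : pred 'I_J.+1)| <= N.
  by rewrite card_ord; apply: leq_trans (ltn_expl L (ltnSn 1)).
have b1 : #|B1| * N ^ cc <= N * #|Om|.
  apply: leq_trans (card_exists_mul_leq (k := #|Om|) _) _ => [j _|].
    by apply: (lift (fun w => ~~ sampling_ok j w)); apply: sampling_fails.
  by rewrite leq_mul2r J1 orbT.
have b2 : #|B2| * N ^ cc <= N * #|Om|.
  apply: leq_trans (card_exists_mul_leq (k := #|Om|) _) _ => [j _|].
    exact: placement_fails.
  by rewrite leq_mul2r J1 orbT.
have b3 : #|B3| * N ^ cc <= #|Om|.
  by apply: (lift (fun w : Coins => remaining e (orient_run J (take (S J).-1 w)) != set0)); apply: orient_fails.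
have b4 : #|B4| * N ^ cc <= #|Om|.
  pose P4 (x : Coins * Coins) := \sum_u weight
    (foldl (step e false J) (orient_run J (take (S J) x.1)) (take (S J) x.2) u) != 0.
  have -> : B4 = [set om : Om | P4 om.1].
    by apply/setP => om; rewrite !in_set /P4 mul2n -addnn state_match.
  rewrite card_fst_pred cOm mulnAC leq_mul2r; apply/orP; right.
  apply: leq_trans (@card_pairs_leq _ _ P4 (N ^ cc) 1 _) _ => [x|]; last by rewrite mul1n card_prod.
  by rewrite mul1n; apply: match_fails => //; apply: sound_foldl; exact: sound0.
apply: leq_trans (_ : (#|B1| + #|B2| + (#|B3| + #|B4|)) * N ^ cc <= _).
  rewrite leq_mul2r; apply/orP; right; apply: leq_trans (subset_leq_card sub) _.
  apply: leq_trans (leq_card_setU _ _) _.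
  by apply: leq_add; exact: leq_card_setU.
rewrite !mulnDl; apply: leq_trans (leq_add (leq_add b1 b2) (leq_add b3 b4)) _.
apply: leq_trans (_ : (N + N + 2) * #|Om| <= _); first by move: #|Om| => x; lia.
rewrite leq_mul2r; apply/orP; right.
by rewrite !expnS expn0; move: N_ge2; nia.
Qed.

Lemma good_until_final J (om : Om) : J <= L -> good_until J om ->
  ~~ [exists u, final_pending e om J u].
Proof.
move=> JL /and3P[_ /eqP rem0 /eqP w0]; rewrite negb_exists; apply/forallP => v.
have iS := sound_state om J.
rewrite /final_pending; apply: no_weight_no_pending (iS _) w0 _.
have S0 : 0 < S J := nsteps_gt0 J.
have keep s : s <= S J -> d_out (state e om J (S J + s) v) = d_out (state e om J (S J) v) /\
    d_in (state e om J (S J + s) v) = d_in (state e om J (S J) v).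
  elim: s => [|s IH] ls; first by rewrite addn0.
  have [<- <-] := IH (ltnW ls); rewrite addnS /= ltnNge leq_addr /=.
  by have [h1 _ h2 _] := fields_match e J (state e om J (S J + s)) (coins_at om J (S J + s)) v.
rewrite mul2n -addnn; have [-> ->] := keep _ (leqnn _).
have -> : S J = (S J).-1.+1 by rewrite prednK.
rewrite /= (_ : (S J).-1 < S J); last by rewrite prednK.
apply: (orient_complete sym_e irr_e) => //.
by rewrite state_orient // leq_pred.
Qed.
End Stage.

(** * The matching algorithm in the Node-Capacitated Clique *)

Definition power2 (k : nat) := exists i, k = 2 ^ i.

Lemma power2M a b : power2 a -> power2 b -> power2 (a * b).
Proof. by move=> [i ->] [k ->]; exists (i + k); rewrite expnD. Qed.

Lemma power2X a b : power2 a -> power2 (a ^ b).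
Proof. by move=> [i ->]; exists (i * b); rewrite expnM. Qed.

Section Final.
Variables (kappa c : nat).
Hypothesis kappa_gt0 : 0 < kappa.
Let cc := c + 3.
Let Kc := 8 * (cc + 2) + 2.
Let g := 2 * cc + 15.
Let r0 := 8 * Kc.
Let a0 := g + 3 + r0.
Let rho := a0 + r0.
Let Q := 2 * (g + 6).

Lemma power2_Omega m : power2 #|Omega cc rho m|.
Proof.
have p2 i : power2 (2 ^ i) by exists i.
have pB : power2 (nbuckets m) by exists (up_log 2 (lg m.+2)).
have pC : power2 #|coins m|.
  rewrite card_prod !card_ffun card_prod !card_ord card_bool.
  exact: power2M (power2X _ (power2M (p2 _) pB)) (p2 _).
have pP : power2 #|placement cc rho m|.
  by rewrite card_ffun; apply: power2X; rewrite card_prod !card_ord; exact: power2M.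
rewrite card_prod card_prod card_tuple.
exact: power2M (power2M (power2X _ pC) (power2X _ pC)) pP.
Qed.

Definition seed_bits (n : nat) : nat := if n is m.+2 then logn 2 #|Omega cc rho m| else 0.

Lemma card_seed m : #|{: {ffun 'I_(seed_bits m.+2) -> bool}}| = #|Omega cc rho m|.
Proof.
rewrite card_ffun card_bool card_ord /=.
by have [i ->] := power2_Omega m; rewrite pfactorK.
Qed.

Definition seed_decode m (om : {ffun 'I_(seed_bits m.+2) -> bool}) : Omega cc rho m :=
  enum_val (cast_ord (card_seed m) (enum_rank om)).

Lemma seed_decode_bij m : bijective (@seed_decode m).
Proof.
exists (fun x => enum_val (cast_ord (esym (card_seed m)) (enum_rank x))) => x.
  by rewrite /seed_decode enum_valK cast_ordK enum_rankK.
by rewrite /seed_decode enum_valK cast_ordKV enum_rankK.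
Qed.

Definition word m (k : nat) (p : packet m.+2 (lg m.+2) (nbuckets m).+1) : nat :=
  nth 0 [:: val p.1.1.1; val p.1.1.2; val p.1.2; val p.2.1.1; val p.2.1.2; val p.2.2] k.

Lemma nbuckets_lt m : nbuckets m < 2 ^ lg m.+2.
Proof.
rewrite ltn_exp2l //; have := lg_gt0 m; case: (lg m.+2) => // l _; rewrite ltnS.
by apply: up_log_min => //; exact: ltn_expl.
Qed.

Lemma word_lt m k (p : packet m.+2 (lg m.+2) (nbuckets m).+1) : word k p < 2 ^ lg m.+2.
Proof.
case: k => [|[|[|[|[|[|k]]]]]]; rewrite /word /=; try exact: ltn_ord.
- by apply: leq_trans (ltn_ord _) (leq_pow_lg m).
- by apply: leq_ltn_trans (nbuckets_lt m); rewrite -ltnS; exact: ltn_ord.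
by rewrite nth_nil pow2_gt0.
Qed.

Lemma word_inj m (p p' : packet m.+2 (lg m.+2) (nbuckets m).+1) :
  (forall k, k < 6 -> word k p = word k p') -> p = p'.
Proof.
move=> h; have := h 0 isT; have := h 1 isT; have := h 2 isT; have := h 3 isT; have := h 4 isT.
have := h 5 isT; rewrite /word /=; case: p p' {h} => [[[p1 p2] p3] [[p4 p5] p6]] [[[q1 q2] q3] [[q4 q5] q6]] /=.
by do 6 move=> /val_inj->.
Qed.

Definition matching_alg : NCCAlg kappa :=
  compiled kappa (sub_first rho Q) 6 word
    (fun m (om : {ffun 'I_(seed_bits m.+2) -> bool}) v nb => start (seed_decode om) v nb 0)
    (fun m => @emit cc rho Q m) (fun m => @absorb cc rho Q m)
    (fun m => @n_halt cc rho m) (fun m (x : node cc rho m) => d_mate (n_data x)).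

Lemma good_success m (e : rel 'I_m.+2) (adv : Adversary matching_alg m.+2)
    (om : Seed matching_alg m.+2) J T :
  symmetric e -> irreflexive e -> adversary_ok adv -> J <= lg m.+2 ->
  good_until Q e J (seed_decode om) ->
  stage_start cc m J.+1 * (#|{: subround rho Q}| * 6) <= T ->
  success e adv T om.
Proof.
move=> sym_e irr_e adv_ok JL good leT.
have ok j s : j <= J -> s < 2 * nsteps cc m j -> loads_ok Q e (seed_decode om) j s.
  move=> lj; apply: placement_ok_loads => //.
  have /and3P[/forallP h _ _] := good.
  by have lj' : j < J.+1 by []; have /andP[] := h (Ordinal lj').
have [j lj [traffic halts dataE fin]] := run_stages ok (good_until_final sym_e irr_e JL good).
apply: (compiled_success kappa_gt0 _ (@word_lt) (@word_inj) adv_ok (T := stage_start cc m j.+1)) => //.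
  apply: leq_trans leT; rewrite leq_mul2r; apply/orP; right.
  rewrite /stage_start (big_ord_widen _ (fun i => stage_len cc m i) (lj : j.+1 <= J.+1)).
  by rewrite big_mkcond /=; apply: leq_sum => i _; case: ifP.
apply: eq_maximal_matching (fun v => esym (congr1 (@d_mate m) (dataE v))) _.
apply: maximal_matching (sound_state sym_e irr_e _ _ _) _ => // v.
by move: fin; rewrite negb_exists => /forallP/(_ v).
Qed.

(** Stage lengths grow geometrically, so their sum is dominated by the last one. *)
Lemma stage_start_le m J :
  stage_start cc m J.+1 <= (2048 * (cc + 2) + 5) * (2 ^ J.+1 * lg m.+2 * lg m.+2).
Proof.
have L0 := lg_gt0 m.
have len i : stage_len cc m i <= (2048 * (cc + 2) + 5) * (2 ^ i * lg m.+2 * lg m.+2).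
  rewrite /stage_len /check_start /nsteps (expnD 2 i 9) -[2 ^ 9]/512.
  by have := pow2_gt0 i; move: (2 ^ i) (lg m.+2) L0 => x l; nia.
elim: J => [|J IH].
  by rewrite /stage_start big_ord1 (leq_trans (len 0)) // leq_mul2l !leq_mul2r !orbT.
rewrite /stage_start big_ord_recr -/(stage_start cc m J.+1) /=.
apply: leq_trans (leq_add IH (len J.+1)) _.
by rewrite -mulnDr -!mulnDl addnn -mul2n -expnS.
Qed.

(** [J] is the first stage whose guess is sure to reach [a], cut off at [L], where the cap already
    exceeds every degree. Rounding up to a power of two loses a factor 2, and summing the stages
    another. *)
Lemma last_stage m a : exists J, [/\ J <= lg m.+2,
  a <= 2 ^ J * nbuckets m \/ m.+2 <= cap_deg m J & 2 ^ J.+1 * lg m.+2 <= 4 * (a + lg m.+2)].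
Proof.
have L0 := lg_gt0 m; set l := lg m.+2; pose x := (a %/ l).+1.
have ax : a <= x * l by exact/ltnW/ltn_ceil.
have xa : x * l <= a + l by rewrite mulSn addnC leq_add2r leq_divM.
have le2 : 2 ^ up_log 2 x <= 2 * x.
  case: (ltnP 1 x) => x1; last by have -> : x = 1 by rewrite /x; lia.
  have := up_log_gtn (isT : 1 < 2) x1.
  have : 0 < up_log 2 x by rewrite up_log_gt0.
  by case: (up_log 2 x) => // i _ /=; rewrite expnS; lia.
exists (minn l (up_log 2 x)); split; first exact: geq_minl.
  case: (leqP l (up_log 2 x)) => h; [right|left].
    apply: leq_trans (leq_pow_lg m) _; rewrite /cap_deg mulnCA leq_pmulr //.
    by rewrite muln_gt0 nbuckets_gt0.
  by apply: leq_trans ax _; apply: leq_mul; [exact: up_logP|exact: nbuckets_ge].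
apply: leq_trans (_ : 2 * (2 * x) * l <= _); last by move: xa; lia.
rewrite leq_mul2r expnS leq_mul2l; apply/orP; right; apply: leq_trans le2.
by rewrite leq_exp2l // geq_minr.
Qed.

Lemma matching_alg_whp m (e : rel 'I_m.+2) a (adv : Adversary matching_alg m.+2) T :
  symmetric e -> irreflexive e -> forest_decomposable e a -> adversary_ok adv ->
  4 * (2048 * (cc + 2) + 5) * (#|{: subround rho Q}| * 6) * (a + lg m.+2) * lg m.+2 <= T ->
  #|[set om : Seed matching_alg m.+2 | ~~ success e adv T om]| * m.+2 ^ c <= 2 ^ seed_bits m.+2.
Proof.
move=> sym_e irr_e arb adv_ok leT; have [J [JL hJ timeJ]] := last_stage m a.
have leT' : stage_start cc m J.+1 * (#|{: subround rho Q}| * 6) <= T.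
  apply: leq_trans leT; apply: leq_trans (leq_mul (stage_start_le m J) (leqnn _)) _.
  move: #|{: subround rho Q}| (2048 * (cc + 2) + 5) (lg m.+2) (2 ^ J.+1) timeJ => s d l p h.
  have -> : d * (p * l * l) * (s * 6) = d * (s * 6) * l * (p * l) by nia.
  have -> : 4 * d * (s * 6) * (a + l) * l = d * (s * 6) * l * (4 * (a + l)) by nia.
  by rewrite leq_mul2l h orbT.
have sparse : (forall W, #|pairs_in e W| <= 2 * (2 ^ J * nbuckets m) * #|W|) \/ m.+2 <= cap_deg m J.
  case: hJ => [ha|]; [left=> W|by right].
  by apply: leq_trans (arboricity_sparse W sym_e irr_e arb) _; rewrite leq_mul2r leq_mul2l ha !orbT.
have Kc_le : 8 * Kc <= 2 ^ r0 by exact/ltnW/ltn_expl.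
have Q_def : Q.+2 = 2 * (g + 7) by rewrite /Q; lia.
have := good_until_likely sym_e irr_e (erefl rho) Kc_le (leqnn _) Q_def (leqnn _) JL sparse.
rewrite -(card_preim_bij _ (@seed_decode_bij m)) => bound.
have N0 : 0 < (2 ^ lg m.+2) ^ 3 by rewrite !expn_gt0.
have -> : 2 ^ seed_bits m.+2 = #|Omega cc rho m| by rewrite -card_seed card_ffun card_bool card_ord.
rewrite -(leq_pmul2l N0); apply: leq_trans bound.
have -> : (2 ^ lg m.+2) ^ cc = (2 ^ lg m.+2) ^ 3 * (2 ^ lg m.+2) ^ c by rewrite -expnD addnC.
rewrite mulnCA; apply: leq_mul; last by rewrite leq_mul2l exp_mono ?orbT ?leq_pow_lg.
apply: subset_leq_card; apply/subsetP => om; rewrite !in_set; apply: contra => good.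
exact: good_success JL good leT'.
Qed.

Lemma matching_alg_single (e : rel 'I_1) (adv : Adversary matching_alg 1) T om :
  irreflexive e -> success e adv T om.
Proof.
move=> irr_e; apply/andP; split; first by apply/forallP.
apply/andP; split; apply/forallP => u; apply/forallP => v; apply/implyP => //.
by rewrite (ord1 u) (ord1 v) irr_e.
Qed.
End Final.

Theorem theorem5p5 :
  forall kappa : nat, 0 < kappa ->
  forall c : nat, 0 < c ->
  exists (A : NCCAlg kappa) (C : nat),
    forall (n : nat) (e : rel 'I_n),
      symmetric e -> irreflexive e ->
      forall a : nat, arboricity e a ->
      forall adv : Adversary A n, adversary_ok adv ->
        #|[set om : Seed A n | ~~ success e adv (C * (a + lg n) * lg n) om]| * n ^ c
          <= 2 ^ rbits A n.
Proof.
move=> kappa kappa_gt0 c c_gt0.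
(* [C] stays open until the last line, where unification takes it from the time hypothesis of
   [matching_alg_whp]. *)
exists (matching_alg kappa c); eexists => n e sym_e irr_e a [arb _] adv adv_ok.
case: n e sym_e irr_e arb adv adv_ok => [|[|m]] e sym_e irr_e arb adv adv_ok.
- by rewrite exp0n // muln0.
- rewrite (_ : [set om | _] = set0) ?cards0 //; apply/setP => om.
  by rewrite in_set0 in_set matching_alg_single.
exact: (matching_alg_whp kappa_gt0 sym_e irr_e arb adv_ok (leqnn _)).
Qed.
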